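(* Let $\varepsilon\in(0,\varepsilon_0)$ and $$\rho_0^\varepsilon\in C(\overline{\Omega_\varepsilon(0)}),\quad f^\varepsilon\in C(Q_{\varepsilon,T}),\quad \psi^\varepsilon\in C(\partial_\ell Q_{\varepsilon,T}).$$ Let $\rho^\varepsilon$ be a classical solution to $$\partial_t\rho^\varepsilon-k_d\Delta\rho^\varepsilon=f^\varepsilon\text{ in }Q_{\varepsilon,T},\qquad \partial_{\nu_\varepsilon}\rho^\varepsilon+k_d^{-1}V_\varepsilon\rho^\varepsilon=\psi^\varepsilon\text{ on }\partial_\ell Q_{\varepsilon,T},\qquad \rho^\varepsilon|_{t=0}=\rho_0^\varepsilon\text{ in }\Omega_\varepsilon(0).$$ Then there exists a constant $c_T>0$ depending on $T$ but independent of $\varepsilon$, $\rho_0^\varepsilon$, $f^\varepsilon$, $\psi^\varepsilon$, and $\rho^\varepsilon$ such that $$\|\rho^\varepsilon\|_{C(\overline{Q_{\varepsilon,T}})}\le c_T\left(\|\rho_0^\varepsilon\|_{C(\overline{\Omega_\varepsilon(0)})}+\|f^\varepsilon\|_{C(Q_{\varepsilon,T})}+\frac1\varepsilon\|\psi^\varepsilon\|_{C(\partial_\ell Q_{\varepsilon,T})}\right)$$ provided that the right-hand side is finite.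
   Context: Moving surface. Let $n\ge2$, $T>0$. For each $t\in[0,T]$, $\Gamma(t)\subset\mathbb{R}^n$ is a given closed (compact, without boundary), connected, oriented smooth hypersurface with unit outward normal vector field $\nu(\cdot,t)$. There is a smooth mapping $\Phi\colon\Gamma(0)\times[0,T]\to\mathbb{R}^n$ with $\Phi(\cdot,0)=\mathrm{Id}$ such that $\Phi(\cdot,t)$ is a diffeomorphism from $\Gamma(0)$ onto $\Gamma(t)$ for each $t$. Set $S_T=\bigcup_{t\in(0,T]}\Gamma(t)\times\{t\}$ and $\overline{S_T}=(\Gamma(0)\times\{0\})\cup S_T$. Let $d(\cdot,t)$ be the signed distance function from $\Gamma(t)$ increasing in the direction of $\nu(\cdot,t)$. Fix $\delta>0$ independent of $t$ such that, with $\overline{N(t)}=\{x\in\mathbb{R}^n: -\delta\le d(x,t)\le\delta\}$ and $\overline{N_T}=\bigcup_{t\in[0,T]}\overline{N(t)}\times\{t\}$, for each $(x,t)\in\overline{N_T}$ there is a unique $\pi(x,t)\in\Gamma(t)$ with $x=\pi(x,t)+d(x,t)\nu(\pi(x,t),t)$ and $\nabla d(x,t)=\nu(\pi(x,t),t)$, the maps $d,\pi$ are smooth on $\overline{N_T}$, and $c_0^{-1}\le1-r\kappa_\alpha(y,t)\le c_0$ for all $(y,t)\in\overline{S_T}$, $r\in[-\delta,\delta]$, $\alpha=1,\dots,n-1$ with some constant $c_0>0$, where $\kappa_1,\dots,\kappa_{n-1}$ are the principal curvatures of $\Gamma(t)$ (the eigenvalues, other than the eigenvalue $0$ in the direction $\nu$,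 of $W=-\nabla^2d$ on $\Gamma(t)$). Moving thin domain. $g_0,g_1$ are smooth functions on $\overline{S_T}$ such that $g=g_1-g_0\ge c$ on $\overline{S_T}$ for some constant $c>0$. Fix $\varepsilon_0\in(0,1)$ with $\varepsilon|g_i|\le\delta$ on $\overline{S_T}$ for all $\varepsilon\in(0,\varepsilon_0)$, $i=0,1$. For $t\in[0,T]$ let $\Omega_\varepsilon(t)=\{y+r\nu(y,t): y\in\Gamma(t),\ \varepsilon g_0(y,t)<r<\varepsilon g_1(y,t)\}$, $Q_{\varepsilon,T}=\bigcup_{t\in(0,T]}\Omega_\varepsilon(t)\times\{t\}$, $\partial_\ell Q_{\varepsilon,T}=\bigcup_{t\in(0,T]}\partial\Omega_\varepsilon(t)\times\{t\}$, $\overline{Q_{\varepsilon,T}}=\bigcup_{t\in[0,T]}\overline{\Omega_\varepsilon(t)}\times\{t\}$. $\nu_\varepsilon$ and $V_\varepsilon$ are the unit outward normal vector field and the scalar outer normal velocity of $\partial\Omega_\varepsilon(t)$, and $\partial_{\nu_\varepsilon}=\nu_\varepsilon\cdot\nabla$. The diffusion coefficient $k_d>0$ is a constant independent of $\varepsilon$. Classical solution means: $\rho^\varepsilon\in C(\overline{Q_{\varepsilon,T}})$, $\partial_i\rho^\varepsilon\in C(Q_{\varepsilon,T}\cup\partial_\ell Q_{\varepsilon,T})$, $\partial_t\rho^\varepsilon,\partial_i\partial_j\rho^\varepsilon\in C(Q_{\varepsilon,T})$ for all $i,j=1,\dots,n$, and the problem is satisfied pointwise. $\|\cdot\|_{C(X)}$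 is the supremum of the absolute value over $X$. *)

(* Defs.v *)
From HB Require Import structures.
From mathcomp Require Import all_boot all_order all_algebra.
From mathcomp Require Import all_classical all_reals all_analysis.
Set Implicit Arguments.
Unset Strict Implicit.
Unset Printing Implicit Defensive.
Import Order.TTheory GRing.Theory Num.Theory numFieldNormedType.Exports.
Local Open Scope classical_set_scope.
Local Open Scope ring_scope.

(* The library norm on 'rV[R]_n is the max norm (same topology); lengths and
   distances below are Euclidean. *)
Definition dotp (R : realType) (n : nat) (x y : 'rV[R]_n) : R :=
  \sum_(i < n) x 0 i * y 0 i.

Definition enorm (R : realType) (n : nat) (x : 'rV[R]_n) : R :=
  Num.sqrt (dotp x x).

Definition grad (R : realType) (n : nat) (f : 'rV[R]_n -> R) (x : 'rV[R]_n)
    : 'rV[R]_n :=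
  \row_(i < n) 'D_(delta_mx 0 i) f x.

Definition hess (R : realType) (n : nat) (f : 'rV[R]_n -> R) (x : 'rV[R]_n)
    : 'M[R]_n :=
  \matrix_(i < n, j < n) 'D_(delta_mx 0 i) ('D_(delta_mx 0 j) f) x.

Definition frontier (X : topologicalType) (A : set X) : set X :=
  closure A `\` interior A.

Definition supnorm (R : realType) (X : Type) (A : set X) (f : X -> R) : \bar R :=
  ereal_sup [set `|f p|%:E | p in A].

(* C^k on an open set U of a finite-dimensional space: all directional
   derivatives up to order k exist and are continuous. *)
Fixpoint Ck (R : realType) (V W : normedModType R) (k : nat) (U : set V)
    (f : V -> W) : Prop :=
  {within U, continuous f} /\
  (if k is k'.+1 then
     forall v : V, (forall x, U x -> derivable f x v) /\ Ck k' U ('D_v f)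
   else True).

(* Smoothness on an arbitrary subset (hypersurface, space-time surface with
   closed time interval, closed tube): local smooth extendability. *)
Definition smooth_on (R : realType) (V W : normedModType R) (X : set V)
    (f : V -> W) : Prop :=
  forall p, X p -> exists (U : set V) (g : V -> W),
    [/\ open U, U p, (forall k, Ck k U g) &
        forall q, U q -> X q -> f q = g q].

Definition diffeo_onto (R : realType) (V W : normedModType R) (A : set V)
    (B : set W) (f : V -> W) : Prop :=
  smooth_on A f /\ exists g : W -> V,
    [/\ smooth_on B g,
        forall x, A x -> B (f x),
        forall y, B y -> A (g y),
        forall x, A x -> g (f x) = x &
        forall y, B y -> f (g y) = y].

Definition smooth_hypersurface (R : realType) (n : nat) (M : set 'rV[R]_n)
    : Prop :=
  M !=set0 /\
  forall p, M p -> exists (U : set 'rV[R]_n) (phi : 'rV[R]_n -> R),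
    [/\ open U, U p, (forall k, Ck k U phi),
        (forall x, U x -> grad phi x != 0) &
        forall x, U x -> (M x <-> phi x = 0)].

Definition tangent (R : realType) (n : nat) (M : set 'rV[R]_n)
    (x w : 'rV[R]_n) : Prop :=
  exists c : R -> 'rV[R]_n,
    [/\ c 0 = x, is_derive (0 : R) 1 c w & \forall s \near (0 : R), M (c s)].

(* v is the unit normal at x to the hypersurface M, the boundary of the domain
   D, pointing out of D. *)
Definition outward_unit_normal (R : realType) (n : nat) (D M : set 'rV[R]_n)
    (x v : 'rV[R]_n) : Prop :=
  [/\ enorm v = 1,
      forall w, tangent M x w -> dotp v w = 0 &
      \forall s \near (0 : R)^'+, D (x - s *: v) /\ ~ closure D (x + s *: v)].

(* For a closed connected hypersurface, the bounded component of its
   complement. *)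
Definition inside (R : realType) (n : nat) (M : set 'rV[R]_n)
    : set 'rV[R]_n :=
  [set x | ~ M x /\ bounded_set (connected_component (~` M) x)].

Definition edistance (R : realType) (n : nat) (x : 'rV[R]_n)
    (M : set 'rV[R]_n) : R :=
  inf [set enorm (x - y) | y in M].

(* Negative inside, positive outside: increasing along the outward normal. *)
Definition sdist (R : realType) (n : nat) (M : set 'rV[R]_n) (x : 'rV[R]_n)
    : R :=
  if x \in inside M then - edistance x M else edistance x M.

Definition slab (R : realType) (n : nat) (I : set R) (A : R -> set 'rV[R]_n)
    : set ('rV[R]_n * R) :=
  [set p | I p.2 /\ A p.2 p.1].

Record moving_surface (R : realType) (n : nat) (T : R)
    (Gam : R -> set 'rV[R]_n) (nu Phi : 'rV[R]_n * R -> 'rV[R]_n) : Prop := {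
  ms_compact : forall t, 0 <= t <= T -> compact (Gam t);
  ms_connected : forall t, 0 <= t <= T -> connected (Gam t);
  ms_hypersurface : forall t, 0 <= t <= T -> smooth_hypersurface (Gam t);
  ms_normal : forall t y, 0 <= t <= T -> Gam t y ->
    outward_unit_normal (inside (Gam t)) (Gam t) y (nu (y, t));
  ms_smooth : smooth_on (Gam 0 `*` `[0, T]) Phi;
  ms_id : forall y, Gam 0 y -> Phi (y, 0) = y;
  ms_diffeo : forall t, 0 <= t <= T ->
    diffeo_onto (Gam 0) (Gam t) (fun y => Phi (y, t)) }.

(* k is an eigenvalue of W = - hess d with an eigenvector orthogonal to the
   normal v (W is symmetric, with the eigenvalue 0 in the direction v). *)
Definition principal_curvature (R : realType) (n : nat) (d : 'rV[R]_n -> R)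
    (y v : 'rV[R]_n) (k : R) : Prop :=
  exists w : 'rV[R]_n,
    [/\ w != 0, dotp w v = 0 & w *m (- hess d y) = k *: w].

Definition tube (R : realType) (n : nat) (Gam : R -> set 'rV[R]_n) (delta : R)
    (t : R) : set 'rV[R]_n :=
  [set x | - delta <= sdist (Gam t) x <= delta].

Record tubular_neighborhood (R : realType) (n : nat) (T : R)
    (Gam : R -> set 'rV[R]_n) (nu : 'rV[R]_n * R -> 'rV[R]_n) (delta : R)
    (proj : 'rV[R]_n * R -> 'rV[R]_n) : Prop := {
  tn_pos : 0 < delta;
  tn_proj : forall x t, 0 <= t <= T -> tube Gam delta t x ->
    unique (fun y => [/\ Gam t y,
                         x = y + sdist (Gam t) x *: nu (y, t),
                         differentiable (sdist (Gam t)) x &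
                         grad (sdist (Gam t)) x = nu (y, t)])
           (proj (x, t));
  tn_smooth_dist : smooth_on (slab `[0, T] (tube Gam delta))
    (fun p : 'rV[R]_n * R => sdist (Gam p.2) p.1);
  tn_smooth_proj : smooth_on (slab `[0, T] (tube Gam delta)) proj;
  tn_curvature : exists2 c0 : R, 0 < c0 &
    forall t y r k, 0 <= t <= T -> Gam t y -> - delta <= r <= delta ->
      principal_curvature (sdist (Gam t)) y (nu (y, t)) k ->
      c0^-1 <= 1 - r * k <= c0 }.

Record thin_width (R : realType) (n : nat) (T : R)
    (Gam : R -> set 'rV[R]_n) (delta : R) (g0 g1 : 'rV[R]_n * R -> R)
    (eps0 : R) : Prop := {
  tw_smooth0 : smooth_on (slab `[0, T] Gam) g0;
  tw_smooth1 : smooth_on (slab `[0, T] Gam) g1;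
  tw_gap : exists2 c : R, 0 < c &
    forall p, slab `[0, T] Gam p -> c <= g1 p - g0 p;
  tw_eps0 : 0 < eps0 < 1;
  tw_fit : forall eps p, 0 < eps < eps0 -> slab `[0, T] Gam p ->
    eps * `|g0 p| <= delta /\ eps * `|g1 p| <= delta }.

Definition thin_domain (R : realType) (n : nat) (Gam : R -> set 'rV[R]_n)
    (nu : 'rV[R]_n * R -> 'rV[R]_n) (g0 g1 : 'rV[R]_n * R -> R) (eps t : R)
    : set 'rV[R]_n :=
  [set x | exists y r, [/\ Gam t y, eps * g0 (y, t) < r < eps * g1 (y, t) &
                           x = y + r *: nu (y, t)]].

(* v is the normal velocity of the moving hypersurface M(.), s in [0, T], at
   the point x of M(t) in the direction u: the u-component of the velocity of
   any curve carried by M(.). The curve is only constrained for s in [0, T],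
   so that at t = T its velocity is determined by s <= T. *)
Definition normal_velocity (R : realType) (n : nat) (T : R)
    (M : R -> set 'rV[R]_n) (t : R) (x u : 'rV[R]_n) (v : R) : Prop :=
  let carried (c : R -> 'rV[R]_n) (w : 'rV[R]_n) :=
    [/\ c t = x, is_derive t 1 c w &
        \forall s \near t, 0 <= s <= T -> M s (c s)] in
  (exists c w, carried c w) /\
  (forall c w, carried c w -> v = dotp w u).

(* Derivative at t of a function of time considered on times <= T only:
   two-sided for t < T, one-sided at t = T. *)
Definition is_time_derivative (R : realType) (T : R) (f : R -> R) (t l : R)
    : Prop :=
  (fun h => h^-1 * (f (t + h) - f t)) @ within [set h | t + h <= T] (0 : R)^'
    --> l.

(* Here Om t is the domain at time t. The field gr is the spatial gradient of
   rho in the interior, together with its continuous extension to the lateral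
   boundary; rt is the time derivative. *)
Record classical_solution_with (R : realType) (n : nat) (T kd : R)
    (Om : R -> set 'rV[R]_n) (nu : 'rV[R]_n * R -> 'rV[R]_n)
    (vel : 'rV[R]_n * R -> R) (rho0 : 'rV[R]_n -> R)
    (f psi rho : 'rV[R]_n * R -> R)
    (gr : 'rV[R]_n * R -> 'rV[R]_n) (rt : 'rV[R]_n * R -> R) : Prop := {
  cs_cont : {within slab `[0, T] (fun t => closure (Om t)), continuous rho};
  cs_grad : forall x t i, slab `]0, T] Om (x, t) ->
    is_derive x (delta_mx 0 i) (fun z => rho (z, t)) (gr (x, t) 0 i);
  cs_grad_cont :
    {within slab `]0, T] Om `|` slab `]0, T] (fun t => frontier (Om t)),
      continuous gr};
  cs_hess : forall x t i j, slab `]0, T] Om (x, t) ->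
    derivable ('D_(delta_mx 0 j) (fun z => rho (z, t))) x (delta_mx 0 i);
  cs_hess_cont : forall i j, {within slab `]0, T] Om, continuous
    (fun p : 'rV[R]_n * R => hess (fun z => rho (z, p.2)) p.1 i j)};
  cs_time : forall x t, slab `]0, T] Om (x, t) ->
    is_time_derivative T (fun s => rho (x, s)) t (rt (x, t));
  cs_time_cont : {within slab `]0, T] Om, continuous rt};
  cs_equation : forall x t, slab `]0, T] Om (x, t) ->
    rt (x, t) - kd * \tr (hess (fun z => rho (z, t)) x) = f (x, t);
  cs_boundary : forall p, slab `]0, T] (fun t => frontier (Om t)) p ->
    dotp (nu p) (gr p) + kd^-1 * vel p * rho p = psi p;
  cs_initial : forall x, Om 0 x -> rho (x, 0) = rho0 x }.

Definition classical_solution (R : realType) (n : nat) (T kd : R)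
    (Om : R -> set 'rV[R]_n) (nu : 'rV[R]_n * R -> 'rV[R]_n)
    (vel : 'rV[R]_n * R -> R) (rho0 : 'rV[R]_n -> R)
    (f psi rho : 'rV[R]_n * R -> R) : Prop :=
  exists gr rt, classical_solution_with T kd Om nu vel rho0 f psi rho gr rt.

(* Main.v *)
Require Import Defs.
From HB Require Import structures.
From mathcomp Require Import all_boot all_order all_algebra.
From mathcomp Require Import all_classical all_reals all_analysis.
From mathcomp Require Import ring lra.
Set Implicit Arguments.
Unset Strict Implicit.
Unset Printing Implicit Defensive.
Import Order.TTheory GRing.Theory Num.Theory numFieldNormedType.Exports.
Local Open Scope classical_set_scope.
Local Open Scope ring_scope.

(** The estimate is a weak maximum principle applied to the quotient of the
    solution by a barrier [Psi], and the whole difficulty is that the Robin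
    coefficient [Ve / kd] has no sign.

    Write [d] for the signed distance, extend the widths by [Gi (x, t) =
    gi (proj (x, t), t)], and put
      [Psi = exp (lam t + phi)],
      [phi = (d_t d) d / kd + A (d - eps G0) (d - eps G1)].
    On the component [d = eps Gi] of the lateral boundary the unit normal is
    proportional to the gradient of [d - eps Gi] and the normal velocity to its
    time derivative ([side_normal], [side_velocity]). Since [d_t d] is minus the
    velocity of the surface, the first term of [phi] removes the part of order one
    of [Ve / kd], which has opposite signs on the two components. The remainder is
    of order [eps]. The second term of [phi] has outward normal derivative at least
    [A eps c] on both components, [c] being the lower bound of the width, so for [A]
    large [Psi] satisfies the Robin condition with right-hand side at least
    [eps Psi]; this is [potential_lateral], and it is where the factor [1 / eps] in
    front of [psi] comes from. The derivatives of [phi] are bounded uniformly in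
    [eps], so a large [lam] makes [Psi] a strict supersolution of the heat equation
    ([barrier_exists]).

    If [M] is the maximum of [rho / Psi], then [rho - M Psi] is nonpositive and
    vanishes at the maximum point. There the first and second order conditions
    bound [M] by the initial datum, by [f], or by [psi / eps], according to whether
    the point is initial, interior or lateral ([interior_max], [lateral_max],
    [comparison]). At a lateral point only the inward normal segment is used,
    because the gradient is merely continuous up to the boundary.

    Two facts about the geometry are needed. The first is that [d (y + r nu) = r]
    for [|r| < delta], which is not part of the definition of the tubular
    neighbourhood. It follows from [|grad d| = 1] alone: by maximising
    [d - c |. - y|] over a ball for every [c < 1] one finds a point of the sphere
    where [d] has grown by the full radius, the segment to that point is a ray of
    [d], and its direction must be the gradient ([eikonal_line]). The second is
    boundedness of derivatives up to [t = 0], [t = T] and [|d| = delta], where they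
    may only be one-sided. All coefficients are therefore handled as functions on
    the open set [0 < t < T, |d| < delta] with smooth local extensions at every
    point of a compact set containing it ([extendable]). Consequently the
    comparison is carried out on [[tau, t1]] with [0 < tau] and [t1 < T]; the
    limits [tau -> 0] and [t -> T] use the continuity of [rho] only
    ([initial_layer], [final_time]). *)

(** * Differentiability from partial derivatives *)

Section line.
Variables (R : realType) (V W : normedModType R).

Lemma is_derive_line (f : V -> W) x v s df :
  is_derive (x + s *: v) v f df <->
  is_derive s (1 : R) (fun u : R => f (x + u *: v)) df.
Proof.
set g := fun u : R => _.
have E : (fun h : R => h^-1 *: ((f \o shift (x + s *: v)) (h *: v) - f (x + s *: v)))
  = (fun h : R => h^-1 *: ((g \o shift s) (h *: (1 : R)) - g s)).
  apply/funext => h /=; rewrite /g; congr (_ *: (f _ - _)).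
  by rewrite [h *: (1 : R)]mulr1 scalerDl addrCA.
have D1 : derivable f (x + s *: v) v = derivable g s 1 by rewrite /derivable E.
have D2 : 'D_v f (x + s *: v) = 'D_1 g s by rewrite /derive E.
split=> -[d e]; apply: DeriveDef; first by rewrite -D1.
- by rewrite -D2.
- by rewrite D1.
- by rewrite D2.
Qed.

Lemma is_derive_curve (f : V -> W) (c : R -> V) s w :
  differentiable f (c s) -> is_derive s (1 : R) c w ->
  is_derive s (1 : R) (f \o c) ('D_w f (c s)).
Proof.
move=> df [dc cw]; have dc' : differentiable c s by apply/derivable1_diffP.
have dfc : differentiable (f \o c) s by apply: differentiable_comp.
apply: DeriveDef; first exact: diff_derivable.
have cE : 'd c s 1 = w by rewrite -deriveE.
by rewrite deriveE// diff_comp//= cE -deriveE.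
Qed.

End line.

Lemma is_derive_scale_dir (R : realType) (V W : normedModType R) (f : V -> W) x v a df :
  is_derive x v f df -> is_derive x (a *: v) f (a *: df).
Proof.
move=> H.
have H0 : is_derive (0:R) (1:R) (fun u : R => f (x + u *: v)) df.
  by apply: (is_derive_line f x v 0 df).1; rewrite scale0r addr0.
suff : is_derive (x + (0 : R) *: (a *: v)) (a *: v) f (a *: df).
  by rewrite scale0r addr0.
apply: (is_derive_line f x (a *: v) 0 (a *: df)).2.
set g := fun u : R => f (x + u *: v) in H0.
have d0 : differentiable g (0 * a : R).
  by rewrite mul0r; apply/derivable1_diffP; case: H0.
have da : is_derive (0:R) (1:R) (fun u : R => u * a) a.
  have := @is_derive_id _ _ (0:R) (1:R); move=> hid.
  have := @is_deriveM _ _ id (cst a) (0:R) (1:R) _ _ hid (is_derive_cst _ _ _).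
  by move=> h; apply: (is_derive_eq h); rewrite scaler0 add0r /cst [_ *: _]mulr1.
rewrite (_ : (fun u : R => _) = g \o (fun u : R => u * a)); last first.
  by apply/funext => u; rewrite /g /= scalerA.
have gE : 'd g (0 * a : R) 1 = df.
  by rewrite -deriveE//; move: H0; rewrite -[X in is_derive X _ _ _](mul0r a) => -[].
have -> : a *: df = 'D_a g (0 * a).
  by rewrite deriveE// -gE -linearZ; congr ('d _ _ _); rewrite [_ *: _]mulr1.
exact: (@is_derive_curve _ _ _ g (fun u : R => u * a) 0 a d0 da).
Qed.

Section partials.
Variables (R : realType) (V : normedModType R) (m : nat).
Variables (e : 'I_m -> V) (c : 'I_m -> V -> R).
Hypothesis c_linear : forall i, linear (c i : V -> R^o).
Hypothesis c_basis : forall v, v = \sum_(i < m) c i v *: e i.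
Hypothesis c_bounded : forall i v, `|c i v| <= `|v|.

Lemma increment_bound (f : V -> R) x v (df k : R) :
  0 <= k ->
  (forall s : R, 0 <= s <= 1 -> derivable f (x + s *: v) v) ->
  (forall s : R, 0 <= s <= 1 -> `|'D_v f (x + s *: v) - df| <= k) ->
  `|f (x + v) - f x - df| <= k.
Proof.
move=> k0 fd fb; pose g (u : R) := f (x + u *: v).
have gd (s : R) : 0 <= s <= 1 -> is_derive s (1 : R) g ('D_v f (x + s *: v)).
  by move=> s01; apply: (is_derive_line f x v s _).1; apply: derivableP; exact: fd.
have := @MVT_segment R g (fun s => 'D_v f (x + s *: v)) 0 1 ler01.
case.
- move=> s; rewrite in_itv/= => /andP[s0 s1]; apply: gd.
  by rewrite !ltW.
- apply: derivable_within_continuous => s; rewrite in_itv/= => s01.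
  by case: (gd s s01).
- move=> s; rewrite in_itv/= => s01; rewrite subr0 mulr1 /g scale1r scale0r addr0.
  by move=> ->; apply: fb.
Qed.

(** The increment is split into steps along the vectors [e i], and the mean value
    theorem controls each step. *)
Lemma differentiable_partials (f : V -> R) x :
  (forall i, \forall y \near x, derivable f y (e i)) ->
  (forall i, {for x, continuous ('D_(e i) f)}) ->
  differentiable f x /\ forall v, 'D_v f x = \sum_(i < m) c i v * 'D_(e i) f x.
Proof.
move=> fd fc; pose L (v : V) : R^o := \sum_(i < m) c i v * 'D_(e i) f x.
have Llin : linear L.
  move=> a u v; rewrite /L scaler_sumr -big_split; apply: eq_bigr => i _ /=.
  by rewrite c_linear mulrDl; congr (_ + _); rewrite /GRing.scale/= mulrA.
pose LL : {linear V -> R^o} := HB.pack L (GRing.isLinear.Build _ _ _ _ L Llin).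
pose C := 1 + \sum_(i < m) `|'D_(e i) f x|.
have Lcont : continuous LL.
  apply/bounded_linear_continuous.
  apply/linear_boundedP; near=> r => v.
  apply: (@le_trans _ _ (C * `|v|)); last by rewrite ler_wpM2r//; near: r; exact: nbhs_pinfty_ge.
  rewrite /C mulrDl mul1r; apply: ler_wpDl => //.
  rewrite mulr_suml; apply: (le_trans (ler_norm_sum _ _ _)); apply: ler_sum => i _.
  by rewrite normrM mulrC ler_wpM2l.
have H : f \o shift x = cst (f x) + LL +o_ (nbhs 0) id.
  apply/eqaddoP => eps eps0.
  pose N := 1 + \sum_(i < m) `|e i|.
  have N0 : 0 < N by rewrite ltr_pwDl// sumr_ge0.
  (* The [m] steps contribute [eps' * `|h|] each. *)
  pose eps' := eps / m.+1%:R.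
  have eps'0 : 0 < eps' by rewrite divr_gt0.
  have /nbhs_ballP [r /= r0 Hr] : \forall y \near x, forall i, derivable f y (e i) /\
      `|'D_(e i) f y - 'D_(e i) f x| <= eps'.
    apply: filter_forall => i; apply: filterI; first exact: fd.
    by have /cvgrPdist_le/(_ _ eps'0) := fc i; apply: filterS => y; rewrite distrC.
  near=> h.
  have hr : `|h| * N < r.
    by rewrite -ltr_pdivlMr//; near: h; apply: nbhs0_lt; rewrite divr_gt0.
  pose S k := \sum_(i < m | (i < k)%N) c i h *: e i.
  pose LS k := \sum_(i < m | (i < k)%N) c i h * 'D_(e i) f x.
  have step k (km : (k < m)%N) (W : zmodType) (F : 'I_m -> W) :
      \sum_(i < m | (i < k.+1)%N) F i =
      \sum_(i < m | (i < k)%N) F i + F (Ordinal km).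
    rewrite (bigD1 (Ordinal km)) ?ltnSn//= addrC; congr (_ + _).
    apply: eq_bigl => i; rewrite ltnS -val_eqE/= andbC.
    by rewrite [RHS]ltn_neqAle.
  have tele k : (k <= m)%N -> `|f (x + S k) - f x - LS k| <= (eps' * `|h|) *+ k.
    elim: k => [_|k IH km].
      by rewrite /S /LS !big_pred0// addr0 !subrr normr0.
    rewrite /S /LS !(step _ km) -/(S k) -/(LS k) mulrSr.
    set v := c _ h *: _; set l := c _ h * _.
    rewrite (_ : _ - _ = (f (x + S k) - f x - LS k) + (f (x + S k + v) - f (x + S k) - l)); last first.
      by rewrite (addrA x); ring.
    apply: (le_trans (ler_normD _ _)); apply: lerD; first exact/IH/ltnW.
    have inr (s : R) : 0 <= s <= 1 -> ball x r (x + S k + s *: v).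
      move=> /andP[s0 s1]; rewrite -ball_normE/= -addrA opprD addNKr normrN.
      apply: le_lt_trans hr.
      apply: (@le_trans _ _ (\sum_(i < m | (i < k.+1)%N) `|h| * `|e i|)).
        rewrite (step _ km); apply: (le_trans (ler_normD _ _)); apply: lerD.
          apply: (le_trans (ler_norm_sum _ _ _)); apply: ler_sum => i _.
          by rewrite normrZ ler_wpM2r.
        rewrite normrZ ger0_norm// -[leRHS]mul1r; apply: ler_pM => //.
        by rewrite normrZ ler_wpM2r.
      rewrite -mulr_sumr ler_wpM2l// /N.
      rewrite (@le_trans _ _ (\sum_(i < m) `|e i|))//; last by rewrite lerDr.
      by rewrite big_mkcond/=; apply: ler_sum => i _; case: ifP.
    have dv (s : R) : 0 <= s <= 1 -> is_derive (x + S k + s *: v) v f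
        (c (Ordinal km) h * 'D_(e (Ordinal km)) f (x + S k + s *: v)).
      move=> /inr /Hr /(_ (Ordinal km)) [H _].
      exact: (is_derive_scale_dir _ (derivableP H)).
    apply: increment_bound => [|s s01|s s01].
    - by rewrite mulr_ge0// ltW.
    - by case: (dv s s01).
    - case: (dv s s01) => _ ->; rewrite /l -mulrBr normrM mulrC.
      by apply: ler_pM => //; have /Hr/(_ (Ordinal km)) [] := inr s s01.
  have := tele m (leqnn m); rewrite /S /LS.
  under eq_bigl do rewrite ltn_ord; rewrite -c_basis.
  under eq_bigl do rewrite ltn_ord; rewrite -/(L h).
  move=> Hm; change (is_true (`|f (h + x) - (f x + L h)| <= eps * `|h|)).
  rewrite opprD addrA (addrC h).
  apply: (le_trans Hm); rewrite -[in leLHS]mulr_natr mulrAC ler_wpM2r//.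
  by rewrite /eps' mulrAC ler_pdivrMr// ler_pM2l// ler_nat.
have dE := diff_unique Lcont H.
have df : differentiable f x.
  apply/diff_locallyP; rewrite dE; split=> //.
split=> // v; rewrite deriveE// dE//.
Unshelve. all: by end_near. Qed.
End partials.

Section bases.
Variable R : realType.

Lemma row_norm_ge (n : nat) (v : 'rV[R]_n) i : `|v 0 i| <= `|v|.
Proof.
rewrite [leRHS]/Num.Def.normr/= mx_normrE.
exact: (le_bigmax _ (fun ij : 'I_1 * 'I_n => `|v ij.1 ij.2|) (0, i)).
Qed.

Lemma differentiable_row (n : nat) (f : 'rV[R]_n -> R) x :
  (forall i, \forall y \near x, derivable f y (delta_mx 0 i)) ->
  (forall i, {for x, continuous ('D_(delta_mx 0 i) f)}) ->
  differentiable f x /\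
  forall v, 'D_v f x = \sum_(i < n) v 0 i * 'D_(delta_mx 0 i) f x.
Proof.
apply: (@differentiable_partials _ _ _ (fun i => delta_mx 0 i) (fun i v => v 0 i)).
- by move=> i a u v; rewrite !mxE.
- by move=> v; rewrite [LHS]row_sum_delta.
- by move=> i v; exact: row_norm_ge.
Qed.

Lemma differentiable_spacetime (n : nat) (f : 'rV[R]_n * R -> R) p :
  (forall v, \forall y \near p, derivable f y v) ->
  (forall v, {for p, continuous ('D_v f)}) ->
  differentiable f p /\
  forall v, 'D_v f p =
    \sum_(i < n) v.1 0 i * 'D_(delta_mx 0 i, 0) f p + v.2 * 'D_(0, 1) f p.
Proof.
move=> fd fc.
pose e (i : 'I_n.+1) : 'rV[R]_n * R :=
  if unlift ord0 i is Some j then (delta_mx 0 j, 0) else (0, 1).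
pose c (i : 'I_n.+1) (v : 'rV[R]_n * R) : R :=
  if unlift ord0 i is Some j then v.1 0 j else v.2.
have [|||||fD DE] := @differentiable_partials _ _ _ e c _ _ _ f p.
- move=> i a u v; rewrite /c; case: unlift => [j|]//=.
  by rewrite !mxE.
- move=> v; rewrite big_ord_recl /c /e unlift_none.
  under eq_bigr do rewrite liftK.
  have s1 (a : 'I_n -> 'rV[R]_n * R) : (\sum_i a i).1 = \sum_i (a i).1.
    by apply: (big_morph fst).
  have s2 (a : 'I_n -> 'rV[R]_n * R) : (\sum_i a i).2 = \sum_i (a i).2.
    by apply: (big_morph snd).
  rewrite [LHS]surjective_pairing [RHS]surjective_pairing; congr (_, _) => /=.
    by rewrite s1 scaler0 add0r -row_sum_delta.
  by rewrite s2 [_ *: _]mulr1 big1 ?addr0// => i _; rewrite /= scaler0.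
- move=> i v; rewrite /c; case: unlift => [j|].
    by rewrite (le_trans (row_norm_ge _ _))// prod_normE le_max lexx.
  by rewrite prod_normE le_max lexx orbT.
- by move=> i; exact: fd.
- by move=> i; exact: fc.
split=> // v; rewrite DE big_ord_recl /c /e unlift_none addrC.
by apply: (f_equal (fun z => z + _)); apply: eq_bigr => i _; rewrite liftK.
Qed.

Lemma is_derive_pair (V W : normedModType R) (a : R -> V) (b : R -> W) s da db :
  is_derive s (1 : R) a da -> is_derive s (1 : R) b db ->
  is_derive s (1 : R) (fun u => (a u, b u)) (da, db).
Proof.
move=> [/derivable1_diffP ad aE] [/derivable1_diffP bd bE].
have d : differentiable (fun u => (a u, b u)) s by exact: differentiable_pair.
apply: DeriveDef; first exact: diff_derivable.
by rewrite deriveE// diff_pair//= -!deriveE// aE bE.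
Qed.

Lemma is_derive_rowP (n : nat) (a : R -> 'rV[R]_n) s da :
  is_derive s (1 : R) a da <->
  forall i, is_derive s (1 : R) (fun u => a u 0 i) (da 0 i).
Proof.
split=> [[ad aE] i|H].
  apply: DeriveDef; first by have /derivable_mxP := ad; exact.
  by rewrite -aE derive_mx// mxE.
have ad : derivable a s 1.
  by apply/derivable_mxP => i j; rewrite (ord1 i); case: (H j).
apply: DeriveDef => //; rewrite derive_mx//; apply/matrixP => i j.
by rewrite mxE (ord1 i); case: (H j).
Qed.
End bases.

(** * Smooth functions on open sets *)

Lemma cvg_row (R : realType) (n : nat) (I : Type) (F : set_system I) (FF : Filter F)
    (a : 'I_n -> I -> R) (l : 'I_n -> R) :
  (forall i, a i x @[x --> F] --> l i) ->
  (\row_i a i x) @[x --> F] --> (\row_i l i).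
Proof.
move=> al; apply/cvgrPdist_le => e e0.
have : \forall x \near F, forall i, `|l i - a i x| <= e.
  by apply: filter_forall => i; move/cvgrPdist_le : (al i); exact.
apply: filterS => x H.
rewrite [leLHS]/Num.Def.normr/= mx_normrE (bigmax_le _ (ltW e0))//= => -[i j] _.
by rewrite !mxE; exact: H.
Qed.

Lemma is_derive_affine (R : realType) (V : normedModType R) (a w : V) (s : R) :
  is_derive s (1 : R) (fun u : R => a + u *: w) w.
Proof.
exact: (is_derive_line id a w s w).1.
Qed.

Section Ck_calculus.
Variables (R : realType) (n : nat).
Local Notation ST := ('rV[R]_n * R)%type.

Definition smooth_open (V W : normedModType R) (U : set V) (f : V -> W) :=
  forall k, Ck k U f.

Lemma Ck_continuous (V W : normedModType R) k (U : set V) (f : V -> W) x :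
  open U -> Ck k U f -> U x -> {for x, continuous f}.
Proof.
move=> Uo fk Ux; have fc : {within U, continuous f} by case: k fk => [|k] [].
by move: fc; rewrite continuous_open_subspace// => /(_ x); apply; rewrite inE.
Qed.

Lemma smooth_openD (V W : normedModType R) (U : set V) (f : V -> W) v :
  smooth_open U f -> smooth_open U ('D_v f).
Proof. by move=> fs k; have [_ /(_ v) []] := fs k.+1. Qed.

Lemma smooth_open_derivable (V W : normedModType R) (U : set V) (f : V -> W) x v :
  smooth_open U f -> U x -> derivable f x v.
Proof. by move=> fs; have [_ /(_ v) [H _]] := fs 1%N; exact: H. Qed.

Lemma open_near_eq (V W : normedModType R) (U : set V) (f g : V -> W) x :
  open U -> {in U, f =1 g} -> U x -> \forall y \near x, f y = g y.
Proof.
move=> Uo fg Ux; apply: filterS (open_nbhs_nbhs (conj Uo Ux)) => y Uy.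
by apply: fg; rewrite inE.
Qed.

Lemma Ck_ext (V W : normedModType R) k (U : set V) (f g : V -> W) :
  open U -> {in U, f =1 g} -> Ck k U f -> Ck k U g.
Proof.
move=> Uo; elim: k f g => [|k IH] f g fg [fc fD]; split => //.
- exact: subspace_eq_continuous fc.
- exact: subspace_eq_continuous fc.
- move=> v; have [fd fDk] := fD v; split => [x Ux|].
    exact: near_eq_derivable (open_near_eq Uo fg Ux) (fd x Ux).
  apply: (IH ('D_v f)) => // x; rewrite inE => Ux.
  exact: near_eq_derive (open_near_eq Uo fg Ux).
Qed.

Lemma Ck_sub (V W : normedModType R) k (U U' : set V) (f : V -> W) :
  U' `<=` U -> Ck k U f -> Ck k U' f.
Proof.
move=> UU'; elim: k f => [|k IH] f [fc fD]; split => //.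
- exact: continuous_subspaceW fc.
- exact: continuous_subspaceW fc.
- by move=> v; have [fd fDk] := fD v; split => [x Ux|]; [exact/fd/UU'|exact: IH].
Qed.

Lemma smooth_open_cst (V W : normedModType R) (U : set V) (a : W) :
  smooth_open U (fun _ => a).
Proof.
move=> k; elim: k a => [|k IH] a; split=> //; try exact/continuous_subspaceT/cst_continuous.
move=> v; split; first by move=> x _; exact: derivable_cst.
rewrite (_ : 'D_v _ = fun _ => 0); first exact: IH.
by apply/funext => x; exact: derive_cst.
Qed.

Lemma Ck_le (V W : normedModType R) k (U : set V) (f : V -> W) :
  Ck k.+1 U f -> Ck k U f.
Proof.
elim: k f => [|k IH] f [fc fD]; split=> // v.
by have [fd fDk] := fD v; split=> //; exact: IH.
Qed.

Lemma Ck_add (V : normedModType R) k (U : set V) (f g : V -> R) :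
  open U -> Ck k U f -> Ck k U g -> Ck k U (fun x => f x + g x).
Proof.
move=> Uo; elim: k f g => [|k IH] f g fk gk;
  (split; first by
    rewrite continuous_open_subspace// => x; rewrite inE => Ux;
    apply: continuousD; [exact: Ck_continuous fk Ux|exact: Ck_continuous gk Ux]).
  by [].
case: fk gk => _ fD [_ gD] v; have [[fd fDk] [gd gDk]] := (fD v, gD v).
split => [x Ux|]; first by apply: derivableD; [exact: fd|exact: gd].
apply: (@Ck_ext _ _ _ _ (fun x => 'D_v f x + 'D_v g x)) => //; last exact: IH.
by move=> x; rewrite inE => Ux; rewrite -deriveD//; [exact: fd|exact: gd].
Qed.

Lemma Ck_mul (V : normedModType R) k (U : set V) (f g : V -> R) :
  open U -> Ck k U f -> Ck k U g -> Ck k U (fun x => f x * g x).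
Proof.
move=> Uo; elim: k f g => [|k IH] f g fk gk;
  (split; first by
    rewrite continuous_open_subspace// => x; rewrite inE => Ux;
    apply: continuousM; [exact: Ck_continuous fk Ux|exact: Ck_continuous gk Ux]).
  by [].
have [f' g'] := (Ck_le fk, Ck_le gk).
case: fk gk => _ fD [_ gD] v; have [[fd fDk] [gd gDk]] := (fD v, gD v).
split => [x Ux|]; first by apply: derivableM; [exact: fd|exact: gd].
apply: (@Ck_ext _ _ _ _ (fun x => f x * 'D_v g x + g x * 'D_v f x)) => //.
  by move=> x; rewrite inE => Ux; rewrite -deriveM//; [exact: fd|exact: gd].
by apply: Ck_add => //; exact: IH.
Qed.

Lemma Ck_sum (V : normedModType R) k (U : set V) (I : Type) (r : seq I)
    (f : I -> V -> R) :
  open U -> (forall i, Ck k U (f i)) -> Ck k U (fun x => \sum_(i <- r) f i x).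
Proof.
move=> Uo fk; elim: r => [|i r IH].
  apply: (Ck_ext Uo _ (smooth_open_cst U (0 : R) k)) => x _.
  by rewrite big_nil.
apply: (Ck_ext Uo _ (Ck_add Uo (fk i) IH)) => x _.
by rewrite big_cons.
Qed.

Lemma smooth_open_differentiable (U : set ST) (f : ST -> R) p :
  open U -> smooth_open U f -> U p ->
  differentiable f p /\
  forall v, 'D_v f p =
    \sum_(i < n) v.1 0 i * 'D_(delta_mx 0 i, 0) f p + v.2 * 'D_(0, 1) f p.
Proof.
move=> Uo fs Up; apply: differentiable_spacetime => v.
  apply: filterS (open_nbhs_nbhs (conj Uo Up)) => q Uq.
  exact: smooth_open_derivable Uq.
exact: (Ck_continuous Uo (smooth_openD v fs 0%N)).
Qed.

(** The space coordinates are replaced by [F] and time is kept, which is the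
    shape of a function on the moving surface composed with the projection. *)
Definition keep_time (F : 'I_n -> ST -> R) (q : ST) : ST := (\row_i F i q, q.2).

Lemma is_derive_keep_time F q v :
  (forall i, derivable (F i) q v) ->
  is_derive (0 : R) (1 : R) (fun s : R => keep_time F (q + s *: v))
    (\row_i 'D_v (F i) q, v.2).
Proof.
move=> Fd; apply: is_derive_pair.
  apply/is_derive_rowP => i; rewrite mxE.
  under eq_fun do rewrite mxE.
  apply: (is_derive_line (F i) q v 0 _).1.
  by rewrite scale0r addr0; exact: derivableP.
exact: is_derive_affine.
Qed.

Lemma smooth_open_comp (U U' : set ST) F (g : ST -> R) :
  open U -> open U' -> (forall i, smooth_open U (F i)) ->
  (forall q, U q -> U' (keep_time F q)) ->
  smooth_open U' g -> smooth_open U (g \o keep_time F).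
Proof.
move=> Uo U'o Fs FU + k.
have gFc (h : ST -> R) : smooth_open U' h -> {within U, continuous (h \o keep_time F)}.
  move=> hs; rewrite continuous_open_subspace// => q; rewrite inE => Uq.
  apply: continuous_comp; last exact: (Ck_continuous U'o (hs 0%N) (FU q Uq)).
  apply: (@cvg_pair _ _ _ (nbhs q) (nbhs (\row_i F i q)) (nbhs q.2)); last exact: cvg_snd.
  apply: cvg_row => i. apply: (Ck_continuous Uo (Fs i 0%N) Uq).
elim: k g => [|k IH] g gs.
  by split=> //; exact: gFc.
split; first exact: gFc.
move=> v.
have E q : U q -> is_derive q v (g \o keep_time F)
    (\sum_(i < n) 'D_v (F i) q * ('D_(delta_mx 0 i, 0) g \o keep_time F) q +
     v.2 * ('D_(0, 1) g \o keep_time F) q).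
  move=> Uq; have [dg gE] := smooth_open_differentiable U'o gs (FU q Uq).
  have H0 : is_derive (0 : R) (1 : R) (fun s : R => keep_time F (q + s *: v))
    (\row_i 'D_v (F i) q, v.2).
    by apply: is_derive_keep_time => i; exact: smooth_open_derivable (Fs i) Uq.
  have dg0 : differentiable g (keep_time F (q + (0 : R) *: v)).
    by rewrite scale0r addr0.
  have := @is_derive_curve R _ _ g _ 0 _ dg0 H0.
  rewrite scale0r addr0 gE /=.
  under eq_bigr do rewrite mxE.
  by move=> /(is_derive_line (g \o keep_time F) q v 0 _).2; rewrite scale0r addr0.
split=> [q Uq|]; first by case: (E q Uq).
apply: (@Ck_ext _ _ _ _ (fun q => \sum_(i < n) 'D_v (F i) q * ('D_(delta_mx 0 i, 0) g \o keep_time F) q +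
     v.2 * ('D_(0, 1) g \o keep_time F) q)) => //.
  by move=> q; rewrite inE => Uq; case: (E q Uq).
apply: Ck_add => //.
  apply: Ck_sum => // i; apply: Ck_mul => //; first exact: smooth_openD.
  by apply: IH; exact: smooth_openD.
apply: Ck_mul => //; first exact: smooth_open_cst.
by apply: IH; exact: smooth_openD.
Qed.
End Ck_calculus.

(** * Functions with smooth local extensions *)

Lemma Ck_coord (R : realType) (V : normedModType R) (n k : nat) (U : set V)
    (f : V -> 'rV[R]_n) i :
  open U -> Ck k U f -> Ck k U (fun x => f x 0 i).
Proof.
have cc (h : V -> 'rV[R]_n) : {within U, continuous h} ->
    {within U, continuous (fun x => h x 0 i)}.
  by move=> hc x; apply: (@continuous_comp _ _ _ (h : subspace U -> _) (fun M : 'rV[R]_n => M 0 i)); [exact: hc|exact: coord_continuous].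
move=> Uo; elim: k f => [|k IH] f [fc fD]; split=> //; try exact: cc.
move=> v; have [fd fDk] := fD v; split=> [x Ux|].
  by have /derivable_mxP := fd x Ux; exact.
apply: (Ck_ext Uo _ (IH _ fDk)) => x; rewrite inE => Ux.
by rewrite derive_mx ?mxE//; exact: fd.
Qed.

Section extendable.
Variables (R : realType) (n : nat).
Local Notation ST := ('rV[R]_n * R)%type.

(** The derivatives of [f] are those of its local extensions only on the open set
    [X], but the extensions exist at all points of [K]: with [K] compact this gives
    bounds on [X] for [f] and all its derivatives. *)
Definition extendable (X K : set ST) (f : ST -> R) :=
  forall p, K p -> exists (U : set ST) (g : ST -> R),
    [/\ open U, U p, smooth_open U g & forall q, U q -> X q -> f q = g q].

Variables (X K : set ST).
Hypotheses (X_open : open X) (XK : X `<=` K) (K_compact : compact K).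

Lemma smooth_on_extendable (Y : set ST) f :
  X `<=` Y -> K `<=` Y -> smooth_on Y f -> extendable X K f.
Proof.
move=> XY KY fs p /KY /fs [U [g [Uo Up gs fg]]].
by exists U, g; split => // q Uq /XY; exact: fg.
Qed.

Lemma extendable_derive f v : extendable X K f -> extendable X K ('D_v f).
Proof.
move=> fe p /fe [U [g [Uo Up gs fg]]]; exists U, ('D_v g); split=> //.
  exact: smooth_openD.
move=> q Uq Xq; apply: near_eq_derive.
near=> z; apply: fg.
  by near: z; exact: (open_nbhs_nbhs (conj Uo Uq)).
by near: z; exact: (open_nbhs_nbhs (conj X_open Xq)).
Unshelve. all: by end_near. Qed.

Lemma extendable_differentiable f q : extendable X K f -> X q ->
  differentiable f q /\
  forall v, 'D_v f q =
    \sum_(i < n) v.1 0 i * 'D_(delta_mx 0 i, 0) f q + v.2 * 'D_(0, 1) f q.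
Proof.
move=> fe Xq; have [U [g [Uo Uq gs fg]]] := fe q (XK Xq).
have UXo : open (U `&` X) by exact: openI.
apply: (@smooth_open_differentiable _ _ (U `&` X)) => // k.
apply: (Ck_ext UXo _ (Ck_sub _ (gs k))); last by move=> z [].
by move=> z; rewrite inE => -[Uz Xz]; rewrite fg.
Qed.

Lemma extendable_bounded f : extendable X K f ->
  exists B : R, forall q, X q -> `|f q| <= B.
Proof.
move=> fe; have /compact_near_coveringP Kc := K_compact.
have := @Kc R (+oo)%R (fun M q => X q -> `|f q| <= M) _.
case.
  move=> p Kp; have [U [g [Uo Up gs fg]]] := fe p Kp.
  have gc : {for p, continuous g} := Ck_continuous Uo (gs 0%N) Up.
  have g1 : \forall q \near p, `|g q| <= `|g p| + 1.
    have /cvgrPdist_le/(_ 1 ltr01) := gc; apply: filterS => q gpq.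
    rewrite -[g q](subrK (g p)) addrC (le_trans (ler_normD _ _))// lerD2l.
    by rewrite distrC.
  have Un := open_nbhs_nbhs (conj Uo Up).
  exists ([set q | U q /\ `|g q| <= `|g p| + 1], [set M | `|g p| + 1 <= M]) => /=.
    by split; [exact: filterI|exact: nbhs_pinfty_ge].
  move=> [q M] /= [[Uq gq] gM] Xq; rewrite fg//.
  exact: le_trans gM.
move=> M [_ H].
exists (M + 1) => q Xq; apply: (H (M + 1)) => //; first by rewrite ltrDl.
exact: XK.
Qed.

Lemma extendable_cst a : extendable X K (fun _ => a).
Proof.
move=> p Kp; exists setT, (fun _ => a); split=> //; first exact: openT.
exact: smooth_open_cst.
Qed.

Lemma extendable_add f g : extendable X K f -> extendable X K g ->
  extendable X K (fun q => f q + g q).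
Proof.
move=> fe ge p Kp; have [U [f' [Uo Up fs ff]]] := fe p Kp.
have [U' [g' [U'o U'p gs gg]]] := ge p Kp.
exists (U `&` U'), (fun q => f' q + g' q); split=> //.
- exact: openI.
- move=> k; apply: Ck_add; first exact: openI.
    by apply: Ck_sub (fs k) => z [].
  by apply: Ck_sub (gs k) => z [].
- by move=> q [Uq U'q] Xq; rewrite ff// gg.
Qed.

Lemma extendable_mul f g : extendable X K f -> extendable X K g ->
  extendable X K (fun q => f q * g q).
Proof.
move=> fe ge p Kp; have [U [f' [Uo Up fs ff]]] := fe p Kp.
have [U' [g' [U'o U'p gs gg]]] := ge p Kp.
exists (U `&` U'), (fun q => f' q * g' q); split=> //.
- exact: openI.
- move=> k; apply: Ck_mul; first exact: openI.
    by apply: Ck_sub (fs k) => z [].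
  by apply: Ck_sub (gs k) => z [].
- by move=> q [Uq U'q] Xq; rewrite ff// gg.
Qed.

Lemma extendable_comp (Y Z : set ST) (P : ST -> 'rV[R]_n) (g : ST -> R) :
  X `<=` Y -> K `<=` Y -> smooth_on Y P -> smooth_on Z g ->
  (forall q, Y q -> Z (P q, q.2)) ->
  extendable X K (fun q => g (P q, q.2)).
Proof.
move=> XY KY Ps gs YZ p Kp; have Yp := KY p Kp.
have [U [P' [Uo Up P's PP']]] := Ps p Yp.
have [U' [g' [U'o U'p g's gg']]] := gs _ (YZ p Yp).
pose F i q := P' q 0 i.
have FE q : keep_time F q = (P' q, q.2).
  by congr (_, _); apply/rowP => i; rewrite mxE.
have Fs i : smooth_open U (F i) by move=> k; exact: Ck_coord.
have Fc : {in U, continuous (keep_time F)}.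
  move=> q; rewrite inE => Uq; rewrite /continuous_at.
  apply: (@cvg_pair _ _ _ (nbhs q) (nbhs (\row_i F i q)) (nbhs q.2)); last exact: cvg_snd.
  by apply: cvg_row => i; exact: (Ck_continuous Uo (Fs i 0%N) Uq).
have U0o : open (U `&` keep_time F @^-1` U').
  by apply: (continuous_inP (keep_time F) Uo).1.
exists (U `&` keep_time F @^-1` U'), (g' \o keep_time F); split=> //.
- by split=> //=; rewrite FE -PP'.
- apply: smooth_open_comp U'o _ _ g's => // [i k|q []//].
  by apply: Ck_sub (Fs i k) => z [].
- move=> q [Uq /=]; rewrite FE => U'q Xq; move: U'q.
  by rewrite -PP' //; [move=> U'q; apply: gg' => //; exact/YZ/XY|exact: XY].
Qed.

End extendable.

(** * Euclidean length and one-sided derivatives *)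

Section euclidean.
Variables (R : realType) (n : nat).
Implicit Types x y z v : 'rV[R]_n.

Lemma dotpC x y : dotp x y = dotp y x.
Proof. by apply: eq_bigr => i _; rewrite mulrC. Qed.

Lemma dotpDl x y z : dotp (x + y) z = dotp x z + dotp y z.
Proof. by rewrite -big_split; apply: eq_bigr => i _; rewrite mxE mulrDl. Qed.

Lemma dotpZl (a : R) x y : dotp (a *: x) y = a * dotp x y.
Proof. by rewrite /dotp mulr_sumr; apply: eq_bigr => i _; rewrite mxE mulrA. Qed.

Lemma dotpDr x y z : dotp z (x + y) = dotp z x + dotp z y.
Proof. by rewrite dotpC dotpDl !(dotpC z). Qed.

Lemma dotpZr (a : R) x y : dotp x (a *: y) = a * dotp x y.
Proof. by rewrite dotpC dotpZl dotpC. Qed.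

Lemma dotpNl x y : dotp (- x) y = - dotp x y.
Proof. by rewrite -scaleN1r dotpZl mulN1r. Qed.

Lemma dotpNr x y : dotp x (- y) = - dotp x y.
Proof. by rewrite dotpC dotpNl dotpC. Qed.

Lemma dotp_ge0 x : 0 <= dotp x x.
Proof. by apply: sumr_ge0 => i _; rewrite -expr2 sqr_ge0. Qed.

Lemma dotp_eq0 x : dotp x x = 0 -> x = 0.
Proof.
move=> /eqP; rewrite psumr_eq0 => [/allP H|i _]; last by rewrite -expr2 sqr_ge0.
apply/rowP => i; rewrite mxE; have := H i; rewrite mem_index_enum => /(_ isT).
by rewrite /= mulf_eq0 orbb => /eqP.
Qed.

Lemma enorm_ge0 x : 0 <= enorm x. Proof. exact: sqrtr_ge0. Qed.

Lemma sqr_enorm x : enorm x ^+ 2 = dotp x x.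
Proof. by rewrite sqr_sqrtr// dotp_ge0. Qed.

Lemma enormZ (a : R) x : enorm (a *: x) = `|a| * enorm x.
Proof.
by rewrite /enorm dotpZl dotpZr mulrA -expr2 sqrtrM ?sqr_ge0// sqrtr_sqr.
Qed.

Lemma enormN x : enorm (- x) = enorm x.
Proof. by rewrite -scaleN1r enormZ normrN1 mul1r. Qed.

Lemma enorm0 : enorm (0 : 'rV[R]_n) = 0.
Proof. by rewrite -(scale0r (0 : 'rV[R]_n)) enormZ normr0 mul0r. Qed.

Lemma dotp_le x y : dotp x y <= enorm x * enorm y.
Proof.
have [y0|y0] := eqVneq (dotp y y) 0.
  rewrite (dotp_eq0 y0) /dotp big1 ?mulr_ge0 ?enorm_ge0// => i _.
  by rewrite mxE mulr0.
have yp : 0 < dotp y y by rewrite lt_def y0 dotp_ge0.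
have H : 0 <= dotp x x * dotp y y - dotp x y ^+ 2.
  have := dotp_ge0 (dotp y y *: x - dotp x y *: y).
  rewrite !(dotpDl, dotpDr, dotpNl, dotpNr, dotpZl, dotpZr) (dotpC y x).
  set a := dotp x x; set b := dotp y y; set c := dotp x y => H.
  have : 0 <= b * (a * b - c ^+ 2) by apply: le_trans H _; lra.
  by rewrite pmulr_rge0.
have [xy0|xy0] := leP (dotp x y) 0.
  by apply: le_trans xy0 _; rewrite mulr_ge0 ?enorm_ge0.
rewrite -(@ler_pXn2r _ 2)// ?nnegrE ?mulr_ge0 ?enorm_ge0//; last exact: ltW.
by rewrite exprMn !sqr_enorm -subr_ge0.
Qed.

Lemma enorm_triangle x y : enorm (x + y) <= enorm x + enorm y.
Proof.
rewrite -(@ler_pXn2r _ 2)// ?nnegrE ?addr_ge0 ?enorm_ge0//.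
rewrite sqrrD !sqr_enorm dotpDl !dotpDr (dotpC y x).
have := dotp_le x y; set a := enorm x * _; lra.
Qed.

Lemma unit_dotp1_eq x y : enorm x = 1 -> enorm y = 1 -> dotp x y = 1 -> x = y.
Proof.
move=> x1 y1 xy; apply/eqP; rewrite -subr_eq0; apply/eqP/dotp_eq0.
rewrite !(dotpDl, dotpDr, dotpNl, dotpNr) (dotpC y x) xy -!sqr_enorm x1 y1; lra.
Qed.

Lemma norm_le_enorm x : `|x| <= enorm x.
Proof.
rewrite [leLHS]/Num.Def.normr/= mx_normrE (bigmax_le _ (enorm_ge0 _))//= => -[i j] _ /=.
rewrite (ord1 i) -(@ler_pXn2r _ 2)// ?nnegrE ?enorm_ge0//.
rewrite sqr_enorm real_normK ?num_real// /dotp (bigD1 j)//= expr2 lerDl.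
by apply: sumr_ge0 => k _; rewrite -expr2 sqr_ge0.
Qed.

Lemma coord_le_enorm x i : `|x 0 i| <= enorm x.
Proof. exact: le_trans (row_norm_ge x i) (norm_le_enorm x). Qed.

Lemma enorm_continuous : continuous (@enorm R n).
Proof.
move=> x; apply: (@continuous_comp _ _ _ (fun x => dotp x x) Num.sqrt); last exact: sqrt_continuous.
have := @continuous_big R 'I_n +%R 0 xpredT (@add_continuous R) _ (index_enum 'I_n)
  (fun i (x : 'rV[R]_n) => x 0 i * x 0 i).
by apply => i _ z; apply: continuousM; exact: coord_continuous.
Qed.

Lemma enorm_dist_continuous y : continuous (fun x => enorm (x - y)).
Proof.
move=> x; apply: (@continuous_comp _ _ _ (fun x => x - y) (@enorm R n)); last exact: enorm_continuous.
by apply: (@cvgB _ _ _ (nbhs x)); [exact: cvg_id|exact: cvg_cst].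
Qed.

Lemma enorm_ball_compact y (h : R) : compact [set x | enorm (x - y) <= h].
Proof.
apply: bounded_closed_compact.
  exists (h + `|y|); split; first exact: num_real.
  move=> M hM x /= xh; apply: le_trans (ltW hM).
  rewrite -{1}(subrK y x); apply: (le_trans (ler_normD _ _)).
  by rewrite lerD2r; apply: le_trans xh; exact: norm_le_enorm.
apply: (@closed_comp _ _ (fun x => enorm (x - y)) [set r | r <= h]); last exact: closed_le.
by move=> x _; exact: enorm_dist_continuous.
Qed.

Lemma enorm_sphere_compact y (h : R) : compact [set x | enorm (x - y) = h].
Proof.
apply: (subclosed_compact _ (@enorm_ball_compact y h)) => [|x /= ->//].
apply: (@closed_comp _ _ (fun x => enorm (x - y)) [set r | r = h]); last exact: closed_eq.
by move=> x _; exact: enorm_dist_continuous.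
Qed.

Lemma derive_grad (f : 'rV[R]_n -> R) x v :
  differentiable f x -> 'D_v f x = dotp v (grad f x).
Proof.
move=> df; rewrite deriveE// {1}(row_sum_delta v) linear_sum.
apply: eq_bigr => i _; rewrite linearZ /= mxE deriveE//.
Qed.

End euclidean.

Lemma at_right_dnbhs (R : realType) (x : R) (P : R -> Prop) :
  (\forall h \near x^', P h) -> \forall h \near x^'+, P h.
Proof.
rewrite /at_right /dnbhs !near_withinE; apply: filterS => h + xh; apply.
by rewrite /= gt_eqF.
Qed.

Lemma derive_right_ge0 (R : realType) (g : R -> R) (k : R) :
  is_derive (0 : R) (1 : R) g k -> (\forall s \near (0 : R)^'+, g 0 <= g s) ->
  0 <= k.
Proof.
move=> [gd gE] g0; rewrite leNgt; apply/negP => k0.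
have : (h^-1 *: (g (h *: (1 : R) + 0) - g 0)) @[h --> (0 : R)^'] --> k.
  by rewrite -gE; exact: gd.
move=> /cvgr_lt /(_ _ k0) H.
have {}H : \forall h \near (0 : R)^'+, h^-1 *: (g (h *: (1 : R) + 0) - g 0) < 0.
  exact: at_right_dnbhs.
have : \forall h \near (0 : R)^'+, False.
  near=> h; have h0 : 0 < h by near: h; exact: nbhs_right_gt.
  have : h^-1 *: (g (h *: (1 : R) + 0) - g 0) < 0 by near: h.
  rewrite addr0 [h *: _]mulr1 [_ *: _]/(h^-1 * _) pmulr_rlt0 ?invr_gt0// subr_lt0.
  by rewrite ltNge => /negP; apply; near: h.
by move=> /filter_ex [].
Unshelve. all: by end_near. Qed.

(** A factor vanishing to first order absorbs a bounded one, however irregular. *)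
Lemma is_derive_mul_bounded (R : realType) (H N : R -> R) :
  H 0 = 0 -> is_derive (0 : R) (1 : R) H 0 ->
  (exists B : R, \forall s \near (0 : R), `|N s| <= B) ->
  is_derive (0 : R) (1 : R) (fun s => H s * N s) 0.
Proof.
move=> H0 [Hd HE] [B NB].
pose B' := Num.max B 1; have B'0 : 0 < B' by rewrite lt_max ltr01 orbT.
have Hq : (h^-1 *: (H (h *: (1 : R) + 0) - H 0)) @[h --> (0 : R)^'] --> 'D_1 H 0.
  exact: Hd.
rewrite HE in Hq.
have cv : (h^-1 *: (H (h *: (1 : R) + 0) * N (h *: (1 : R) + 0) - H 0 * N 0))
    @[h --> (0 : R)^'] --> (0 : R).
  apply/cvgrPdist_le => e e0.
  have eB : 0 < e / B' by rewrite divr_gt0.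
  have /cvgrPdist_le/(_ _ eB) := Hq.
  have : \forall h \near (0 : R)^', `|N h| <= B by exact: nbhs_dnbhs.
  apply: filterS2 => h Nh /=; rewrite H0 mul0r !subr0 !sub0r !normrN addr0.
  rewrite (_ : h *: (1 : R) = h); last exact: mulr1.
  rewrite [h^-1 *: (H h * N h)]scalerAl !normrM => Hh.
  rewrite -(divfK (lt0r_neq0 B'0) e).
  by apply: ler_pM => //; rewrite (le_trans Nh)// le_max lexx.
by apply: DeriveDef; [apply/cvg_ex; exists 0|exact: cvg_lim cv].
Qed.

(** * Functions with unit gradient *)

Section eikonal.
Variables (R : realType) (n : nat) (f : 'rV[R]_n -> R) (y : 'rV[R]_n) (h : R).
Hypotheses (h_gt0 : 0 < h)
  (f_diff : forall x, enorm (x - y) <= h -> differentiable f x)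
  (f_unit : forall x, enorm (x - y) <= h -> enorm (grad f x) = 1).

Let f_line (x v : 'rV[R]_n) (s : R) : enorm (x + s *: v - y) <= h ->
  is_derive s (1 : R) (fun u : R => f (x + u *: v)) (dotp v (grad f (x + s *: v))).
Proof.
move=> xh; apply: (is_derive_line f x v s _).1.
by rewrite -derive_grad; [apply/derivableP/diff_derivable; exact: f_diff|exact: f_diff].
Qed.

Let segment_in (x z : 'rV[R]_n) (s : R) : enorm (x - y) <= h -> enorm (z - y) <= h ->
  0 <= s <= 1 -> enorm (x + s *: (z - x) - y) <= h.
Proof.
move=> xh zh /andP[s0 s1].
have -> : x + s *: (z - x) - y = (1 - s) *: (x - y) + s *: (z - y).
  by apply/rowP => i; rewrite !mxE; ring.
apply: (le_trans (enorm_triangle _ _)); rewrite !enormZ (ger0_norm s0) ger0_norm ?subr_ge0//.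
have -> : h = (1 - s) * h + s * h by ring.
by apply: lerD; apply: ler_wpM2l => //; rewrite subr_ge0.
Qed.

Lemma eikonal_lipschitz x z : enorm (x - y) <= h -> enorm (z - y) <= h ->
  f z - f x <= enorm (z - x).
Proof.
move=> xh zh.
have inball (s : R) := @segment_in x z s xh zh.
have [||s] := @MVT_segment R (fun s : R => f (x + s *: (z - x)))
  (fun s => dotp (z - x) (grad f (x + s *: (z - x)))) 0 1 ler01.
- by move=> s; rewrite in_itv/= => /andP[/ltW s0 /ltW s1]; apply/f_line/inball/andP.
- apply: derivable_within_continuous => s; rewrite in_itv/= => s01.
  by case: (f_line (inball s s01)).
- rewrite in_itv/= => s01; rewrite scale1r scale0r addr0 subr0 mulr1 [x + (z - x)]addrC subrK => ->.
  by apply: (le_trans (dotp_le _ _)); rewrite f_unit ?mulr1//; exact: inball.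
Qed.

(** Maximise [f - c |. - y|] over the ball: at an interior point a step along the
    unit gradient would increase it, because [c < 1]. *)
Lemma eikonal_reach (c : R) : 0 < c < 1 ->
  exists z, enorm (z - y) = h /\ f y + c * h <= f z.
Proof.
move=> /andP[c0 c1]; pose B := [set x : 'rV[R]_n | enorm (x - y) <= h].
pose F x := f x - c * enorm (x - y).
have By : B y by rewrite /B/= subrr enorm0 ltW.
have Fc : {within B, continuous F}.
  apply: continuous_in_subspaceT => x; rewrite inE => Bx.
  apply: (@cvgB _ _ _ (nbhs x)); first exact: differentiable_continuous (f_diff Bx).
  apply: (@cvgM _ _ (nbhs x)); first exact: cvg_cst.
  exact: enorm_dist_continuous.
have [z] := EVT_max_rV (ex_intro _ y By) (@enorm_ball_compact R n y h) Fc.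
rewrite inE => Bz zmax.
have Fyz : f y + c * enorm (z - y) <= f z.
  have := zmax y; rewrite inE => /(_ By); rewrite /F subrr enorm0 mulr0 subr0; lra.
exists z; suff <- : enorm (z - y) = h by [].
apply/eqP; rewrite eq_le; apply/andP; split; first exact: Bz.
rewrite leNgt; apply/negP => zh; pose N := grad f z.
have N1 : enorm N = 1 := f_unit Bz.
have gd : is_derive (0 : R) (1 : R) (fun s : R => f z + c * s - f (z + s *: N)) (c - 1).
  have Bz0 : enorm (z + (0 : R) *: N - y) <= h by rewrite scale0r addr0.
  have H1 := f_line Bz0; rewrite scale0r addr0 -sqr_enorm N1 expr1n in H1.
  have H2 := is_derive_affine (f z : R^o) c (0 : R).
  have := is_deriveB H2 H1; congr (is_derive _ _ _ _).
  by apply/funext => s /=; rewrite mulrC.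
have : 0 <= c - 1.
  apply: (derive_right_ge0 gd); near=> s.
  have s0 : 0 <= s by near: s; exact: nbhs_right_ge.
  have zsB : B (z + s *: N).
    rewrite /B/= addrAC; apply: (le_trans (enorm_triangle _ _)).
    rewrite enormZ N1 mulr1 ger0_norm// -lerBrDl.
    by near: s; apply: nbhs_right_le; rewrite subr_gt0.
  have := zmax (z + s *: N); rewrite inE => /(_ zsB); rewrite /F.
  have : enorm (z + s *: N - y) <= enorm (z - y) + s.
    by rewrite addrAC (le_trans (enorm_triangle _ _))// enormZ N1 mulr1 ger0_norm.
  rewrite scale0r addr0 mulr0 addr0 subrr => H1 H2.
  have : c * enorm (z + s *: N - y) <= c * (enorm (z - y) + s) by rewrite ler_pM2l.
  lra.
lra.
Unshelve. all: by end_near. Qed.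

(** Letting [c] tend to [1] in [eikonal_reach] gives a point [z] of the sphere with
    [f z = f y + h]. As [f] is 1-Lipschitz it grows at unit rate along the segment
    from [y] to [z], so its unit gradient at [y] is the direction of the segment. *)
Lemma eikonal_line (s : R) : 0 <= s <= h -> f (y + s *: grad f y) = f y + s.
Proof.
have hyh : enorm (y - y) <= h by rewrite subrr enorm0 ltW.
pose S := [set x : 'rV[R]_n | enorm (x - y) = h].
have h2 : 0 < (2^-1 : R) < 1 by lra.
have S0 : S !=set0 by have [z [zS _]] := eikonal_reach h2; exists z.
have Sf : {within S, continuous f}.
  apply: continuous_in_subspaceT => x; rewrite inE => Sx.
  by apply/differentiable_continuous/f_diff; rewrite Sx.
have [z] := EVT_max_rV S0 (@enorm_sphere_compact R n y h) Sf.
rewrite inE => zh zmax.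
have zh' : enorm (z - y) <= h by rewrite zh.
have fz : f z = f y + h.
  apply/eqP; rewrite eq_le; apply/andP; split.
    by have := eikonal_lipschitz hyh zh'; rewrite zh; lra.
  rewrite leNgt; apply/negP => fzh.
  (* A slope [c < 1] exceeding [(f z - f y) / h]. *)
  have cP : 0 < Num.max (2^-1) ((1 + (f z - f y) / h) / 2) < 1.
    rewrite lt_max gt_max; apply/andP; split; first by apply/orP; left; lra.
    apply/andP; split; first lra.
    suff : (f z - f y) / h < 1 by lra.
    by rewrite ltr_pdivrMr// mul1r; lra.
  have [w [wS wf]] := eikonal_reach cP.
  have := zmax w; rewrite inE => /(_ wS).
  have : ((1 + (f z - f y) / h) / 2) * h <= Num.max (2^-1) ((1 + (f z - f y) / h) / 2) * h.
    by rewrite ler_pM2r// le_max lexx orbT.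
  have -> : ((1 + (f z - f y) / h) / 2) * h = (h + (f z - f y)) / 2.
    by field; rewrite gt_eqF.
  lra.
pose u := h^-1 *: (z - y).
have u1 : enorm u = 1 by rewrite enormZ zh gtr0_norm ?invr_gt0// mulVf// gt_eqF.
have zE : z = y + h *: u by rewrite /u scalerA divff ?gt_eqF// scale1r addrC subrK.
have in_u (r : R) : 0 <= r <= h -> enorm (y + r *: u - y) <= h.
  by move=> /andP[r0 rh]; rewrite addrAC subrr add0r enormZ u1 mulr1 ger0_norm.
have fu (r : R) : 0 <= r <= h -> f (y + r *: u) = f y + r.
  move=> rh; have /andP[r0 rh'] := rh; apply/eqP; rewrite eq_le; apply/andP; split.
    have := eikonal_lipschitz hyh (in_u r rh).
    by rewrite addrAC subrr add0r enormZ u1 mulr1 ger0_norm//; lra.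
  have := eikonal_lipschitz (in_u r rh) zh'.
  have -> : z - (y + r *: u) = (h - r) *: u.
    by rewrite zE; apply/rowP => i; rewrite !mxE; ring.
  by rewrite enormZ u1 mulr1 ger0_norm ?subr_ge0// fz; lra.
suff -> : grad f y = u by exact: fu.
apply: unit_dotp1_eq => //; first exact: f_unit.
rewrite dotpC; apply/eqP; rewrite eq_le; apply/andP; split.
  by apply: (le_trans (dotp_le _ _)); rewrite u1 f_unit// mulr1.
have H0 : enorm (y + (0 : R) *: u - y) <= h by rewrite scale0r addr0.
have H1 := f_line H0; rewrite scale0r addr0 in H1.
have H2 := is_derive_affine (f y : R^o) (1 : R) (0 : R).
have H3 : is_derive (0 : R) (1 : R) (fun r : R => f (y + r *: u) - (f y + r * 1))
  (dotp u (grad f y) - 1) := is_deriveB H1 H2.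
rewrite -subr_ge0; apply: (derive_right_ge0 H3); near=> r.
have r0 : 0 <= r by near: r; exact: nbhs_right_ge.
have rh : r <= h by near: r; exact: nbhs_right_le.
rewrite (fu r) ?r0// scale0r addr0 mul0r addr0 mulr1 !subrr//.
Unshelve. all: by end_near. Qed.

End eikonal.

(** For negative [s], [eikonal_line] is applied to [- f]. *)
Lemma eikonal_line_both (R : realType) (n : nat) (f : 'rV[R]_n -> R) y (h : R) :
  0 < h ->
  (forall x, enorm (x - y) <= h -> differentiable f x) ->
  (forall x, enorm (x - y) <= h -> enorm (grad f x) = 1) ->
  forall s : R, - h <= s <= h -> f (y + s *: grad f y) = f y + s.
Proof.
move=> h0 fd fu s /andP[hs sh].
have [s0|s0] := leP 0 s; first by apply: (@eikonal_line R n f y h); rewrite ?s0.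
have gN x : enorm (x - y) <= h -> grad (- f) x = - grad f x.
  move=> xh; apply/rowP => i; rewrite !mxE deriveN//.
  exact/diff_derivable/fd.
have := @eikonal_line R n (- f) y h h0 _ _ (- s).
have hyh : enorm (y - y) <= h by rewrite subrr enorm0 ltW.
rewrite gN// scaleNr scalerN opprK /= => H.
have /= : - f (y + s *: grad f y) = - f y - s.
  apply: H => [x xh|x xh|].
  - exact/differentiableN/fd.
  - by rewrite gN// enormN fu.
  - by rewrite oppr_ge0 ltW//= lerNl.
lra.
Qed.

(** * The signed distance along normal lines *)

Lemma ltW_itv (R : realType) (a b t : R) : a < t < b -> a <= t <= b.
Proof. by move=> /andP[/ltW -> /ltW ->]. Qed.

Lemma sdist_le (R : realType) (n : nat) (M : set 'rV[R]_n) x y :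
  M y -> `|sdist M x| <= enorm (x - y).
Proof.
move=> My; have lb : has_lbound [set enorm (x - z) | z in M].
  by exists 0 => _ [z _ <-]; exact: enorm_ge0.
have e0 : 0 <= edistance x M.
  by apply: lb_le_inf; [exists (enorm (x - y)), y|move=> _ [z _ <-]; exact: enorm_ge0].
have ed : edistance x M <= enorm (x - y) by apply: ge_inf => //; exists y.
by rewrite ler_norml /sdist; case: (x \in inside M); lra.
Qed.

Lemma sdist_eq0 (R : realType) (n : nat) (M : set 'rV[R]_n) y :
  M y -> sdist M y = 0.
Proof.
by move=> My; apply/eqP; rewrite -normr_le0 (le_trans (sdist_le y My))// subrr enorm0.
Qed.

Lemma smooth_on_continuous (R : realType) (V W : normedModType R) (Y : set V) (f : V -> W) :
  smooth_on Y f -> {within Y, continuous f}.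
Proof.
move=> fs; apply/subspace_continuousP => p Yp.
have [U [g [Uo Up gs fg]]] := fs p Yp.
have gc : {for p, continuous g} := Ck_continuous Uo (gs 0%N) Up.
have fp : f p = g p by exact: fg.
suff : f @ within Y (nbhs p) --> g p by rewrite -fp.
have gw : g @ within Y (nbhs p) --> g p by apply: cvg_within_filter; exact: gc.
apply: cvg_trans gw.
apply: near_eq_cvg; rewrite near_withinE.
by apply: filterS (open_nbhs_nbhs (conj Uo Up)) => q Uq Yq; exact/esym/fg.
Qed.

Lemma within_fst (S S' W : topologicalType) (A : set S) (B : set S') (f : S -> W) p :
  {within A, continuous f} -> (A `*` B) p ->
  f q.1 @[q --> within (A `*` B) (nbhs p)] --> f p.1.
Proof.
case: p => a b /subspace_continuousP fc [Ap Bp].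
apply: cvg_comp (fc _ Ap) => C AC.
have : nbhs (a, b) [set q : S * S' | A q.1 -> C q.1].
  exists ([set x | A x -> C x], setT); last by move=> [x y] [].
  by split=> //; exact: filterT.
by apply: filterS => q H [Aq _]; exact: H.
Qed.

Lemma cvg_to_within (I : Type) (S : topologicalType) (F : set_system I) {FF : Filter F}
    (A : set S) (f : I -> S) (p : S) :
  f @ F --> p -> (\forall i \near F, A (f i)) -> f @ F --> within A (nbhs p).
Proof.
move=> fp fA C AC; have H : F (fun i => A (f i) -> C (f i)) := fp _ AC.
change (F (fun i => C (f i))).
by apply: filterS2 H fA => i; apply.
Qed.

Section tubes.
Variables (R : realType) (n : nat) (T : R).
Variables (Gam : R -> set 'rV[R]_n) (nu Phi : 'rV[R]_n * R -> 'rV[R]_n).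
Variables (delta : R) (proj : 'rV[R]_n * R -> 'rV[R]_n).
Hypotheses (hT : 0 < T) (hGam : moving_surface T Gam nu Phi)
  (htube : tubular_neighborhood T Gam nu delta proj).
Local Notation ST := ('rV[R]_n * R)%type.

Definition dist (p : ST) : R := sdist (Gam p.2) p.1.

Lemma unit_normal t y : 0 <= t <= T -> Gam t y -> enorm (nu (y, t)) = 1.
Proof. by move=> t0T Gy; case: (ms_normal hGam t0T Gy). Qed.

Lemma tube_proj x t : 0 <= t <= T -> `|dist (x, t)| <= delta ->
  [/\ Gam t (proj (x, t)),
      x = proj (x, t) + dist (x, t) *: nu (proj (x, t), t),
      differentiable (sdist (Gam t)) x &
      grad (sdist (Gam t)) x = nu (proj (x, t), t)].
Proof.
by move=> t0T; rewrite ler_norml => xd; have [] := tn_proj htube t0T xd.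
Qed.

Lemma tube_unit_grad x t : 0 <= t <= T -> `|dist (x, t)| <= delta ->
  enorm (grad (sdist (Gam t)) x) = 1.
Proof. by move=> t0T /(tube_proj t0T) [Gp _ _ ->]; exact: unit_normal. Qed.

Lemma surface_grad t y : 0 <= t <= T -> Gam t y ->
  grad (sdist (Gam t)) y = nu (y, t).
Proof.
move=> t0T Gy; have d0 : dist (y, t) = 0 by exact: sdist_eq0.
have [] := @tube_proj y t t0T; first by rewrite d0 normr0 ltW// (tn_pos htube).
by rewrite d0 scale0r addr0 => _ <-.
Qed.

(** On the ball of radius [h < delta] about a point of the surface the signed
    distance is at most [h] in absolute value, so that the ball lies in the tube,
    where the gradient is a unit vector. *)
Lemma dist_normal_line t y r : 0 <= t <= T -> Gam t y -> `|r| < delta ->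
  dist (y + r *: nu (y, t), t) = r.
Proof.
move=> t0T Gy rd; pose h := (`|r| + delta) / 2.
have hd : `|r| < h < delta by rewrite /h; lra.
have h0 : 0 < h by rewrite (le_lt_trans (normr_ge0 r))//; case/andP: hd.
have inB x : enorm (x - y) <= h -> `|dist (x, t)| <= delta.
  move=> xh; apply: (le_trans (sdist_le x Gy)); apply: (le_trans xh).
  by rewrite ltW//; case/andP: hd.
have := @eikonal_line_both R n (sdist (Gam t)) y h h0 _ _ r.
rewrite surface_grad// (sdist_eq0 Gy) add0r; apply.
- by move=> x /inB /(tube_proj t0T) [].
- by move=> x /inB; exact: tube_unit_grad.
- by rewrite -ler_norml ltW//; case/andP: hd.
Qed.

(** By [dist_normal_line] the gradient at [y + r nu] has inner product [1] with
    [nu]; it is therefore [nu], and uniqueness of the projection applies. *)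
Lemma proj_normal_line t y r : 0 <= t <= T -> Gam t y -> `|r| < delta ->
  proj (y + r *: nu (y, t), t) = y.
Proof.
move=> t0T Gy rd; have dE := dist_normal_line t0T Gy rd.
set x := y + r *: nu (y, t) in dE *.
have xd : `|dist (x, t)| <= delta by rewrite dE ltW.
have xtube : tube Gam delta t x by rewrite /tube/= -ler_norml.
have [_ dx gx] : [/\ True, differentiable (sdist (Gam t)) x & enorm (grad (sdist (Gam t)) x) = 1].
  by split => //; [case: (tube_proj t0T xd)|exact: tube_unit_grad].
have [_] := tn_proj htube t0T xtube; apply.
rewrite -/(dist (x, t)) dE; split=> //.
apply: unit_dotp1_eq => //; first exact: unit_normal.
have H1 : is_derive r (1 : R) (fun s : R => sdist (Gam t) (y + s *: nu (y, t)))
    (dotp (grad (sdist (Gam t)) x) (nu (y, t))).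
  apply: (is_derive_line _ y (nu (y, t)) r _).1.
  by rewrite dotpC -derive_grad//; exact/derivableP/diff_derivable.
have H2 : is_derive r (1 : R) (fun s : R => sdist (Gam t) (y + s *: nu (y, t))) 1.
  apply: near_eq_is_derive (is_derive_id r (1 : R)).
  near=> s; apply/esym/(dist_normal_line t0T Gy).
  near: s; have := @norm_continuous R R^o r; move=> /cvgr_lt; exact.
by have [_ <-] := H1; have [_ ->] := H2.
Unshelve. all: by end_near. Qed.

End tubes.

(** * Compactness and openness of the tube in space-time *)

Lemma cvg_pair_nbhs (I : Type) (U V : topologicalType) (F : set_system I)
    {FF : Filter F} (f : I -> U) (g : I -> V) (a : U) (b : V) :
  f x @[x --> F] --> a -> g x @[x --> F] --> b ->
  (f x, g x) @[x --> F] --> (a, b).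
Proof. by move=> fa gb; exact: (@cvg_pair _ _ _ F (nbhs a) (nbhs b)). Qed.

Lemma is_derive_slice_space (R : realType) (n : nat) (F : 'rV[R]_n * R -> R) q v l :
  is_derive q (v, 0) F l <-> is_derive q.1 v (fun x => F (x, q.2)) l.
Proof.
have E : (fun h : R => h^-1 *: ((F \o shift q) (h *: (v, (0 : R))) - F q)) =
    (fun h : R => h^-1 *: (((fun x => F (x, q.2)) \o shift q.1) (h *: v) - F (q.1, q.2))).
  apply/funext => h /=; congr (_ *: (F _ - F _)); last by case: q.
  by rewrite [LHS]surjective_pairing/= scaler0 add0r.
have D1 : derivable F q (v, 0) = derivable (fun x => F (x, q.2)) q.1 v by rewrite /derivable E.
have D2 : 'D_(v, 0) F q = 'D_v (fun x => F (x, q.2)) q.1 by rewrite /derive E.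
split=> -[d e]; apply: DeriveDef; first by rewrite -D1.
- by rewrite -D2.
- by rewrite D1.
- by rewrite D2.
Qed.

Lemma is_derive_slice_time (R : realType) (n : nat) (F : 'rV[R]_n * R -> R)
    (q : 'rV[R]_n * R) (l : R) :
  is_derive q ((0, 1) : 'rV[R]_n * R) F l <-> is_derive q.2 (1 : R) (fun s => F (q.1, s)) l.
Proof.
have E : (fun h : R => h^-1 *: ((F \o shift q) (h *: ((0 : 'rV[R]_n), (1 : R))) - F q)) =
    (fun h : R => h^-1 *: (((fun s => F (q.1, s)) \o shift q.2) (h *: (1 : R)) - F (q.1, q.2))).
  apply/funext => h /=; congr (_ *: (F _ - F _)); last by case: q.
  by rewrite [LHS]surjective_pairing/= scaler0 add0r.
have D1 : derivable F q ((0, 1) : 'rV[R]_n * R) = derivable (fun s => F (q.1, s)) q.2 1 by rewrite /derivable E.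
have D2 : 'D_((0, 1) : 'rV[R]_n * R) F q = 'D_1 (fun s => F (q.1, s)) q.2 by rewrite /derive E.
split=> -[d e]; apply: DeriveDef; first by rewrite -D1.
- by rewrite -D2.
- by rewrite D1.
- by rewrite D2.
Qed.

Section tube_domain.
Variables (R : realType) (n : nat) (T : R).
Variables (Gam : R -> set 'rV[R]_n) (nu Phi : 'rV[R]_n * R -> 'rV[R]_n).
Variables (delta : R) (proj : 'rV[R]_n * R -> 'rV[R]_n).
Hypotheses (hT : 0 < T) (hGam : moving_surface T Gam nu Phi)
  (htube : tubular_neighborhood T Gam nu delta proj).
Local Notation ST := ('rV[R]_n * R)%type.
Local Notation dist := (dist Gam).
Local Notation surface := (slab `[0, T] Gam).
Local Notation tubes := (slab `[0, T] (tube Gam delta)).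

Lemma surface_flow t y : 0 <= t <= T -> Gam t y ->
  exists2 z, Gam 0 z & y = Phi (z, t).
Proof.
move=> t0T Gy; have [_ [g [_ _ gG _ gK]]] := ms_diffeo hGam t0T.
by exists (g y); [exact: gG|rewrite gK].
Qed.

Lemma flow_surface t z : 0 <= t <= T -> Gam 0 z -> Gam t (Phi (z, t)).
Proof. by move=> t0T Gz; have [_ [g [_ H _ _ _]]] := ms_diffeo hGam t0T; exact: H. Qed.

Lemma flow_continuous :
  {within Gam 0 `*` `[0, T], continuous (fun q : ST => (Phi q, q.2))}.
Proof.
have /subspace_continuousP Pc := smooth_on_continuous (ms_smooth hGam).
apply/subspace_continuousP => q Aq; have Pq := Pc q Aq.
have sq : x.2 @[x --> within (Gam 0 `*` `[0, T]) (nbhs q)] --> q.2.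
  by apply: cvg_within_filter; exact: cvg_snd.
exact: (cvg_pair_nbhs Pq sq).
Qed.

Lemma surface_compact : compact surface.
Proof.
have -> : surface = (fun q : ST => (Phi q, q.2)) @` (Gam 0 `*` `[0, T]).
  apply/seteqP; split=> [[y t] [/= t0T Gy]|_ [[z t] [/= Gz t0T] <-]].
    rewrite in_itv/= in t0T.
    have [z Gz ->] := surface_flow t0T Gy.
    by exists (z, t) => //; split=> //=; rewrite in_itv.
  by split=> //=; apply: flow_surface => //; move: t0T; rewrite in_itv.
apply: continuous_compact; first exact: flow_continuous.
apply: compact_setX; last exact: segment_compact.
by apply: (ms_compact hGam); rewrite lexx ltW.
Qed.

Lemma surface_in_tubes q : surface q -> tubes q.
Proof.
case: q => y t [/= t0T Gy]; split=> //=.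
rewrite /tube/= (sdist_eq0 Gy); have := tn_pos htube; lra.
Qed.

Lemma in_tubesP q : tubes q <-> 0 <= q.2 <= T /\ `|dist q| <= delta.
Proof.
by case: q => x t; rewrite /slab/= in_itv/= /tube/= ler_norml.
Qed.

Lemma normal_continuous : {within surface, continuous nu}.
Proof.
apply/subspace_continuousP => p Sp.
have [U [g [Uo Up gs fg]]] := tn_smooth_dist htube (surface_in_tubes Sp).
have nuE q : U q -> surface q -> nu q = \row_i 'D_(delta_mx 0 i, 0) g q.
  case: q => y t Uq [/=]; rewrite in_itv/= => t0T Gy.
  rewrite -(surface_grad htube t0T Gy); apply/rowP => i; rewrite !mxE.
  have dg := derivableP (@smooth_open_derivable _ _ _ U g (y, t) (delta_mx 0 i, 0) gs Uq).
  have [_ <-] := (is_derive_slice_space _ _ _ _).1 dg.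
  apply: near_eq_derive => /=.
  have sc : {for y, continuous (sdist (Gam t))}.
    apply: differentiable_continuous.
    have [] := @tube_proj _ _ _ _ _ _ _ htube y t t0T => //.
    by rewrite /Defs.sdist; rewrite -/(sdist (Gam t) y) /dist /= (sdist_eq0 Gy) normr0 ltW// (tn_pos htube).
  have : \forall x \near y, `|sdist (Gam t) x| < delta.
    have := @continuous_comp _ _ _ (sdist (Gam t)) (fun r : R => `|r|) y sc (@norm_continuous _ R^o _).
    by move=> /cvgr_lt; apply; rewrite /= (sdist_eq0 Gy) normr0 (tn_pos htube).
  have : \forall x \near y, U (x, t).
    have : (x, t) @[x --> y] --> (y, t) by exact: (@cvg_pair_nbhs _ _ _ (nbhs y) _ id (cst t) y t cvg_id (cvg_cst _)).
    by apply; exact: (open_nbhs_nbhs (conj Uo Uq)).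
  apply: filterS2 => x Ux dx; apply: (fg (x, t)) => //.
  by apply/in_tubesP; split => //; exact: ltW.
have gc : (\row_i 'D_(delta_mx 0 i, 0) g q) @[q --> within surface (nbhs p)] --> nu p.
  rewrite (nuE p Up Sp); apply: cvg_within_filter; apply: cvg_row => i.
  exact: (Ck_continuous Uo (smooth_openD (delta_mx 0 i, 0) gs 0%N) Up).
apply: cvg_trans gc; apply: near_eq_cvg; rewrite near_withinE.
by apply: filterS (open_nbhs_nbhs (conj Uo Up)) => q Uq Yq; exact/esym/nuE.
Qed.

(** Normal coordinates; the height [a] may depend on the foot point and on a
    parameter. *)
Definition fermi (a : ST -> R -> R) (q : ST * R) : ST :=
  (q.1.1 + a q.1 q.2 *: nu q.1, q.1.2).

Lemma fermi_continuous a (B : set R) :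
  {within surface `*` B, continuous (fun q : ST * R => a q.1 q.2)} ->
  {within surface `*` B, continuous (fermi a)}.
Proof.
move=> /subspace_continuousP ac; apply/subspace_continuousP => q Aq.
have nq := within_fst normal_continuous Aq.
have aq := ac q Aq.
have s2 : x.1.2 @[x --> within (surface `*` B) (nbhs q)] --> q.1.2.
  apply: cvg_within_filter; apply: (@continuous_comp _ _ _ (fun x : ST * R => x.1) snd q).
    exact: cvg_fst.
  exact: cvg_snd.
have s1 : x.1.1 @[x --> within (surface `*` B) (nbhs q)] --> q.1.1.
  apply: cvg_within_filter; apply: (@continuous_comp _ _ _ (fun x : ST * R => x.1) fst q).
    exact: cvg_fst.
  exact: cvg_fst.
have H : x.1.1 + a x.1 x.2 *: nu x.1 @[x --> within (surface `*` B) (nbhs q)]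
   --> q.1.1 + a q.1 q.2 *: nu q.1.
  by apply: cvgD => //; exact: cvgZ.
exact: (cvg_pair_nbhs H s2).
Qed.

Definition tube_interior : set ST := [set p | 0 < p.2 < T /\ `|dist p| < delta].

Definition closed_tube : set ST :=
  fermi (fun _ r => r) @` (surface `*` `[- delta, delta]).

Lemma closed_tube_compact : compact closed_tube.
Proof.
apply: continuous_compact; last first.
  by apply: compact_setX; [exact: surface_compact|exact: segment_compact].
apply: fermi_continuous; apply/subspace_continuousP => q Aq.
by apply: cvg_within_filter; exact: cvg_snd.
Qed.

(** The flow moves points of the surface continuously in time, and the absolute
    signed distance is at most the distance to any given point of the surface. *)
Lemma tube_interior_open : open tube_interior.
Proof.
rewrite openE => -[x t] [/= t0T xd].
have t0T' : 0 <= t <= T by case/andP: t0T => *; rewrite !ltW.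
have [Gp xE _ _] := tube_proj htube t0T' (ltW xd).
set y := proj (x, t) in Gp xE.
have xy : enorm (x - y) < delta.
  by rewrite {1}xE addrAC subrr add0r enormZ (unit_normal hGam t0T' Gp) mulr1.
have [z Gz yE] := surface_flow t0T' Gp.
have tin : \forall q \near (x, t), 0 < q.2 < T.
  have : q.2 @[q --> (x, t)] --> t by exact: cvg_snd.
  move=> tc; case/andP: t0T => t0 tT.
  have /(_ _ _ t0) H1 := cvgr_gt t tc.
  have /(_ _ _ tT) H2 := cvgr_lt t tc.
  by apply: filterS2 H1 H2 => q ? ?; apply/andP.
have Pc : enorm (q.1 - Phi (z, q.2)) @[q --> within [set q : ST | 0 < q.2 < T] (nbhs (x, t))]
     --> enorm (x - y).
  apply: (@cvg_comp _ _ _ (fun q : ST => q.1 - Phi (z, q.2)) (@enorm R n) _ (nbhs (x - y))); last exact: enorm_continuous.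
  apply: cvgB; first by apply: cvg_within_filter; exact: cvg_fst.
  rewrite yE.
  have /subspace_continuousP Pcc := smooth_on_continuous (ms_smooth hGam).
  have Pz : (Gam 0 `*` `[0, T]) (z, t) by split=> //=; rewrite in_itv.
  apply: (@cvg_comp _ _ _ (fun q : ST => (z, q.2)) Phi); last exact: (Pcc _ Pz).
  move=> C /= CP; have zc : (z, q.2) @[q --> (x, t)] --> (z, t).
    exact: (@cvg_pair_nbhs _ _ _ (nbhs (x, t)) _ (cst z) snd z t (cvg_cst _) cvg_snd).
  change (nbhs (x, t) (fun q : ST => 0 < q.2 < T -> C (z, q.2))).
  have CP' : nbhs (z, t) (fun w : ST => (Gam 0 `*` `[0, T]) w -> C w) := CP.
  have zC : nbhs (x, t) (fun q : ST => (Gam 0 `*` `[0, T]) (z, q.2) -> C (z, q.2)) := zc _ CP'.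
  apply: filterS zC => q /= H q0T; apply: H; split=> //=.
  by rewrite in_itv/=; case/andP: q0T => *; rewrite !ltW.
have /(_ _ _ xy) := cvgr_lt _ Pc; rewrite near_withinE => H.
apply: filterS2 tin H => -[x' t'] /= t'0T xd'.
split=> //=; apply: le_lt_trans (xd' t'0T).
apply: sdist_le; apply: flow_surface => //.
by case/andP: t'0T => *; rewrite !ltW.
Qed.

Lemma tube_interior_tubes : tube_interior `<=` tubes.
Proof.
move=> [x t] [/= /andP[t0 tT] xd]; apply/in_tubesP; split=> /=; first by rewrite !ltW.
exact: ltW.
Qed.

Lemma tube_interior_sub : tube_interior `<=` closed_tube.
Proof.
move=> [x t] Xq; have /in_tubesP[/= t0T xd] := tube_interior_tubes Xq.
have [Gp xE _ _] := tube_proj htube t0T xd.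
exists ((proj (x, t), t), dist (x, t)); last by rewrite /fermi/= -xE.
by split => //=; rewrite in_itv/= -ler_norml.
Qed.

Lemma closed_tube_sub : closed_tube `<=` tubes.
Proof.
move=> _ [[[y t] r] [[/= t0T Gy] rd] <-]; rewrite in_itv/= in t0T.
apply/in_tubesP; split=> //=; apply: (le_trans (sdist_le _ Gy)).
rewrite addrAC subrr add0r enormZ (unit_normal hGam t0T Gy) mulr1.
by move: rd; rewrite /= in_itv/= ler_norml.
Qed.

End tube_domain.

(** * The thin domain in terms of the signed distance *)

Lemma within_continuous_comp (S S' W : topologicalType) (A : set S) (B : set S')
    (f : S -> S') (g : S' -> W) :
  {within A, continuous f} -> {within B, continuous g} ->
  (forall x, A x -> B (f x)) -> {within A, continuous (g \o f)}.
Proof.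
move=> /subspace_continuousP fc /subspace_continuousP gc AB.
apply/subspace_continuousP => x Ax.
have fx := fc x Ax; have gfx := gc _ (AB _ Ax).
apply: cvg_comp gfx => C BC.
have BC' : nbhs (f x) (fun z => B z -> C z) := BC.
have H := fx _ BC'; move: H.
rewrite !nbhs_simpl /= => H.
change (nbhs x (fun z => A z -> C (f z))).
have H' : nbhs x (fun z => A z -> B (f z) -> C (f z)) := H.
by apply: filterS H' => z H0 Az; apply: H0 => //; exact: AB.
Qed.

Section thin.
Variables (R : realType) (n : nat) (T : R).
Variables (Gam : R -> set 'rV[R]_n) (nu Phi : 'rV[R]_n * R -> 'rV[R]_n).
Variables (delta : R) (proj : 'rV[R]_n * R -> 'rV[R]_n).
Variables (g0 g1 : 'rV[R]_n * R -> R) (eps0 eps : R).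
Hypotheses (hT : 0 < T) (hGam : moving_surface T Gam nu Phi)
  (htube : tubular_neighborhood T Gam nu delta proj)
  (hwidth : thin_width T Gam delta g0 g1 eps0) (heps : 0 < eps < eps0).
Local Notation ST := ('rV[R]_n * R)%type.
Local Notation dist := (dist Gam).
Local Notation surface := (slab `[0, T] Gam).
Local Notation Om := (thin_domain Gam nu g0 g1 eps).

Definition pull (g : ST -> R) (q : ST) : R := g (proj q, q.2).

Lemma pull_normal_line g t y r : 0 <= t <= T -> Gam t y -> `|r| < delta ->
  pull g (y + r *: nu (y, t), t) = g (y, t).
Proof.
by move=> t0T Gy rd; rewrite /pull/= (proj_normal_line hGam htube).
Qed.

(** The bound is strict because [eps < eps0]: compare with an intermediate [e1]. *)
Lemma width_lt q : surface q -> eps * `|g0 q| < delta /\ eps * `|g1 q| < delta.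
Proof.
move=> Sq; have /andP[e0 ee0] := heps.
pose e1 := (eps + eps0) / 2.
have e1P : eps < e1 < eps0 by rewrite /e1; lra.
have /andP[ee1 e1e0] := e1P.
have [|H0 H1] := tw_fit hwidth (eps := e1) _ Sq; first by apply/andP; split; lra.
have d0 := tn_pos htube.
have aux a : 0 <= a -> e1 * a <= delta -> eps * a < delta.
  move=> a0; have [->|an0] := eqVneq a 0; first by rewrite !mulr0 d0.
  have ap : 0 < a by rewrite lt_def an0.
  by apply: lt_le_trans; rewrite ltr_pM2r.
by split; apply: aux.
Qed.

Lemma width_itv (a : R) : eps * `|a| < delta -> - delta < eps * a < delta.
Proof.
by have /andP[e0 _] := heps; rewrite -ltr_norml normrM (gtr0_norm e0).
Qed.

Lemma gap_pos : exists2 c : R, 0 < c & forall q, surface q -> c <= g1 q - g0 q.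
Proof. exact: tw_gap hwidth. Qed.

(** The slices of this set are the closures of the domains. In terms of the distance
    membership is a pair of inequalities between functions of space-time, while
    compactness comes from parametrizing the set by the surface and an interval. *)
Definition thin_closed : set ST := [set p | [/\ 0 <= p.2 <= T, `|dist p| < delta &
  eps * pull g0 p <= dist p <= eps * pull g1 p]].

Definition height (q : ST) (th : R) : R := eps * (g0 q + th * (g1 q - g0 q)).

Lemma height_bounds q (th : R) : surface q -> 0 <= th <= 1 ->
  eps * g0 q <= height q th <= eps * g1 q /\ `|height q th| < delta.
Proof.
move=> Sq /andP[t0 t1]; have [c c0 cg] := gap_pos; have := cg q Sq => gq.
have /andP[e0 _] := heps.
have H : eps * g0 q <= height q th <= eps * g1 q.
  rewrite /height !ler_pM2l//.
  have : 0 <= th * (g1 q - g0 q) by rewrite mulr_ge0//; lra.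
  have : 0 <= (1 - th) * (g1 q - g0 q) by rewrite mulr_ge0//; lra.
  by move=> ? ?; apply/andP; split; lra.
split=> //; have [/width_itv w0 /width_itv w1] := width_lt Sq.
by rewrite ltr_norml; lra.
Qed.

Lemma thin_closed_image :
  thin_closed = fermi nu height @` (surface `*` `[0, 1]).
Proof.
have /andP[e0 _] := heps; have [c c0 cg] := gap_pos.
apply/seteqP; split => [[x t] [/= t0T xd xb]|_ [[[y t] th] [/= [/= t0T Gy] th01] <-]].
  have [Gp xE _ _] := tube_proj htube t0T (ltW xd).
  set y := proj (x, t) in Gp xE; have Sy : surface (y, t) by split=> //=; rewrite in_itv.
  have gy := cg _ Sy.
  have gyp : 0 < eps * (g1 (y, t) - g0 (y, t)) by rewrite mulr_gt0//; lra.
  pose th := (dist (x, t) - eps * g0 (y, t)) / (eps * (g1 (y, t) - g0 (y, t))).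
  rewrite /pull/= -/y in xb; case/andP: xb => xb0 xb1.
  exists ((y, t), th); last first.
    rewrite /fermi/= [in RHS]xE; congr (_ + _ *: _, _); rewrite /height /th; field.
    by apply/andP; split; rewrite gt_eqF//; lra.
  split=> //=; rewrite in_itv/= divr_ge0 ?(ltW gyp)//=; last lra.
  by rewrite ler_pdivrMr// mul1r; lra.
rewrite in_itv/= in t0T; rewrite in_itv/= in th01.
have Sy : surface (y, t) by split=> //=; rewrite in_itv.
have [hb hd] := height_bounds Sy th01.
by split=> //=; rewrite ?(dist_normal_line hGam htube) ?pull_normal_line.
Qed.

Lemma height_continuous :
  {within surface `*` `[0, 1], continuous (fun q : ST * R => height q.1 q.2)}.
Proof.
apply/subspace_continuousP => q Aq.
have H0 := within_fst (smooth_on_continuous (tw_smooth0 hwidth)) Aq.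
have H1 := within_fst (smooth_on_continuous (tw_smooth1 hwidth)) Aq.
have H2 : x.2 @[x --> within (surface `*` `[0, 1]) (nbhs q)] --> q.2.
  by apply: cvg_within_filter; exact: cvg_snd.
apply: cvgM; first exact: cvg_cst.
by apply: cvgD => //; apply: cvgM => //; apply: cvgB.
Qed.

Lemma thin_closed_compact : compact thin_closed.
Proof.
rewrite thin_closed_image; apply: continuous_compact.
  by apply: (fermi_continuous htube); exact: height_continuous.
by apply: compact_setX; [exact: (surface_compact hT hGam)|exact: segment_compact].
Qed.

Lemma thin_domainP t x : 0 <= t <= T ->
  Om t x <-> `|dist (x, t)| < delta /\
    eps * pull g0 (x, t) < dist (x, t) < eps * pull g1 (x, t).
Proof.
move=> t0T; split=> [[y [r [Gy rb ->]]]|[xd xb]].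
  have Sy : surface (y, t) by split=> //=; rewrite in_itv.
  have rd : `|r| < delta.
    have [/width_itv w0 /width_itv w1] := width_lt Sy.
    by rewrite ltr_norml; lra.
  by rewrite (dist_normal_line hGam htube)// !pull_normal_line.
have [Gp xE _ _] := tube_proj htube t0T (ltW xd).
by exists (proj (x, t)), (dist (x, t)).
Qed.

Lemma thin_domain_closed t x : 0 <= t <= T -> Om t x -> thin_closed (x, t).
Proof.
by move=> t0T /(thin_domainP _ t0T) [xd /andP[x0 x1]]; split=> //=; rewrite !ltW.
Qed.

Lemma closure_thinP t x : 0 <= t <= T ->
  closure (Om t) x <-> thin_closed (x, t).
Proof.
move=> t0T; split=> [xc|].
  have cl : closed [set z | thin_closed (z, t)].
    apply: (@closed_comp _ _ (fun z : 'rV[R]_n => (z, t)) thin_closed).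
      move=> z _; exact: (@cvg_pair_nbhs _ _ _ (nbhs z) _ id (cst t) z t cvg_id (cvg_cst _)).
    by apply: compact_closed; [exact: norm_hausdorff|exact: thin_closed_compact].
  have /closure_id clE := cl.
  have : closure [set z | thin_closed (z, t)] x.
    by apply: closure_subset xc => z; exact: thin_domain_closed.
  by rewrite -clE.
move=> [/= _ xd xb] B xB.
have [Gp xE _ _] := tube_proj htube t0T (ltW xd).
set y := proj (x, t) in Gp xE; set r := dist (x, t) in xd xb xE.
have Sy : surface (y, t) by split=> //=; rewrite in_itv.
have [c c0 cg] := gap_pos; have gy := cg _ Sy; have /andP[e0 _] := heps.
(* Move along the normal towards the middle height [m]. *)
pose m := eps * ((g0 (y, t) + g1 (y, t)) / 2).
rewrite /pull/= -/y in xb.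
have mb : eps * g0 (y, t) < m < eps * g1 (y, t).
  by rewrite /m !ltr_pM2l//; apply/andP; split; lra.
clearbody m.
have cv : y + (r + u * (m - r)) *: nu (y, t) @[u --> (0 : R)^'+] --> x.
  apply: cvg_at_right_filter.
  have H : y + (r + u * (m - r)) *: nu (y, t) @[u --> (0 : R)] -->
      y + (r + 0 * (m - r)) *: nu (y, t).
    apply: cvgD; first exact: cvg_cst.
    apply: cvgZr_tmp; apply: cvgD; first exact: cvg_cst.
    by apply: cvgM; [exact: cvg_id|exact: cvg_cst].
  by rewrite mul0r addr0 -xE in H.
have : \forall u \near (0 : R)^'+, B (y + (r + u * (m - r)) *: nu (y, t)) by exact: cv.
have : \forall u \near (0 : R)^'+, Om t (y + (r + u * (m - r)) *: nu (y, t)).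
  near=> u; exists y, (r + u * (m - r)); split=> //.
  have u0 : 0 < u by near: u; exact: nbhs_right_gt.
  have u1 : u < 1 by near: u; exact: nbhs_right_lt.
  have -> : r + u * (m - r) = (1 - u) * r + u * m by ring.
  case/andP: xb => xb0 xb1; case/andP: mb => mb0 mb1.
  have A0 : 0 <= (1 - u) * (r - eps * g0 (y, t)) by rewrite mulr_ge0//; lra.
  have A1 : 0 <= (1 - u) * (eps * g1 (y, t) - r) by rewrite mulr_ge0//; lra.
  have B0 : 0 < u * (m - eps * g0 (y, t)) by rewrite mulr_gt0//; lra.
  have B1 : 0 < u * (eps * g1 (y, t) - m) by rewrite mulr_gt0//; lra.
  by apply/andP; split; lra.
move=> H1 H2; have [u [Bu Ou]] := filter_ex (filterI H1 H2).
by exists (y + (r + u * (m - r)) *: nu (y, t)).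
Unshelve. all: by end_near. Qed.

End thin.

(** * Normal and velocity of the lateral boundary *)

Section lateral.
Variables (R : realType) (n : nat) (T : R).
Variables (Gam : R -> set 'rV[R]_n) (nu Phi : 'rV[R]_n * R -> 'rV[R]_n).
Variables (delta : R) (proj : 'rV[R]_n * R -> 'rV[R]_n).
Variables (g0 g1 : 'rV[R]_n * R -> R) (eps0 eps : R).
Hypotheses (hT : 0 < T) (hGam : moving_surface T Gam nu Phi)
  (htube : tubular_neighborhood T Gam nu delta proj)
  (hwidth : thin_width T Gam delta g0 g1 eps0) (heps : 0 < eps < eps0).
Local Notation ST := ('rV[R]_n * R)%type.
Local Notation dist := (dist Gam).
Local Notation pull := (pull proj).
Local Notation surface := (slab `[0, T] Gam).
Local Notation Om := (thin_domain Gam nu g0 g1 eps).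
Local Notation thin_closed := (thin_closed T Gam delta proj g0 g1 eps).
Local Notation X := (tube_interior T Gam delta).
Local Notation K := (closed_tube T Gam nu delta).
Local Notation tame := (extendable X K).

Let Xo : open X := tube_interior_open hGam htube.
Let XK : X `<=` K := tube_interior_sub htube.

Lemma dist_tame : tame dist.
Proof.
exact: (smooth_on_extendable (tube_interior_tubes (T := T) (Gam := Gam) (delta := delta))
  (closed_tube_sub hGam) (tn_smooth_dist htube)).
Qed.

Lemma pull_tame g : smooth_on surface g -> tame (pull g).
Proof.
move=> gs; apply: (@extendable_comp R n X K (slab `[0, T] (tube Gam delta)) surface).
- exact: tube_interior_tubes.
- exact: (closed_tube_sub hGam).
- exact: tn_smooth_proj htube.
- exact: gs.
- move=> [x t] /in_tubesP [/= t0T xd]; split=> /=; first by rewrite in_itv.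
  by have [] := tube_proj htube t0T xd.
Qed.

Lemma thin_interior p : 0 < p.2 < T -> thin_closed p -> X p.
Proof. by move=> p0T [_ pd _]. Qed.

Lemma tame_continuous f p : tame f -> X p -> {for p, continuous f}.
Proof.
by move=> ft Xp; apply: differentiable_continuous; have [] := extendable_differentiable Xo XK ft Xp.
Qed.

Lemma thin_open : open [set p : ST | 0 < p.2 < T /\ Om p.2 p.1].
Proof.
rewrite openE => -[x t] [/= t0T Ox].
have t0T' : 0 <= t <= T by case/andP: t0T => *; rewrite !ltW.
have [xd xb] := (thin_domainP hGam htube hwidth heps x t0T').1 Ox.
have Xp : X (x, t) by split.
have dc := tame_continuous dist_tame Xp.
have c0 := tame_continuous (pull_tame (tw_smooth0 hwidth)) Xp.
have c1 := tame_continuous (pull_tame (tw_smooth1 hwidth)) Xp.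
have H0 : \forall q \near (x, t), 0 < dist q - eps * pull g0 q.
  have : dist q - eps * pull g0 q @[q --> (x, t)] --> dist (x, t) - eps * pull g0 (x, t).
    by apply: cvgB => //; apply: cvgM => //; exact: cvg_cst.
  by move=> /cvgr_gt; apply; lra.
have H1 : \forall q \near (x, t), dist q - eps * pull g1 q < 0.
  have : dist q - eps * pull g1 q @[q --> (x, t)] --> dist (x, t) - eps * pull g1 (x, t).
    by apply: cvgB => //; apply: cvgM => //; exact: cvg_cst.
  by move=> /cvgr_lt; apply; lra.
have HX : \forall q \near (x, t), X q by exact: (open_nbhs_nbhs (conj Xo Xp)).
rewrite /interior/=; apply: filterS3 HX H0 H1 => -[x' t'] [/= t'0T xd'] q0 q1; split=> //.
apply/(thin_domainP hGam htube hwidth heps).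
  by case/andP: t'0T => *; rewrite !ltW.
by split=> //; apply/andP; split; lra.
Qed.

Lemma thin_domain_open t : 0 <= t <= T -> open (Om t).
Proof.
move=> t0T; rewrite openE => x Ox.
have [xd xb] := (thin_domainP hGam htube hwidth heps x t0T).1 Ox.
have [_ _ dx _] := tube_proj htube t0T (ltW xd).
have sc : sdist (Gam t) z @[z --> x] --> sdist (Gam t) x := differentiable_continuous dx.
have dn : \forall z \near x, `|dist (z, t)| < delta.
  have := @continuous_comp _ _ _ (sdist (Gam t)) (fun r : R => `|r|) x sc (@norm_continuous _ R^o _).
  by move=> /cvgr_lt; exact.
have cv0 : (z, t) @[z --> x] --> (x, t).
  exact: (@cvg_pair_nbhs _ _ _ (nbhs x) _ id (cst t) x t cvg_id (cvg_cst _)).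
have tn : \forall z \near x, slab `[0, T] (tube Gam delta) (z, t).
  by apply: filterS dn => z zd; apply/in_tubesP; split=> //; exact: ltW.
have cv : (z, t) @[z --> x] --> within (slab `[0, T] (tube Gam delta)) (nbhs (x, t)).
  exact: cvg_to_within cv0 tn.
have pc g : smooth_on surface g -> pull g (z, t) @[z --> x] --> pull g (x, t).
  move=> gs; have pt : {within slab `[0, T] (tube Gam delta), continuous (pull g)}.
    apply: (@within_continuous_comp _ _ _ _ surface (fun q : ST => (proj q, q.2)) g).
    - apply/subspace_continuousP => q qt.
      have /subspace_continuousP pc := smooth_on_continuous (tn_smooth_proj htube).
      apply: cvg_pair_nbhs; first exact: pc.
      by apply: cvg_within_filter; exact: cvg_snd.
    - exact: smooth_on_continuous.
    - move=> [z s] /in_tubesP [/= s0T zd]; split=> /=; first by rewrite in_itv.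
      by have [] := tube_proj htube s0T zd.
  have /subspace_continuousP ptc := pt.
  have xt : slab `[0, T] (tube Gam delta) (x, t) by apply/in_tubesP; split=> //; exact: ltW.
  exact: cvg_comp cv (ptc _ xt).
have c0 : sdist (Gam t) z - eps * pull g0 (z, t) @[z --> x] -->
    sdist (Gam t) x - eps * pull g0 (x, t).
  exact: (cvgB sc (cvgM (cvg_cst eps) (pc g0 (tw_smooth0 hwidth)))).
have c1 : sdist (Gam t) z - eps * pull g1 (z, t) @[z --> x] -->
    sdist (Gam t) x - eps * pull g1 (x, t).
  exact: (cvgB sc (cvgM (cvg_cst eps) (pc g1 (tw_smooth1 hwidth)))).
have H0 : \forall z \near x, 0 < sdist (Gam t) z - eps * pull g0 (z, t).
  by move: c0 => /cvgr_gt; apply; rewrite subr_gt0; case/andP: xb.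
have H1 : \forall z \near x, sdist (Gam t) z - eps * pull g1 (z, t) < 0.
  by move: c1 => /cvgr_lt; apply; rewrite subr_lt0; case/andP: xb.
rewrite /interior/=; apply: filterS3 dn H0 H1 => z zd; rewrite subr_gt0 subr_lt0 => z0 z1.
by apply/(thin_domainP hGam htube hwidth heps) => //; split=> //; rewrite z0.
Qed.

Lemma thin_frontierP t x : 0 < t < T ->
  frontier (Om t) x <-> thin_closed (x, t) /\
    (dist (x, t) = eps * pull g0 (x, t) \/ dist (x, t) = eps * pull g1 (x, t)).
Proof.
move=> t0T; have t0T' : 0 <= t <= T by case/andP: t0T => *; rewrite !ltW.
have Oo := thin_domain_open t0T'.
split=> [[/(closure_thinP hT hGam htube hwidth heps x t0T') xc xi]|[xc xe]].
  split=> //; apply: contrapT => /not_orP[/eqP x0 /eqP x1]; apply: xi.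
  have [_ xd /andP[xb0 xb1]] := xc.
  rewrite openE in Oo; apply: Oo; apply/(thin_domainP hGam htube hwidth heps) => //.
  by split=> //; rewrite !lt_neqAle xb0 xb1 x1 eq_sym x0.
split; first exact/(closure_thinP hT hGam htube hwidth heps x t0T').
move=> /interior_subset /(thin_domainP hGam htube hwidth heps x t0T') [_ /andP[x0 x1]].
by case: xe => xe; [rewrite xe ltxx in x0|rewrite xe ltxx in x1].
Qed.

Definition sgrad (f : ST -> R) (q : ST) : 'rV[R]_n := \row_i 'D_(delta_mx 0 i, 0) f q.

Lemma tame_derive f q v s : tame f -> X q ->
  'D_(v, s) f q = dotp v (sgrad f q) + s * 'D_(0, 1) f q.
Proof.
move=> ft Xq; have [_ ->] := extendable_differentiable Xo XK ft Xq.
by congr (_ + _); apply: eq_bigr => i _; rewrite mxE.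
Qed.

Lemma tame_is_derive f q v : tame f -> X q -> is_derive q v f ('D_v f q).
Proof.
move=> ft Xq; have [fd _] := extendable_differentiable Xo XK ft Xq.
exact/derivableP/diff_derivable.
Qed.

Lemma sgrad_dist x t : X (x, t) -> sgrad dist (x, t) = nu (proj (x, t), t).
Proof.
move=> Xq; have /in_tubesP[/= t0T xd] := tube_interior_tubes Xq.
have [_ _ sd <-] := tube_proj htube t0T xd; apply/rowP => i; rewrite !mxE.
have [_ ->] := (is_derive_slice_space dist (x, t) (delta_mx 0 i) _).1
  (tame_is_derive (delta_mx 0 i, 0) dist_tame Xq).
by [].
Qed.

(** The two components of the lateral boundary: outer ([sg = 1]) and inner
    ([sg = -1]); [side sg g] is negative inside the domain and vanishes on the
    component. *)
Definition is_side (sg : R) (g g' : ST -> R) :=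
  (sg = 1 /\ g = g1 /\ g' = g0) \/ (sg = -1 /\ g = g0 /\ g' = g1).

Definition side (sg : R) (g : ST -> R) (q : ST) : R := sg * (dist q - eps * pull g q).

Section one_side.
Variables (sg : R) (g g' : ST -> R) (x0 : 'rV[R]_n) (t0 : R).
Hypotheses (sgg : is_side sg g g') (t0T : 0 < t0 < T)
  (x0F : frontier (Om t0) x0) (x0g : side sg g (x0, t0) = 0).

Let t0T' : 0 <= t0 <= T. Proof. by case/andP: t0T => *; rewrite !ltW. Qed.

Lemma side_smooth : smooth_on surface g.
Proof.
by case: sgg => -[_ [-> _]]; [exact: tw_smooth1 hwidth|exact: tw_smooth0 hwidth].
Qed.

Lemma side_smooth' : smooth_on surface g'.
Proof.
by case: sgg => -[_ [_ ->]]; [exact: tw_smooth0 hwidth|exact: tw_smooth1 hwidth].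
Qed.

Lemma side_sign : sg = 1 \/ sg = -1.
Proof. by case: sgg => -[-> _]; [left|right]. Qed.

Lemma side_tame : tame (side sg g).
Proof.
apply: extendable_mul; first exact: extendable_cst.
have := extendable_add dist_tame
  (extendable_mul (@extendable_cst R n X K (- eps)) (pull_tame side_smooth)).
by rewrite /side; congr (extendable X K); apply/funext => q; rewrite mulNr.
Qed.

Lemma side_eq0 q : side sg g q = 0 <-> dist q = eps * pull g q.
Proof.
rewrite /side; split=> [/eqP|->]; last by rewrite subrr mulr0.
rewrite mulf_eq0 subr_eq0 => /orP[|/eqP//].
by case: side_sign => ->; rewrite ?oppr_eq0 oner_eq0.
Qed.

Lemma frontier_in_X : X (x0, t0).
Proof.
have [/thin_interior H _] := (thin_frontierP x0 t0T).1 x0F.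
exact: H.
Qed.

Lemma side_neg x : Om t0 x -> side sg g (x, t0) < 0.
Proof.
move=> /(thin_domainP hGam htube hwidth heps x t0T') [_ /andP[d0 d1]].
by rewrite /side; case: sgg => -[-> [-> _]]; lra.
Qed.

Lemma dist_pull_gap : 0 < eps * sg * (pull g (x0, t0) - pull g' (x0, t0)).
Proof.
have /in_tubesP[/= _ xd] := tube_interior_tubes frontier_in_X.
have [Gp _ _ _] := tube_proj htube t0T' xd.
have [c c0 cg] := gap_pos hwidth.
have := cg (proj (x0, t0), t0); move=> H.
have /andP[e0 _] := heps.
have {}H : 0 < pull g1 (x0, t0) - pull g0 (x0, t0).
  by apply: lt_le_trans c0 _; apply: H; split=> //=; rewrite in_itv.
by case: sgg => -[-> [-> ->]]; rewrite -mulrA pmulr_rgt0//; lra.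
Qed.

(** Pushing [x0 + s w] back along the normal onto the graph of [g] stays on the
    boundary and has velocity [w] when [w] is orthogonal to the gradient. *)
Lemma side_tangent w : dotp w (sgrad (side sg g) (x0, t0)) = 0 ->
  tangent (frontier (Om t0)) x0 w.
Proof.
move=> wS; have X0 := frontier_in_X.
pose H (s : R) : R := dist (x0 + s *: w, t0) - eps * pull g (x0 + s *: w, t0).
pose N (s : R) := nu (proj (x0 + s *: w, t0), t0).
have sgn0 : sg * sg = 1 by case: side_sign => ->; lra.
have HE : H = fun s : R => sg * side sg g (x0 + s *: w, t0).
  by apply/funext => s; rewrite /side mulrA sgn0 mul1r.
have H0 : H 0 = 0 by rewrite HE scale0r addr0 x0g mulr0.
have Hd : is_derive (0 : R) (1 : R) H 0.
  have := tame_is_derive (w, 0) side_tame X0; rewrite (tame_derive _ _ side_tame X0) wS mul0r addr0.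
  move=> /(is_derive_slice_space _ _ _ _).1 /= D.
  have D0 : is_derive (0 : R) (1 : R) (fun s : R => side sg g (x0 + s *: w, t0)) 0.
    by apply: (is_derive_line (fun x => side sg g (x, t0)) x0 w 0 0).1; rewrite scale0r addr0.
  have := is_deriveZ sg D0; rewrite HE scaler0; exact.
have XN : \forall s \near (0 : R), X (x0 + s *: w, t0).
  have cv : (x0 + s *: w, t0) @[s --> (0 : R)] --> (x0 + (0 : R) *: w, t0).
    apply: (@cvg_pair_nbhs _ _ _ (nbhs (0 : R))); last exact: cvg_cst.
    by apply: cvgD; [exact: cvg_cst|apply: cvgZr_tmp; exact: cvg_id].
  by rewrite scale0r addr0 in cv; apply: cv; exact: (open_nbhs_nbhs (conj Xo X0)).
exists (fun s => x0 + s *: w - H s *: N s); split.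
- by rewrite H0 !scale0r addr0 subr0.
- apply/is_derive_rowP => i.
  have D1 : is_derive (0 : R) (1 : R) (fun s : R => H s * N s 0 i) 0.
    apply: is_derive_mul_bounded H0 Hd _; exists 1.
    apply: filterS XN => s Xs; have /in_tubesP[/= _ xd] := tube_interior_tubes Xs.
    have [Gp _ _ _] := tube_proj htube t0T' xd.
    by rewrite -(unit_normal hGam t0T' Gp); exact: coord_le_enorm.
  have D2 := is_derive_affine (x0 0 i : R^o) (w 0 i) (0 : R).
  have := is_deriveB D2 D1; rewrite subr0; congr (is_derive _ _ _ _).
  by apply/funext => s; rewrite !mxE.
- apply: filterS XN => s Xs; have /in_tubesP[/= _ xd] := tube_interior_tubes Xs.
  have [Gp xE _ _] := tube_proj htube t0T' xd.
  set x := x0 + s *: w in Xs xd Gp xE *; set y := proj (x, t0) in Gp xE.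
  have Sy : surface (y, t0) by split=> //=; rewrite in_itv.
  have yd : `|eps * g (y, t0)| < delta.
    have [w0 w1] := width_lt htube hwidth heps Sy; have /andP[e0 _] := heps.
    by rewrite normrM (gtr0_norm e0); case: sgg => -[_ [-> _]].
  have -> : x - H s *: N s = y + (eps * g (y, t0)) *: nu (y, t0).
    rewrite /H /N -/x -/y {1}xE -addrA -scalerBl; congr (_ + _ *: _).
    by rewrite opprB addrC subrK.
  have dE : dist (y + (eps * g (y, t0)) *: nu (y, t0), t0) = eps * g (y, t0).
    by rewrite (dist_normal_line hGam htube).
  have pE h : pull h (y + (eps * g (y, t0)) *: nu (y, t0), t0) = h (y, t0).
    by rewrite (pull_normal_line hGam htube).
  apply/(thin_frontierP _ t0T); split; last first.
    by rewrite dE !pE; case: sgg => -[_ [-> _]]; [right|left].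
  split=> //=; rewrite ?dE ?pE//.
  have [c c0 cg] := gap_pos hwidth; have gy := cg _ Sy; have /andP[e0 _] := heps.
  by case: sgg => -[_ [-> _]]; rewrite !ler_pM2l//; apply/andP; split; lra.
Qed.

(** [pull g] is constant along normals, so [side] has slope [sg] in the direction of
    the gradient of [dist]. In [side_normal] this bounds the length of the gradient
    of [side] from below by one. *)
Lemma side_dist : 'D_(sgrad (side sg g) (x0, t0), 0) dist (x0, t0) = sg.
Proof.
have X0 := frontier_in_X; have /in_tubesP[/= _ xd] := tube_interior_tubes X0.
have [Gp xE _ _] := tube_proj htube t0T' xd.
rewrite (tame_derive _ _ dist_tame X0) mul0r addr0 (sgrad_dist X0).
set y := proj (x0, t0) in Gp xE *; set N := nu (y, t0) in xE *.
have := tame_is_derive (N, 0) side_tame X0; rewrite (tame_derive _ _ side_tame X0) mul0r addr0.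
rewrite dotpC => /(is_derive_slice_space _ _ _ _).1 /= D.
set r0 := dist (x0, t0) in xE xd.
have D0 : is_derive r0 (1 : R) (fun s : R => side sg g (y + s *: N, t0)) (dotp (sgrad (side sg g) (x0, t0)) N).
  by apply: (is_derive_line (fun x => side sg g (x, t0)) y N r0 _).1; rewrite -xE.
have D1 : is_derive r0 (1 : R) (fun s : R => side sg g (y + s *: N, t0)) sg.
  have H1 : is_derive r0 (1 : R) (fun s : R => - (sg * eps * g (y, t0)) + s * sg) sg.
    exact: (is_derive_affine (- (sg * eps * g (y, t0)) : R^o) sg r0).
  apply: near_eq_is_derive H1.
  have r0d : `|r0| < delta by case: X0.
  near=> s; have sd : `|s| < delta.
    near: s; have := @norm_continuous R R^o r0; move=> /cvgr_lt; exact.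
  rewrite /side (dist_normal_line hGam htube)// (pull_normal_line hGam htube)//.
  ring.
by have [_ <-] := D0; have [_ ->] := D1.
Unshelve. all: by end_near. Qed.

(** By [side_tangent] the normal is orthogonal to everything orthogonal to the
    gradient, hence parallel to it; the sign comes from the inward segment. *)
Lemma side_normal v : outward_unit_normal (Om t0) (frontier (Om t0)) x0 v ->
  enorm (sgrad (side sg g) (x0, t0)) *: v = sgrad (side sg g) (x0, t0) /\
  1 <= enorm (sgrad (side sg g) (x0, t0)).
Proof.
move=> [v1 vT vin]; have X0 := frontier_in_X; set S := sgrad (side sg g) (x0, t0).
have S1 : 1 <= enorm S.
  have := side_dist; rewrite (tame_derive _ _ dist_tame X0) mul0r addr0 (sgrad_dist X0) -/S => SN.
  have /in_tubesP[/= _ xd] := tube_interior_tubes X0.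
  have [Gp _ _ _] := tube_proj htube t0T' xd.
  have N1 := unit_normal hGam t0T' Gp; set N := nu _ in SN N1.
  have := dotp_le S N; have := dotp_le (- S) N; rewrite enormN dotpNl SN N1 mulr1.
  by case: side_sign => ->; lra.
have vS0 : 0 <= dotp v S.
  have := tame_is_derive (- v, 0) side_tame X0; rewrite (tame_derive _ _ side_tame X0) mul0r addr0.
  move=> /(is_derive_slice_space _ _ _ _).1 /= D.
  have D0 : is_derive (0 : R) (1 : R) (fun s : R => side sg g (x0 + s *: (- v), t0)) (- dotp v S).
    apply: (is_derive_line (fun x => side sg g (x, t0)) x0 (- v) 0 _).1.
    by rewrite scale0r addr0 -dotpNl.
  have D1 : is_derive (0 : R) (1 : R) (fun s : R => - side sg g (x0 + s *: (- v), t0)) (dotp v S).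
    by have := is_deriveN D0; rewrite opprK; exact.
  apply: (derive_right_ge0 D1); apply: filterS vin => s [Os _].
  rewrite scale0r addr0 x0g oppr0 oppr_ge0 scalerN ltW//.
  exact: side_neg.
pose w := dotp S S *: v - dotp v S *: S.
have wS : dotp w S = 0 by rewrite /w dotpDl dotpNl !dotpZl mulrC subrr.
have w0 : w = 0.
  apply: dotp_eq0; rewrite {2}/w dotpDr dotpNr !dotpZr wS mulr0 subr0 dotpC.
  by rewrite (vT w (side_tangent wS)) mulr0.
have SE : dotp S S *: v = dotp v S *: S by apply/eqP; rewrite -subr_eq0 -/w w0.
have SS : dotp S S = enorm S ^+ 2 by rewrite sqr_enorm.
have S0 : 0 < enorm S by apply: lt_le_trans S1.
have vS : dotp v S = enorm S.
  have := f_equal (@enorm R n) SE; rewrite !enormZ v1 mulr1 SS.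
  rewrite (ger0_norm vS0) ger0_norm ?sqr_ge0// expr2 => /mulIf -> //.
  by rewrite gt_eqF.
split=> //; move: SE; rewrite SS vS expr2 -scalerA => /(scalerI _); apply.
by rewrite gt_eqF.
Qed.

(** Any curve carried by the boundary stays on the same component, because the two
    are separated by the width; differentiate [side] along it. *)
Lemma side_velocity v V : outward_unit_normal (Om t0) (frontier (Om t0)) x0 v ->
  normal_velocity T (fun s => frontier (Om s)) t0 x0 v V ->
  enorm (sgrad (side sg g) (x0, t0)) * V = - 'D_(0, 1) (side sg g) (x0, t0).
Proof.
move=> vn [[c [w [c0 cw cF]]] /(_ c w) Vw]; have X0 := frontier_in_X.
have [vS _] := side_normal vn; set S := sgrad _ _ in vS *.
have -> : V = dotp w v by apply: Vw.
rewrite -dotpZr vS; set q : R -> ST := fun s => (c s, s).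
have q0 : q t0 = (x0, t0) by rewrite /q c0.
have qd : is_derive t0 (1 : R) q (w, 1) by apply: is_derive_pair => //; exact: is_derive_id.
have qc : {for t0, continuous q}.
  by apply: differentiable_continuous; apply/derivable1_diffP; case: qd.
have Xq : \forall s \near t0, X (q s).
  by apply: qc; rewrite q0; exact: (open_nbhs_nbhs (conj Xo X0)).
have tT : \forall s \near t0, 0 < s < T.
  have t0i : t0 \in `]0, T[ by rewrite in_itv.
  by apply: filterS (near_in_itvoo t0i) => s; rewrite in_itv.
have other : \forall s \near t0, dist (q s) - eps * pull g' (q s) != 0.
  have cv : dist (q s) - eps * pull g' (q s) @[s --> t0] --> dist (q t0) - eps * pull g' (q t0).
    have cq f : tame f -> f (q s) @[s --> t0] --> f (q t0).
      move=> ft; apply: continuous_comp => //; rewrite q0; exact: tame_continuous.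
    apply: cvgB; first exact: (cq _ dist_tame).
    by apply: cvgM; [exact: cvg_cst|exact: (cq _ (pull_tame side_smooth'))].
  have ne0 : dist (q t0) - eps * pull g' (q t0) != 0.
    rewrite q0 (side_eq0 _).1// -mulrBr; have := dist_pull_gap.
    by case: eqP => // E; rewrite mulrAC E mul0r ltxx.
  by move: cv => /cvgr_neq0; exact.
have sd : is_derive t0 (1 : R) (side sg g \o q) ('D_(w, 1) (side sg g) (q t0)).
  apply: is_derive_curve => //; rewrite q0.
  by have [] := extendable_differentiable Xo XK side_tame X0.
have s0 : is_derive t0 (1 : R) (side sg g \o q) 0.
  apply: near_eq_is_derive (is_derive_cst (0 : R) t0 (1 : R)).
  near=> s; apply/esym/side_eq0.
  have sT : 0 < s < T by near: s.
  have sF : frontier (Om s) (c s).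
    suff : 0 <= s <= T by near: s.
    by case/andP: sT => *; rewrite !ltW.
  have [_ E] := (thin_frontierP (c s) sT).1 sF.
  have : dist (q s) - eps * pull g' (q s) != 0 by near: s.
  rewrite subr_eq0; move: E; rewrite -/(q s).
  by case: sgg => -[_ [-> ->]] [] -> //; rewrite eqxx.
have : 'D_(w, 1) (side sg g) (x0, t0) = 0.
  by rewrite -q0; have [_ <-] := sd; have [_ ->] := s0.
rewrite (tame_derive _ _ side_tame X0) mul1r -/S; lra.
Unshelve. all: by end_near. Qed.

End one_side.
End lateral.

(** * The barrier *)

Lemma is_derive_expR_comp (R : realType) (V : normedModType R) (h : V -> R) q v (l : R) :
  is_derive q v h l -> is_derive q v (fun z => expR (h z)) (expR (h q) * l).
Proof.
move=> hd; suff : is_derive (q + (0 : R) *: v) v (fun z => expR (h z)) (expR (h q) * l).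
  by rewrite scale0r addr0.
apply: (is_derive_line _ q v 0 _).2.
have H0 : is_derive (0 : R) (1 : R) (fun s : R => h (q + s *: v)) l.
  by apply: (is_derive_line h q v 0 l).1; rewrite scale0r addr0.
have ed x : differentiable (@expR R) x by apply/derivable1_diffP.
have := is_derive_curve (ed _) H0; rewrite scale0r addr0.
congr (is_derive _ _ _ _).
have := is_derive_scale_dir l (is_derive_expR (h q)).
rewrite [l *: (1 : R)]mulr1 => -[_ ->]; exact: mulrC.
Qed.

Lemma common_bound (R : realType) (n : nat) (P : 'I_n -> R -> Prop) :
  (forall i, exists2 B : R, 0 <= B & P i B) ->
  (forall i (B B' : R), P i B -> B <= B' -> P i B') ->
  exists2 B : R, 0 <= B & forall i, P i B.
Proof.
move=> PB Pmono; have /choice [B HB] : forall i, exists B : R, 0 <= B /\ P i B.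
  by move=> i; have [B B0 H] := PB i; exists B.
exists (\sum_i B i); first by apply: sumr_ge0 => i _; case: (HB i).
move=> i; apply: Pmono (HB i).2 _.
by rewrite (bigD1 i)//= lerDl; apply: sumr_ge0 => j _; case: (HB j).
Qed.

Section barrier.
Variables (R : realType) (n : nat) (T : R).
Variables (Gam : R -> set 'rV[R]_n) (nu Phi : 'rV[R]_n * R -> 'rV[R]_n).
Variables (delta : R) (proj : 'rV[R]_n * R -> 'rV[R]_n).
Variables (g0 g1 : 'rV[R]_n * R -> R) (eps0 kd : R).
Hypotheses (hT : 0 < T) (hGam : moving_surface T Gam nu Phi)
  (htube : tubular_neighborhood T Gam nu delta proj)
  (hwidth : thin_width T Gam delta g0 g1 eps0) (hkd : 0 < kd).
Local Notation ST := ('rV[R]_n * R)%type.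
Local Notation dist := (dist Gam).
Local Notation surface := (slab `[0, T] Gam).
Local Notation Om := (thin_domain Gam nu g0 g1).
Local Notation X := (tube_interior T Gam delta).
Local Notation K := (closed_tube T Gam nu delta).
Local Notation tame := (extendable X K).
Local Notation dx i := ((delta_mx 0 i, 0) : ST).
Local Notation dt := (((0 : 'rV[R]_n), (1 : R)) : ST).
Local Notation G0 := (pull proj g0).
Local Notation G1 := (pull proj g1).

Let Xo : open X := tube_interior_open hGam htube.
Let XK : X `<=` K := tube_interior_sub htube.
Let Kc : compact K := closed_tube_compact hT hGam htube.
Let tder f v : tame f -> tame ('D_v f) := @extendable_derive _ _ X K Xo f v.
Let tis f q v (ft : tame f) (Xq : X q) := @tame_is_derive _ _ _ _ _ _ _ _ hGam htube f q v ft Xq.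

(** Minus the normal velocity of the surface, transported along normals. *)
Definition dist_t : ST -> R := 'D_dt dist.

Let td : tame dist := dist_tame hGam htube.
Let tb : tame dist_t := tder dt td.
Let t0 : tame G0 := pull_tame hGam htube (tw_smooth0 hwidth).
Let t1 : tame G1 := pull_tame hGam htube (tw_smooth1 hwidth).

Definition potential (A eps : R) (q : ST) : R :=
  kd^-1 * (dist_t q * dist q) +
  A * ((dist q - eps * G0 q) * (dist q - eps * G1 q)).

(** The potential has this form with coefficients independent of [eps], so that
    bounds on its derivatives are uniform in [eps]. *)
Definition quadratic (a0 a1 a2 : ST -> R) (eps : R) (q : ST) : R :=
  a0 q + (eps * a1 q + eps ^+ 2 * a2 q).

Lemma quadratic_tame a0 a1 a2 eps : tame a0 -> tame a1 -> tame a2 ->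
  tame (quadratic a0 a1 a2 eps).
Proof.
move=> ta0 ta1 ta2; apply: extendable_add => //.
by apply: extendable_add; apply: extendable_mul => //; exact: extendable_cst.
Qed.

Lemma potential_quadratic A : exists a0 a1 a2, [/\ tame a0, tame a1, tame a2 &
  forall eps, potential A eps = quadratic a0 a1 a2 eps].
Proof.
pose a0 q := kd^-1 * (dist_t q * dist q) + A * (dist q * dist q).
pose a1 q := - A * (dist q * (G0 q + G1 q)).
pose a2 q := A * (G0 q * G1 q).
have C a : tame (fun _ => a) by exact: extendable_cst.
exists a0, a1, a2; split.
- by apply: extendable_add; apply: extendable_mul => //; exact: extendable_mul.
- by apply: extendable_mul => //; apply: extendable_mul => //; exact: extendable_add.
- by apply: extendable_mul => //; exact: extendable_mul.
- by move=> eps; apply/funext => q; rewrite /potential /quadratic /a0 /a1 /a2; ring.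
Qed.

Lemma potential_tame A eps : tame (potential A eps).
Proof.
have [a0 [a1 [a2 [ta0 ta1 ta2 ->]]]] := potential_quadratic A.
exact: quadratic_tame.
Qed.

Lemma potential_derive A eps q u : X q ->
  is_derive q u (potential A eps)
    (kd^-1 * (dist_t q * 'D_u dist q + dist q * 'D_u dist_t q) +
     A * ((dist q - eps * G0 q) * ('D_u dist q - eps * 'D_u G1 q) +
          (dist q - eps * G1 q) * ('D_u dist q - eps * 'D_u G0 q))).
Proof.
move=> Xq.
have Dd := tis u td Xq; have Db := tis u tb Xq.
have D0 := is_deriveB Dd (is_deriveZ eps (tis u t0 Xq)).
have D1 := is_deriveB Dd (is_deriveZ eps (tis u t1 Xq)).
exact: (is_deriveD (is_deriveZ kd^-1 (is_deriveM Db Dd)) (is_deriveZ A (is_deriveM D0 D1))).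
Qed.

Lemma tame_bound f : tame f -> exists2 B : R, 0 <= B & forall q, X q -> `|f q| <= B.
Proof.
move=> /(extendable_bounded XK Kc) [B HB]; exists `|B| => // q Xq.
by rewrite (le_trans (HB q Xq))// ler_norm.
Qed.

Lemma tame_bound_fin (f : 'I_n -> ST -> R) : (forall i, tame (f i)) ->
  exists2 B : R, 0 <= B & forall i q, X q -> `|f i q| <= B.
Proof.
move=> ft; have [|i B B' H BB' q Xq|B B0 H] :=
  @common_bound R n (fun i B => forall q, X q -> `|f i q| <= B).
- by move=> i; have [B B0 H] := tame_bound (ft i); exists B.
- exact: le_trans (H q Xq) BB'.
- by exists B.
Qed.

Lemma side_derive eps sg g q u : tame (pull proj g) -> X q ->
  is_derive q u (side Gam proj eps sg g) (sg * ('D_u dist q - eps * 'D_u (pull proj g) q)).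
Proof.
move=> gt Xq.
exact: (is_deriveZ sg (is_deriveB (tis u td Xq) (is_deriveZ eps (tis u gt Xq)))).
Qed.

(** The term [dist_t * dist / kd] cancels the velocity of the boundary to leading
    order; what remains is of order [eps] and is dominated, for [A] large, by the
    derivative of the term with coefficient [A], which is positive on both
    components because the width is bounded below. *)
Lemma potential_lateral : exists2 A : R, 0 <= A &
  forall eps x t v V, 0 < eps < eps0 -> 0 < t < T -> frontier (Om eps t) x ->
    outward_unit_normal (Om eps t) (frontier (Om eps t)) x v ->
    normal_velocity T (fun s => frontier (Om eps s)) t x v V ->
    eps * kd <= kd * dotp v (sgrad (potential A eps) (x, t)) + V.
Proof.
have [c c0 cg] := gap_pos hwidth.
have [Bg0 Bg00 Hg0] := tame_bound t0.
have [Bg1 Bg10 Hg1] := tame_bound t1.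
have [Bt0 Bt00 Ht0] := tame_bound (tder dt t0).
have [Bt1 Bt10 Ht1] := tame_bound (tder dt t1).
have [Bb Bb0 Hb] := tame_bound_fin (fun i => tder (dx i) tb).
pose C := (Bg0 + Bg1) * (n%:R * Bb) + (Bt0 + Bt1).
have C0 : 0 <= C by rewrite addr_ge0 ?mulr_ge0 ?addr_ge0.
(* [C] bounds the remainder divided by [eps]; the choice gives [kd A c - C = kd]. *)
pose A := (C + kd) / (kd * c).
have kc : 0 < kd * c by rewrite mulr_gt0.
have A0 : 0 <= A by rewrite divr_ge0 ?(ltW kc)// addr_ge0// ltW.
have AE : kd * A * c = C + kd by rewrite /A; field; rewrite !gt_eqF.
exists A => // eps x t v V heps tT xF vn VV.
have [xc xe] := (thin_frontierP hT hGam htube hwidth heps x tT).1 xF.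
have Xq : X (x, t) := frontier_in_X hT hGam htube hwidth heps tT xF.
have /andP[e0 _] := heps.
have [sg [g [g' [sgg x0g]]]] : exists sg g g', is_side g0 g1 sg g g' /\ side Gam proj eps sg g (x, t) = 0.
  have H0 : is_side g0 g1 (-1) g0 g1 by right.
  have H1 : is_side g0 g1 1 g1 g0 by left.
  case: xe => xe; [exists (-1), g0, g1|exists 1, g1, g0]; split=> //.
    exact: (@side_eq0 R n Gam proj g0 g1 eps _ _ _ H0 (x, t)).2.
  exact: (@side_eq0 R n Gam proj g0 g1 eps _ _ _ H1 (x, t)).2.
have [LS L1] := side_normal hT hGam htube hwidth heps sgg tT xF x0g vn.
have LV := side_velocity hT hGam htube hwidth heps sgg tT xF x0g vn VV.
have Sd := side_dist hT hGam htube hwidth heps sgg tT xF.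
set S := sgrad _ _ in LS L1 LV Sd; set L := enorm S in LS L1 LV.
have tg : tame (pull proj g) := pull_tame hGam htube (side_smooth hwidth sgg).
have ts : tame (side Gam proj eps sg g) := side_tame eps hGam htube hwidth sgg.
have L0 : 0 < L by apply: lt_le_trans L1.
have SS : 'D_(S, 0) (side Gam proj eps sg g) (x, t) = L ^+ 2.
  by rewrite (tame_derive hGam htube _ _ ts Xq) mul0r addr0 sqr_enorm.
have [_ SSE] := side_derive eps sg (S, 0) tg Xq; rewrite SS Sd in SSE.
have [_ STE] := side_derive eps sg dt tg Xq; rewrite STE in LV.
have dE : dist (x, t) = eps * pull proj g (x, t) by apply: (@side_eq0 R n Gam proj g0 g1 eps _ _ _ sgg (x, t)).1.
have vb : `|dotp v (sgrad dist_t (x, t))| <= n%:R * Bb.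
  have [v1 _ _] := vn; apply: (le_trans (ler_norm_sum _ _ _)).
  rewrite -[X in X%:R]card_ord -sumr_const mulr_suml; apply: ler_sum => i _.
  rewrite normrM mxE mul1r -[leRHS]mul1r; apply: ler_pM => //.
    by rewrite -v1; exact: coord_le_enorm.
  exact: Hb.
have Sb : 'D_(S, 0) dist_t (x, t) = L * dotp v (sgrad dist_t (x, t)).
  by rewrite (tame_derive hGam htube _ _ tb Xq) mul0r addr0 -{1}LS dotpZl.
have tp : tame (potential A eps) by exact: potential_tame.
have Sp : 'D_(S, 0) (potential A eps) (x, t) = L * dotp v (sgrad (potential A eps) (x, t)).
  by rewrite (tame_derive hGam htube _ _ tp Xq) mul0r addr0 -{1}LS dotpZl.
have [_ LPE] := potential_derive A eps (S, 0) Xq; rewrite Sp Sd Sb in LPE.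
set P := dotp v (sgrad (potential A eps) (x, t)) in LPE *.
set b := dist_t (x, t) in LPE; set vbv := dotp v _ in vb LPE.
have bE : 'D_dt dist (x, t) = b by [].
rewrite bE in LV.
set G := pull proj g (x, t) in dE.
set Gt := 'D_dt (pull proj g) (x, t) in LV.
have Gb : `|G| <= Bg0 + Bg1.
  rewrite /G; case: sgg => -[_ [-> _]].
    by rewrite (le_trans (Hg1 _ Xq))// lerDr.
  by rewrite (le_trans (Hg0 _ Xq))// lerDl.
have Gtb : `|Gt| <= Bt0 + Bt1.
  rewrite /Gt; case: sgg => -[_ [-> _]].
    by rewrite (le_trans (Ht1 _ Xq))// lerDr.
  by rewrite (le_trans (Ht0 _ Xq))// lerDl.
have gap : c <= G1 (x, t) - G0 (x, t).
  have [/= t0T _ _] := xc; have [Gp _ _ _] := tube_proj htube t0T (ltW Xq.2).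
  by apply: cg; split=> //=; rewrite in_itv.
have key : L * P = kd^-1 * (b * sg + eps * G * (L * vbv)) +
   A * (eps * (G1 (x, t) - G0 (x, t)) * L ^+ 2).
  rewrite LPE dE SSE; case: (sgg) => -[-> [gE _]]; rewrite /G gE; ring.
have E : L * (kd * P + V) = eps * (L * (G * vbv) +
    kd * A * (G1 (x, t) - G0 (x, t)) * L ^+ 2 + sg * Gt).
  by rewrite mulrDr LV mulrCA key; field; rewrite gt_eqF.
have C1 : `|G * vbv| <= (Bg0 + Bg1) * (n%:R * Bb).
  by rewrite normrM; apply: ler_pM.
have C2 : `|sg * Gt| <= Bt0 + Bt1.
  by rewrite normrM; case: (side_sign sgg) => ->; rewrite ?normrN normr1 mul1r.
move: C1 C2; rewrite !ler_norml => /andP[C1 _] /andP[C2 _].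
have C3 : L * (- ((Bg0 + Bg1) * (n%:R * Bb))) <= L * (G * vbv) by rewrite ler_pM2l.
have C4 : kd * A * c * L <= kd * A * (G1 (x, t) - G0 (x, t)) * L ^+ 2.
  apply: ler_pM; [by apply: mulr_ge0; [apply: mulr_ge0 => //; exact: ltW|exact: ltW]|exact: ltW| |].
    by rewrite ler_wpM2l// mulr_ge0// ltW.
  by rewrite expr2 ler_peMr// ltW.
have C5 : Bt0 + Bt1 <= L * (Bt0 + Bt1) by rewrite ler_peMl// addr_ge0.
(* Compare after multiplication by the length [L >= 1] of the gradient. *)
rewrite -(ler_pM2l L0) E mulrCA ler_pM2l//.
move: C4; rewrite AE /C => C4; move: C1 C2 C3 C4 C5; clear; lra.
Qed.

Lemma quadratic_derive a0 a1 a2 eps q v : tame a0 -> tame a1 -> tame a2 -> X q ->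
  'D_v (quadratic a0 a1 a2 eps) q =
  quadratic ('D_v a0) ('D_v a1) ('D_v a2) eps q.
Proof.
move=> ta0 ta1 ta2 Xq.
have := is_deriveD (tis v ta0 Xq) (is_deriveD (is_deriveZ eps (tis v ta1 Xq))
  (is_deriveZ (eps ^+ 2) (tis v ta2 Xq))).
by case.
Qed.

Lemma quadratic_bound a0 a1 a2 : tame a0 -> tame a1 -> tame a2 ->
  exists2 B : R, 0 <= B & forall eps q, 0 <= eps <= 1 -> X q ->
    `|quadratic a0 a1 a2 eps q| <= B.
Proof.
move=> /tame_bound [B0 B00 H0] /tame_bound [B1 B10 H1] /tame_bound [B2 B20 H2].
exists (B0 + (B1 + B2)) => [|eps q /andP[e0 e1] Xq]; first by rewrite !addr_ge0.
have e2 : eps ^+ 2 <= 1 by rewrite exprn_ile1.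
rewrite /quadratic (le_trans (ler_normD _ _))// lerD ?H0//.
rewrite (le_trans (ler_normD _ _))//; apply: lerD.
  by rewrite normrM (ger0_norm e0) -[leRHS]mul1r; apply: ler_pM => //; exact: H1.
rewrite normrM (ger0_norm (sqr_ge0 _)) -[leRHS]mul1r.
by apply: ler_pM => //; [exact: sqr_ge0|exact: H2].
Qed.

Lemma potential_bounds A : exists2 B : R, 0 <= B & forall eps q, 0 <= eps <= 1 -> X q ->
  [/\ `|potential A eps q| <= B, `|'D_dt (potential A eps) q| <= B,
      forall i, `|'D_(dx i) (potential A eps) q| <= B &
      forall i, `|'D_(dx i) ('D_(dx i) (potential A eps)) q| <= B].
Proof.
have [a0 [a1 [a2 [ta0 ta1 ta2 pE]]]] := potential_quadratic A.
have [B0 B00 H0] := quadratic_bound ta0 ta1 ta2.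
have [B1 B10 H1] := quadratic_bound (tder dt ta0) (tder dt ta1) (tder dt ta2).
have mono (Q : 'I_n -> R -> ST -> R) : forall i (B B' : R),
    (forall eps q, 0 <= eps <= 1 -> X q -> `|Q i eps q| <= B) -> B <= B' ->
    forall eps q, 0 <= eps <= 1 -> X q -> `|Q i eps q| <= B'.
  by move=> i B B' H BB' eps q he Xq; exact: le_trans (H eps q he Xq) BB'.
have [i|B2 B20 H2] := common_bound _ (mono (fun i => quadratic ('D_(dx i) a0) ('D_(dx i) a1) ('D_(dx i) a2))).
  by apply: quadratic_bound; exact: tder.
have [i|B3 B30 H3] := common_bound _ (mono (fun i => quadratic ('D_(dx i) ('D_(dx i) a0))
    ('D_(dx i) ('D_(dx i) a1)) ('D_(dx i) ('D_(dx i) a2)))).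
  by apply: quadratic_bound; exact/tder/tder.
exists (B0 + (B1 + (B2 + B3))) => [|eps q he Xq]; first by rewrite !addr_ge0.
rewrite pE; split=> [||i|i].
- by rewrite (le_trans (H0 _ _ he Xq))// lerDl !addr_ge0.
- rewrite quadratic_derive// (le_trans (H1 _ _ he Xq))//.
  by rewrite addrCA lerDl !addr_ge0.
- rewrite quadratic_derive// (le_trans (H2 i _ _ he Xq))//.
  by rewrite addrA addrCA lerDl !addr_ge0.
- rewrite (@near_eq_derive _ _ _ _ (quadratic ('D_(dx i) a0) ('D_(dx i) a1) ('D_(dx i) a2) eps)).
    rewrite quadratic_derive//; try exact: tder.
    by rewrite (le_trans (H3 i _ _ he Xq))// !addrA lerDr !addr_ge0.
  by apply: (open_near_eq Xo _ Xq) => z; rewrite inE => Xz; exact: quadratic_derive.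
Qed.

Definition barrier (lam A eps : R) (q : ST) : R :=
  expR (lam * q.2 + potential A eps q).

Lemma barrier_derive lam A eps q v : X q -> is_derive q v (barrier lam A eps)
  (barrier lam A eps q * (lam * v.2 + 'D_v (potential A eps) q)).
Proof.
move=> Xq; apply: is_derive_expR_comp.
have ds : is_derive q v (fun z : ST => z.2) v.2.
  suff : is_derive (q + (0 : R) *: v) v (fun z : ST => z.2) v.2 by rewrite scale0r addr0.
  by apply: (is_derive_line _ q v 0 _).2; exact: is_derive_affine.
exact: (is_deriveD (is_deriveZ lam ds) (tis v (potential_tame A eps) Xq)).
Qed.

Lemma barrier_gt0 lam A eps q : 0 < barrier lam A eps q.
Proof. exact: expR_gt0. Qed.

(** The exponential of the potential turns the lateral inequality into a Robin
    condition with a positive coefficient of order [eps]; the factor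
    [exp (lam * t)] makes it a supersolution of the heat equation. *)
Lemma barrier_exists : exists m M : R, [/\ 0 < m, 0 < M &
  forall eps, 0 < eps < eps0 -> exists Psi : ST -> R,
  [/\ forall q, X q -> m <= Psi q <= M,
      forall q, X q -> {for q, continuous Psi},
      forall q, X q -> is_derive q dt Psi ('D_dt Psi q) /\
        forall v, is_derive q (v, 0) Psi (dotp v (sgrad Psi q)),
      forall q i, X q -> derivable ('D_(dx i) Psi) q (dx i) &
      (forall q, X q ->
        Psi q <= 'D_dt Psi q - kd * \sum_(i < n) 'D_(dx i) ('D_(dx i) Psi) q) /\
      forall x t v V, 0 < t < T -> frontier (Om eps t) x ->
        outward_unit_normal (Om eps t) (frontier (Om eps t)) x v ->
        normal_velocity T (fun s => frontier (Om eps s)) t x v V ->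
        eps * Psi (x, t) <= dotp v (sgrad Psi (x, t)) + kd^-1 * V * Psi (x, t)]].
Proof.
have [A A0 HA] := potential_lateral.
have [B B0 HB] := potential_bounds A.
(* [lam] dominates the derivatives of the potential in the heat operator. *)
pose lam := 1 + B + kd * (n%:R * (B + B ^+ 2)).
have lam0 : 0 <= lam.
  by rewrite /lam !addr_ge0 ?mulr_ge0 ?addr_ge0 ?sqr_ge0// ltW.
have lamP (a s : R) : - B <= a -> kd * s <= kd * (n%:R * (B + B ^+ 2)) -> 1 <= lam + a - kd * s.
  by rewrite /lam; lra.
exists (expR (- B)), (expR (lam * T + B)); split; [exact: expR_gt0|exact: expR_gt0|].
move=> eps heps; have he1 : 0 <= eps <= 1.
  by have /andP[e00 e01] := tw_eps0 hwidth; lra.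
pose Psi := barrier lam A eps; exists Psi.
have PsiD q v : X q -> is_derive q v Psi (Psi q * (lam * v.2 + 'D_v (potential A eps) q)).
  exact: barrier_derive.
have tp := potential_tame A eps.
have Psix q v : X q -> 'D_(v, 0) Psi q = Psi q * 'D_(v, 0) (potential A eps) q.
  by move=> Xq; have [_ ->] := PsiD q (v, 0) Xq; rewrite mulr0 add0r.
have sgradP q : X q -> sgrad Psi q = Psi q *: sgrad (potential A eps) q.
  by move=> Xq; apply/rowP => i; rewrite !mxE Psix.
have Psixx q i : X q -> is_derive q (dx i) ('D_(dx i) Psi)
    (Psi q * ('D_(dx i) ('D_(dx i) (potential A eps)) q + ('D_(dx i) (potential A eps) q) ^+ 2)).
  move=> Xq.
  have D1 := PsiD q (dx i) Xq; have D2 := tis (dx i) (tder (dx i) tp) Xq.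
  have := is_deriveM D1 D2; rewrite mulr0 add0r => D3.
  have D4 : is_derive q (dx i) (fun z => Psi z * 'D_(dx i) (potential A eps) z)
    (Psi q * ('D_(dx i) ('D_(dx i) (potential A eps)) q + ('D_(dx i) (potential A eps) q) ^+ 2)).
    apply: (is_derive_eq D3); rewrite mulrDr expr2; congr (_ + _); exact: mulrCA.
  apply: near_eq_is_derive D4.
  by apply: (open_near_eq Xo _ Xq) => z; rewrite inE => Xz; rewrite Psix.
split.
- move=> q Xq; have [H _ _ _] := HB eps q he1 Xq.
  have [/andP[q0 qT] _] := Xq; move: H; rewrite ler_norml => /andP[H1 H2].
  rewrite /Psi /barrier !ler_expR; apply/andP; split.
    by rewrite (le_trans H1)// lerDr mulr_ge0// ltW.
  by rewrite lerD// ler_wpM2l// ltW.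
- move=> q Xq; rewrite /Psi /barrier.
  apply: (@continuous_comp _ _ _ (fun q : ST => lam * q.2 + potential A eps q) (@expR R)); last exact: continuous_expR.
  apply: cvgD; last exact: (tame_continuous hGam htube tp Xq).
  by apply: cvgM; [exact: cvg_cst|exact: cvg_snd].
- move=> q Xq; split; first by have [d _] := PsiD q dt Xq; exact: derivableP.
  move=> v; apply: (is_derive_eq (PsiD q (v, 0) Xq)).
  by rewrite mulr0 add0r sgradP// dotpZr (tame_derive hGam htube _ _ tp Xq) mul0r addr0.
- by move=> q i Xq; case: (Psixx q i Xq).
- split=> [q Xq|x t v V tT xF vn VV].
    have [_ H1 H2 H3] := HB eps q he1 Xq.
    have [_ ->] := PsiD q dt Xq; rewrite mulr1.
    under eq_bigr => i _ do rewrite (@derive_val _ _ _ _ _ _ _ (Psixx q i Xq)).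
    rewrite -mulr_sumr mulrCA -mulrBr ler_peMr//; first exact/ltW/barrier_gt0.
    have S : \sum_(i < n) ('D_(dx i) ('D_(dx i) (potential A eps)) q +
        ('D_(dx i) (potential A eps) q) ^+ 2) <= n%:R * (B + B ^+ 2).
      rewrite -[X in X%:R]card_ord -sumr_const mulr_suml; apply: ler_sum => i _.
      rewrite mul1r lerD//; first by rewrite (le_trans (ler_norm _)).
      by rewrite (le_trans (ler_norm _))// normrX lerXn2r ?nnegrE.
    have S' := ler_wpM2l (ltW hkd) S.
    move: H1; rewrite ler_norml => /andP[H1 _].
    exact: lamP.
  have Xq : X (x, t) := frontier_in_X hT hGam htube hwidth heps tT xF.
  have H := HA eps x t v V heps tT xF vn VV.
  rewrite sgradP// dotpZr.
  have -> : Psi (x, t) * dotp v (sgrad (potential A eps) (x, t)) + kd^-1 * V * Psi (x, t) =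
      (kd * dotp v (sgrad (potential A eps) (x, t)) + V) / kd * Psi (x, t).
    by field; rewrite gt_eqF.
  by rewrite ler_pM2r ?barrier_gt0// ler_pdivlMr.
Qed.

End barrier.

(** * Extremum conditions in one variable *)

Section one_variable.
Variable R : realType.
Implicit Types f g r P : R -> R.

Lemma derive_left_ge0 f (k : R) :
  is_derive (0 : R) (1 : R) f k -> (\forall s \near (0 : R)^'+, f (- s) <= f 0) ->
  0 <= k.
Proof.
move=> fd f0.
have D : is_derive (0 : R) (1 : R) (fun s => - f (0 + s *: (-1 : R))) k.
  have H1 : is_derive ((0 : R) + (0 : R) *: (-1 : R)) (-1 : R) f (- k).
    rewrite scale0r addr0; have := is_derive_scale_dir (-1) fd.
    by rewrite [_ *: (1 : R)]mulr1 scaleN1r.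
  have H2 := (is_derive_line f 0 (-1) 0 (- k)).1 H1.
  by have := is_deriveN H2; rewrite opprK; exact.
apply: (derive_right_ge0 D); apply: filterS f0 => s.
by rewrite !add0r scale0r scalerN [_ *: (1 : R)]mulr1 lerN2.
Qed.

Lemma at_right_opp (Q : R -> Prop) :
  (\forall s \near (0 : R), Q s) -> \forall s \near (0 : R)^'+, Q (- s).
Proof.
move=> Q0; have : \forall s \near (0 : R), Q (- s).
  have c : - s @[s --> (0 : R)] --> (- 0 : R) by apply: cvgN; exact: cvg_id.
  by rewrite oppr0 in c; apply: c.
by move=> H; apply: cvg_within.
Qed.

Lemma at_right_interval (Q : R -> Prop) : (\forall s \near (0 : R)^'+, Q s) ->
  exists2 e : R, 0 < e & forall s, 0 < s <= e -> Q s.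
Proof.
rewrite /at_right near_withinE => /nbhs_ballP [e /= e0 He].
exists (e / 2) => [|s /andP[s0 se]]; first by rewrite divr_gt0.
apply: He => //; rewrite /ball/= sub0r normrN gtr0_norm//; lra.
Qed.

Lemma right_mvt r r1 (e : R) : 0 < e ->
  (forall s, 0 < s <= e -> is_derive s (1 : R) r (r1 s)) ->
  r s @[s --> (0 : R)^'+] --> r 0 ->
  exists2 c, 0 < c < e & r e - r 0 = r1 c * e.
Proof.
move=> e0 rd rc.
have rcont s : 0 < s <= e -> {for s, continuous r}.
  move=> /rd [d _]; apply: differentiable_continuous; exact/derivable1_diffP.
have [||c ce H] := @MVT R r r1 0 e e0.
- by move=> s; rewrite in_itv/= => /andP[s0 /ltW se]; apply: rd; rewrite s0.
- apply/continuous_within_itvP => //; split=> //.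
    by move=> s; rewrite in_itv/= => /andP[s0 /ltW se]; apply: rcont; rewrite s0.
  by apply: cvg_at_left_filter; apply: rcont; rewrite e0 lexx.
by exists c; [move: ce; rewrite in_itv|rewrite H subr0].
Qed.

Lemma second_derivative_max f f1 (k : R) :
  (\forall s \near (0 : R), is_derive s (1 : R) f (f1 s)) ->
  is_derive (0 : R) (1 : R) f1 k ->
  (\forall s \near (0 : R), f s <= f 0) -> k <= 0.
Proof.
move=> fd f1d fmax.
have fmr : \forall s \near (0 : R)^'+, f s <= f 0 by exact: cvg_within.
have f10 : f1 0 = 0.
  apply/eqP; rewrite eq_le; apply/andP; split.
    rewrite -oppr_ge0; apply: derive_right_ge0 (is_deriveN (nbhs_singleton fd)) _.
    by apply: filterS fmr => s; rewrite lerN2.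
  apply: derive_left_ge0 (nbhs_singleton fd) _.
  exact: (at_right_opp fmax).
rewrite leNgt; apply/negP => k0.
have f1pos : \forall s \near (0 : R)^'+, 0 < f1 s.
  have : (h^-1 *: (f1 (h *: (1 : R) + 0) - f1 0)) @[h --> (0 : R)^'] --> k.
    by have [d <-] := f1d; exact: d.
  move=> /cvgr_gt /(_ _ k0) /at_right_dnbhs; rewrite /at_right !near_withinE.
  apply: filterS => h + h0 => /(_ h0).
  by rewrite f10 subr0 addr0 [h *: (1 : R)]mulr1 pmulr_rgt0// invr_gt0.
have H : \forall s \near (0 : R)^'+, is_derive s (1 : R) f (f1 s) /\ 0 < f1 s.
  by apply: filterI => //; exact: cvg_within.
have [e e0 He] : exists2 e : R, 0 < e & forall s, 0 < s <= e ->
    f s <= f 0 /\ 0 < f1 s /\ is_derive s (1 : R) f (f1 s).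
  by apply: at_right_interval; apply: filterS2 fmr H => s ? [].
have [||c ce fe] := @right_mvt f f1 e e0.
- by move=> s /He [_ []].
- apply: cvg_at_right_filter; apply: differentiable_continuous.
  by apply/derivable1_diffP; case: (nbhs_singleton fd).
have [fe0 _] := He e (andb_true_intro (conj e0 (lexx e))).
have [_ [fc0 _]] : f c <= f 0 /\ 0 < f1 c /\ is_derive c (1 : R) f (f1 c).
  by apply: He; case/andP: ce => -> /ltW.
have : 0 < f1 c * e by rewrite mulr_gt0.
by rewrite -fe subr_gt0 ltNge fe0.
Qed.

(** First-order condition at a boundary maximum, for a function [r] that is only
    differentiable off the boundary with a derivative continuous up to it. *)
Lemma one_sided_max r r1 P (l b : R) :
  (\forall s \near (0 : R)^'+, is_derive s (1 : R) r (r1 s)) ->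
  r s @[s --> (0 : R)^'+] --> r 0 -> r1 s @[s --> (0 : R)^'+] --> l ->
  is_derive (0 : R) (1 : R) P b ->
  (\forall s \near (0 : R)^'+, r s - P s <= r 0 - P 0) -> l <= b.
Proof.
move=> rd rc r1c Pd rP; rewrite leNgt; apply/negP => bl.
pose mu := (l + b) / 2; have bmu : b < mu by rewrite /mu; lra.
have mul : mu < l by rewrite /mu; lra.
have r1mu : \forall s \near (0 : R)^'+, mu < r1 s by move: r1c => /cvgr_gt; exact.
have [e e0 He] : exists2 e : R, 0 < e & forall s, 0 < s <= e ->
    mu < r1 s /\ is_derive s (1 : R) r (r1 s) /\ r s - P s <= r 0 - P 0.
  by apply: at_right_interval; apply: filterS3 r1mu rd rP.
have D : is_derive (0 : R) (1 : R) (fun s => P s - (0 + s * mu)) (b - mu).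
  exact: (is_deriveB Pd (is_derive_affine (0 : R^o) mu (0 : R))).
have : 0 <= b - mu.
  apply: (derive_right_ge0 D); near=> s; rewrite !add0r mul0r subr0.
  have s0 : 0 < s by near: s; exact: nbhs_right_gt.
  have se : s <= e by near: s; exact: nbhs_right_le.
  have [||c cs rs] := @right_mvt r r1 s s0.
  - by move=> u /andP[u0 us]; have [_ []] : mu < r1 u /\ is_derive u (1 : R) r (r1 u) /\ r u - P u <= r 0 - P 0
      by apply: He; rewrite u0 (le_trans us).
  - exact: rc.
  have [_ [_ H]] := He s (andb_true_intro (conj s0 se)).
  have [cmu _] : mu < r1 c /\ is_derive c (1 : R) r (r1 c) /\ r c - P c <= r 0 - P 0.
    by apply: He; case/andP: cs => -> /ltW cs; rewrite (le_trans cs).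
  have : mu * s <= r1 c * s by rewrite ler_wpM2r// ltW.
  rewrite -rs; lra.
lra.
Unshelve. all: by end_near. Qed.

Lemma is_time_derivative_derive (T : R) f (t l : R) : t < T ->
  is_time_derivative T f t l -> is_derive t (1 : R) f l.
Proof.
move=> tT H.
have cv : (h^-1 *: (f (h *: (1 : R) + t) - f t)) @[h --> (0 : R)^'] --> l.
  have H' : (fun h => h^-1 * (f (t + h) - f t)) @ (0 : R)^' --> l.
    move=> C /H HC.
    have HC' : \forall h \near (0 : R)^', t + h <= T -> C (h^-1 * (f (t + h) - f t)) := HC.
    have : \forall h \near (0 : R)^', t + h <= T.
      apply: cvg_within; have c : t + h @[h --> (0 : R)] --> t + 0.
        by apply: cvgD; [exact: cvg_cst|exact: cvg_id].
      have : t + 0 < T by rewrite addr0.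
      by move=> tT'; move: c => /cvgr_lt/(_ _ tT'); apply: filterS => h /ltW.
    by apply: filterS2 HC' => h; exact.
  apply: cvg_trans H'; apply: near_eq_cvg; near=> h.
  by rewrite [h *: (1 : R)]mulr1 (addrC h).
by apply: DeriveDef; [apply/cvg_ex; exists l|exact: cvg_lim cv].
Unshelve. all: by end_near. Qed.

End one_variable.

(** * The comparison principle *)

Lemma dotp_continuous (R : realType) (n : nat) (v : 'rV[R]_n) :
  continuous (fun x : 'rV[R]_n => dotp v x).
Proof.
have := @continuous_big R 'I_n +%R 0 xpredT (@add_continuous R) _ (index_enum 'I_n)
  (fun i (x : 'rV[R]_n) => v 0 i * x 0 i).
apply => i _ z; apply: (@cvgM _ _ (nbhs z)); first exact: cvg_cst.
exact: coord_continuous.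
Qed.

Section comparison.
Variables (R : realType) (n : nat) (T : R).
Variables (Gam : R -> set 'rV[R]_n) (nu Phi : 'rV[R]_n * R -> 'rV[R]_n).
Variables (delta : R) (proj : 'rV[R]_n * R -> 'rV[R]_n).
Variables (g0 g1 : 'rV[R]_n * R -> R) (eps0 eps kd : R).
Hypotheses (hT : 0 < T) (hGam : moving_surface T Gam nu Phi)
  (htube : tubular_neighborhood T Gam nu delta proj)
  (hwidth : thin_width T Gam delta g0 g1 eps0) (heps : 0 < eps < eps0) (hkd : 0 < kd).
Local Notation ST := ('rV[R]_n * R)%type.
Local Notation Om := (thin_domain Gam nu g0 g1 eps).
Local Notation thin_closed := (thin_closed T Gam delta proj g0 g1 eps).
Local Notation X := (tube_interior T Gam delta).
Local Notation dx i := ((delta_mx 0 i, 0) : ST).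
Local Notation dt := (((0 : 'rV[R]_n), (1 : R)) : ST).

Lemma Qbar_thin_closed : slab `[0, T] (fun t => closure (Om t)) = thin_closed.
Proof.
apply/seteqP; split=> [[x t] [/=]|[x t] xc].
  by rewrite in_itv/= => t0T /(closure_thinP hT hGam htube hwidth heps x t0T).
have [/= t0T _ _] := xc; split => /=; first by rewrite in_itv.
exact/(closure_thinP hT hGam htube hwidth heps x t0T).
Qed.

Lemma thin_closed_split x t : 0 < t < T -> thin_closed (x, t) ->
  Om t x \/ frontier (Om t) x.
Proof.
move=> t0T xc; have [/= t0T' xd /andP[x0 x1]] := xc.
have [e|n0] := eqVneq (dist Gam (x, t)) (eps * pull proj g0 (x, t)).
  by right; apply/(thin_frontierP hT hGam htube hwidth heps x t0T); split=> //; left.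
have [e|n1] := eqVneq (dist Gam (x, t)) (eps * pull proj g1 (x, t)).
  by right; apply/(thin_frontierP hT hGam htube hwidth heps x t0T); split=> //; right.
left; apply/(thin_domainP hGam htube hwidth heps x t0T'); split=> //.
by rewrite !lt_neqAle x0 x1 n1 eq_sym n0.
Qed.

Variables (nue : ST -> 'rV[R]_n) (Ve : ST -> R) (rho0 : 'rV[R]_n -> R)
  (f psi rho : ST -> R) (gr : ST -> 'rV[R]_n) (rt : ST -> R).
Hypothesis sol : classical_solution_with T kd Om nue Ve rho0 f psi rho gr rt.
Hypothesis nueP : forall x t, 0 < t < T -> frontier (Om t) x ->
  outward_unit_normal (Om t) (frontier (Om t)) x (nue (x, t)).

Let in_Q x t : 0 < t < T -> Om t x -> slab `]0, T] Om (x, t).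
Proof.
by move=> /andP[t0 tT] Ox; split=> //=; rewrite in_itv/= t0 ltW.
Qed.

Lemma rho_continuous : {within thin_closed, continuous rho}.
Proof. by rewrite -Qbar_thin_closed; exact: cs_cont sol. Qed.

Lemma rho_differentiable x t : 0 < t < T -> Om t x ->
  forall v, is_derive x v (fun z => rho (z, t)) (dotp v (gr (x, t))).
Proof.
move=> t0T Ox v; have Oo := thin_domain_open hGam htube hwidth heps (ltW_itv t0T).
pose rt' := fun z => rho (z, t).
have grD z i : Om t z -> is_derive z (delta_mx 0 i) rt' (gr (z, t) 0 i).
  by move=> Oz; apply: (cs_grad sol); exact: in_Q.
have On : \forall z \near x, Om t z by exact: (open_nbhs_nbhs (conj Oo Ox)).
have [||dr DE] := @differentiable_row R n rt' x.
- by move=> i; apply: filterS On => z /(grD _ i) [].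
- move=> i.
  have c : gr (z, t) 0 i @[z --> x] --> gr (x, t) 0 i.
    have /subspace_continuousP gc := cs_grad_cont sol.
    have gx := gc (x, t) (or_introl (in_Q t0T Ox)).
    have cv : (z, t) @[z --> x] --> (x, t).
      exact: (@cvg_pair_nbhs _ _ _ (nbhs x) _ id (cst t) x t cvg_id (cvg_cst _)).
    have Sn : \forall z \near x, (slab `]0, T] Om `|` slab `]0, T] (fun t => frontier (Om t))) (z, t).
      by apply: filterS On => z Oz; left; exact: in_Q.
    have cw : (z, t) @[z --> x] --> within (slab `]0, T] Om `|`
        slab `]0, T] (fun t => frontier (Om t))) (nbhs (x, t)) by exact: cvg_to_within cv Sn.
    have gz : gr (z, t) @[z --> x] --> gr (x, t) := cvg_comp _ _ cw gx.
    exact: (cvg_comp _ _ gz (@coord_continuous _ _ _ 0 i (gr (x, t)))).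
  suff H : 'D_(delta_mx 0 i) rt' z @[z --> x] --> gr (x, t) 0 i.
    by have [_ E] := grD x i Ox; rewrite -E in H; exact: H.
  have nE : \forall z \near x, gr (z, t) 0 i = 'D_(delta_mx 0 i) rt' z.
    by apply: filterS On => z Oz; have [_ E] := grD z i Oz.
  by apply: cvg_trans c; exact: (near_eq_cvg nE).
apply: DeriveDef; first exact: diff_derivable.
by rewrite DE; apply: eq_bigr => i _; have [_ ->] := grD x i Ox.
Unshelve. all: by end_near. Qed.

Variables (Psi : ST -> R) (m : R).
Hypotheses (m_gt0 : 0 < m) (Psi_ge : forall q, X q -> m <= Psi q)
  (Psi_cont : forall q, X q -> {for q, continuous Psi})
  (Psi_dt : forall q, X q -> is_derive q dt Psi ('D_dt Psi q))
  (Psi_dv : forall q v, X q -> is_derive q (v, 0) Psi (dotp v (sgrad Psi q)))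
  (Psi_dxx : forall q i, X q -> derivable ('D_(dx i) Psi) q (dx i))
  (Psi_super : forall q, X q ->
    Psi q <= 'D_dt Psi q - kd * \sum_(i < n) 'D_(dx i) ('D_(dx i) Psi) q)
  (Psi_robin : forall x t, 0 < t < T -> frontier (Om t) x ->
    eps * Psi (x, t) <=
      dotp (nue (x, t)) (sgrad Psi (x, t)) + kd^-1 * Ve (x, t) * Psi (x, t)).

(** [rho - M Psi] is maximal with value zero at [(x, t)]: its time derivative is
    nonnegative there, as only earlier times compete, and its Laplacian nonpositive. *)
Lemma interior_max (M tau t1 : R) x t : 0 < tau -> t1 < T -> tau < t <= t1 ->
  Om t x -> 0 <= M -> rho (x, t) = M * Psi (x, t) ->
  (forall p, thin_closed p -> tau <= p.2 <= t1 -> rho p <= M * Psi p) ->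
  M * Psi (x, t) <= f (x, t).
Proof.
move=> tau0 t1T /andP[taut tt1] Ox M0 rhoE rhole.
have t0T : 0 < t < T by rewrite (lt_trans tau0)//= (le_lt_trans tt1).
have Oo := thin_domain_open hGam htube hwidth heps (ltW_itv t0T).
have t0T' : 0 <= t <= T by case/andP: t0T => *; rewrite !ltW.
have OX s z : 0 < s < T -> Om s z -> X (z, s).
  move=> s0T Oz; have /andP[s0 sT] := s0T; apply: thin_interior => //.
  by apply: (thin_domain_closed hGam htube hwidth heps) => //; rewrite !ltW.
have Xq := OX t x t0T Ox.
have OC s z : 0 < s < T -> Om s z -> thin_closed (z, s).
  move=> s0T Oz; apply: (thin_domain_closed hGam htube hwidth heps) => //.
  by case/andP: s0T => *; rewrite !ltW.
have time : M * 'D_dt Psi (x, t) <= rt (x, t).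
  have Dr : is_derive t (1 : R) (fun s => rho (x, s)) (rt (x, t)).
    apply: (@is_time_derivative_derive _ T); first by case/andP: t0T.
    exact: (cs_time sol (in_Q t0T Ox)).
  have DP := (is_derive_slice_time Psi (x, t) _).1 (Psi_dt Xq).
  have D1 : is_derive t (1 : R) (fun s => rho (x, s) - M * Psi (x, s)) (rt (x, t) - M * 'D_dt Psi (x, t)).
    exact: (is_deriveB Dr (is_deriveZ M DP)).
  have D2 : is_derive (0 : R) (1 : R) (fun s => rho (x, t + s *: (1 : R)) - M * Psi (x, t + s *: (1 : R)))
      (rt (x, t) - M * 'D_dt Psi (x, t)).
    by apply: (is_derive_line (fun s => rho (x, s) - M * Psi (x, s)) t (1 : R) 0 _).1; rewrite scale0r addr0.
  rewrite -subr_ge0; apply: (derive_left_ge0 D2).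
  have Osn : \forall s \near (0 : R), 0 < t + s < T /\ Om (t + s) x.
    have c : (x, t + s) @[s --> (0 : R)] --> (x, t + 0).
      apply: (@cvg_pair_nbhs _ _ _ (nbhs (0 : R))); first exact: cvg_cst.
      by apply: cvgD; [exact: cvg_cst|exact: cvg_id].
    rewrite addr0 in c; apply: (c [set p : ST | 0 < p.2 < T /\ Om p.2 p.1]).
    exact: (open_nbhs_nbhs (conj (thin_open hGam htube hwidth heps) _)).
  have Onr := at_right_opp Osn; near=> s.
  have s0 : 0 < s by near: s; exact: nbhs_right_gt.
  have st : s < t - tau by near: s; apply: nbhs_right_lt; rewrite subr_gt0.
  have [s0T Os] : 0 < t - s < T /\ Om (t - s) x by near: s.
  rewrite scale0r addr0 rhoE subrr [_ *: (1 : R)]mulr1 subr_le0.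
  apply: rhole; first exact: OC.
  apply/andP; split; first by rewrite /= lerBrDr -lerBrDl ltW.
  by rewrite /= lerBlDr (le_trans tt1)// lerDl ltW.
have space i : hess (fun z => rho (z, t)) x i i <= M * 'D_(dx i) ('D_(dx i) Psi) (x, t).
  pose e : 'rV[R]_n := delta_mx 0 i.
  have Osn : \forall s \near (0 : R), Om t (x + s *: e).
    have c : x + s *: e @[s --> (0 : R)] --> x + (0 : R) *: e.
      by apply: cvgD; [exact: cvg_cst|apply: cvgZr_tmp; exact: cvg_id].
    by rewrite scale0r addr0 in c; apply: c; exact: (open_nbhs_nbhs (conj Oo Ox)).
  pose z1 (s : R) := 'D_e (fun z => rho (z, t)) (x + s *: e) - M * 'D_(dx i) Psi (x + s *: e, t).
  have D1 : \forall s \near (0 : R), is_derive s (1 : R)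
      (fun s => rho (x + s *: e, t) - M * Psi (x + s *: e, t)) (z1 s).
    apply: filterS Osn => s Os.
    have [dr _] := rho_differentiable t0T Os e.
    have Dr := (is_derive_line (fun z => rho (z, t)) x e s _).1 (derivableP dr).
    have [dP _] := Psi_dv e (OX _ _ t0T Os).
    have DP := (is_derive_slice_space Psi (x + s *: e, t) e _).1 (derivableP dP).
    have DP' := (is_derive_line (fun z => Psi (z, t)) x e s _).1 DP.
    exact: (is_deriveB Dr (is_deriveZ M DP')).
  have D2 : is_derive (0 : R) (1 : R) z1
      (hess (fun z => rho (z, t)) x i i - M * 'D_(dx i) ('D_(dx i) Psi) (x, t)).
    have H1 : is_derive (0 : R) (1 : R) (fun s => 'D_e (fun z => rho (z, t)) (x + s *: e))
        (hess (fun z => rho (z, t)) x i i).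
      apply: (is_derive_line ('D_e (fun z => rho (z, t))) x e 0 _).1.
      rewrite scale0r addr0 mxE; apply: derivableP.
      by apply: (cs_hess sol); exact: in_Q.
    have Pxx : derivable ('D_(dx i) Psi) (x, t) (dx i) by exact: Psi_dxx.
    have H2 := (is_derive_slice_space ('D_(dx i) Psi) (x, t) e _).1 (derivableP Pxx).
    have H3 : is_derive (0 : R) (1 : R) (fun s => 'D_(dx i) Psi (x + s *: e, t))
        ('D_(dx i) ('D_(dx i) Psi) (x, t)).
      apply: (is_derive_line (fun z => 'D_(dx i) Psi (z, t)) x e 0 _).1.
      by rewrite scale0r addr0.
    exact: (is_deriveB H1 (is_deriveZ M H3)).
  rewrite -subr_le0; apply: (second_derivative_max D1 D2).
  apply: filterS Osn => s Os; rewrite scale0r addr0 rhoE subrr subr_le0.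
  apply: rhole; first exact: OC.
  by rewrite /= tt1 ltW.
have trE : \tr (hess (fun z => rho (z, t)) x) <= M * \sum_(i < n) 'D_(dx i) ('D_(dx i) Psi) (x, t).
  by rewrite mulr_sumr; apply: ler_sum => i _; exact: space.
have := cs_equation sol (in_Q t0T Ox) => <-.
have trE' := ler_wpM2l (ltW hkd) trE.
apply: (le_trans (ler_wpM2l M0 (Psi_super Xq))); rewrite mulrBr; apply: lerB => //.
by rewrite mulrCA.
Unshelve. all: by end_near. Qed.

(** [rho - M Psi] is maximal with value zero at a lateral point, hence its normal
    derivative is nonnegative, by [one_sided_max] on the inward normal segment. *)
Lemma lateral_max (M tau t1 : R) x t : 0 < tau -> t1 < T -> tau < t <= t1 ->
  frontier (Om t) x -> 0 <= M -> rho (x, t) = M * Psi (x, t) ->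
  (forall p, thin_closed p -> tau <= p.2 <= t1 -> rho p <= M * Psi p) ->
  M * (eps * Psi (x, t)) <= psi (x, t).
Proof.
move=> tau0 t1T /andP[taut tt1] xF M0 rhoE rhole.
have t0T : 0 < t < T by rewrite (lt_trans tau0)//= (le_lt_trans tt1).
have t0T' : 0 <= t <= T by case/andP: t0T => *; rewrite !ltW.
have Xq := frontier_in_X hT hGam htube hwidth heps t0T xF.
have [xc _] := (thin_frontierP hT hGam htube hwidth heps x t0T).1 xF.
have [_ _ vin] := nueP t0T xF; set v := nue (x, t) in vin *.
have tQ : slab `]0, T] (fun t => frontier (Om t)) (x, t).
  by split=> //=; rewrite in_itv/=; case/andP: t0T => -> /ltW.
have Oin : \forall s \near (0 : R)^'+, Om t (x + s *: (- v)).
  by apply: filterS vin => s []; rewrite scalerN.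
have cv : (x + s *: (- v), t) @[s --> (0 : R)^'+] --> (x, t).
  apply: cvg_at_right_filter.
  have c : (x + s *: (- v), t) @[s --> (0 : R)] --> (x + (0 : R) *: (- v), t).
    apply: (@cvg_pair_nbhs _ _ _ (nbhs (0 : R))); last exact: cvg_cst.
    by apply: cvgD; [exact: cvg_cst|apply: cvgZr_tmp; exact: cvg_id].
  by rewrite scale0r addr0 in c.
pose r (s : R) := rho (x + s *: (- v), t).
pose r1 (s : R) := dotp (- v) (gr (x + s *: (- v), t)).
have rd : \forall s \near (0 : R)^'+, is_derive s (1 : R) r (r1 s).
  apply: filterS Oin => s Os.
  apply: (is_derive_line (fun z => rho (z, t)) x (- v) s _).1.
  exact: rho_differentiable.
have rc : r s @[s --> (0 : R)^'+] --> r 0.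
  have -> : r 0 = rho (x, t) by rewrite /r scale0r addr0.
  have /subspace_continuousP rc := rho_continuous.
  apply: cvg_comp (rc _ xc); apply: cvg_to_within cv _.
  by apply: filterS Oin => s Os; apply: (thin_domain_closed hGam htube hwidth heps).
have r1c : r1 s @[s --> (0 : R)^'+] --> dotp (- v) (gr (x, t)).
  have /subspace_continuousP gc := cs_grad_cont sol.
  have gx := gc (x, t) (or_intror tQ).
  have Sn : \forall s \near (0 : R)^'+,
      (slab `]0, T] Om `|` slab `]0, T] (fun t => frontier (Om t))) (x + s *: (- v), t).
    by apply: filterS Oin => s Os; left; exact: in_Q.
  have cw : (x + s *: (- v), t) @[s --> (0 : R)^'+] --> within (slab `]0, T] Om `|`
      slab `]0, T] (fun t => frontier (Om t))) (nbhs (x, t)) by exact: cvg_to_within cv Sn.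
  have gz : gr (x + s *: (- v), t) @[s --> (0 : R)^'+] --> gr (x, t) := cvg_comp _ _ cw gx.
  exact: (cvg_comp _ _ gz (@dotp_continuous R n (- v) (gr (x, t)))).
have DP : is_derive (0 : R) (1 : R) (fun s => M * Psi (x + s *: (- v), t))
    (M * dotp (- v) (sgrad Psi (x, t))).
  have H2 := (is_derive_slice_space Psi (x, t) (- v) _).1 (Psi_dv (- v) Xq).
  have H3 : is_derive (0 : R) (1 : R) (fun s => Psi (x + s *: (- v), t)) (dotp (- v) (sgrad Psi (x, t))).
    by apply: (is_derive_line (fun z => Psi (z, t)) x (- v) 0 _).1; rewrite scale0r addr0.
  exact: (is_deriveZ M H3).
have key : dotp (- v) (gr (x, t)) <= M * dotp (- v) (sgrad Psi (x, t)).
  apply: (one_sided_max rd rc r1c DP); apply: filterS Oin => s Os.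
  rewrite /r scale0r addr0 rhoE subrr subr_le0; apply: rhole => /=; last by rewrite tt1 ltW.
  exact: (thin_domain_closed hGam htube hwidth heps).
have := cs_boundary sol tQ; rewrite -/v rhoE => <-.
move: key; rewrite !dotpNl mulrN lerN2 => key.
have := ler_wpM2l M0 (Psi_robin t0T xF); rewrite -/v mulrDr => H.
apply: (le_trans H); apply: lerD => //.
by rewrite mulrCA.
Qed.

(** Were the maximum [M] of [rho / Psi] larger than [N], the maximum point would
    contradict the bound on the initial datum, on [f] or on [psi]. *)
Lemma comparison (N tau t1 : R) : 0 < tau -> t1 < T -> 0 <= N ->
  (forall x, thin_closed (x, tau) -> rho (x, tau) <= N * m) ->
  (forall x t, 0 < t < T -> Om t x -> f (x, t) <= N * m) ->
  (forall x t, 0 < t < T -> frontier (Om t) x -> psi (x, t) <= eps * (N * m)) ->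
  forall p, thin_closed p -> tau <= p.2 <= t1 -> rho p <= N * Psi p.
Proof.
move=> tau0 t1T N0 rhoN fN psiN p pc pt.
have /andP[e0 _] := heps.
pose D := thin_closed `&` [set q | tau <= q.2 <= t1].
have DX q : D q -> X q.
  move=> [qc /= /andP[q1 q2]]; apply: thin_interior qc.
  by rewrite (lt_le_trans tau0)//= (le_lt_trans q2).
have Dc : compact D.
  apply: compact_closedI; first exact: (thin_closed_compact hT hGam htube hwidth heps).
  have -> : [set q : ST | tau <= q.2 <= t1] = snd @^-1` `[tau, t1].
    by apply/seteqP; split=> q /=; rewrite in_itv.
  by apply: closed_comp => [q _|]; [exact: cvg_snd|exact: itv_closed].
have Psi0 q : D q -> 0 < Psi q by move=> /DX /Psi_ge; exact: lt_le_trans.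
have wc : {within D, continuous (fun q => rho q / Psi q)}.
  apply/subspace_continuousP => q Dq.
  have /subspace_continuousP rc : {within D, continuous rho}.
    by apply: continuous_subspaceW rho_continuous => z [].
  have Pc : Psi z @[z --> within D (nbhs q)] --> Psi q.
    by apply: cvg_within_filter; exact: Psi_cont (DX q Dq).
  apply: cvgM; first exact: rc.
  by apply: cvgV => //; rewrite gt_eqF// Psi0.
have Dp : D p by [].
have [[x t]] := compact_EVT_max (ex_intro _ p Dp) Dc wc.
rewrite inE => Dq wmax; set M := rho (x, t) / Psi (x, t) in wmax.
have rhole q : thin_closed q -> tau <= q.2 <= t1 -> rho q <= M * Psi q.
  move=> qc qt; have qD : D q by [].
  by rewrite -ler_pdivrMr ?Psi0//; apply: wmax; rewrite inE.
suff MN : M <= N by apply: (le_trans (rhole p pc pt)); rewrite ler_wpM2r// ltW// Psi0.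
have P0 := Psi0 _ Dq; have Pm := Psi_ge (DX _ Dq).
have rhoE : rho (x, t) = M * Psi (x, t) by rewrite /M divfK// gt_eqF.
rewrite leNgt; apply/negP => NM; have M0 : 0 <= M by rewrite ltW// (le_lt_trans N0).
have NmM : N * m < M * Psi (x, t).
  apply: (@lt_le_trans _ _ (M * m)); first by rewrite ltr_pM2r.
  by rewrite ler_wpM2l.
have [xc /= /andP[q1 q2]] := Dq.
have [tE|tn] := eqVneq t tau.
  have := rhoN x; rewrite -tE => /(_ xc); rewrite rhoE leNgt NmM//.
have taut : tau < t <= t1 by rewrite lt_neqAle eq_sym tn q1.
have t0T : 0 < t < T by rewrite (lt_le_trans tau0)//= (le_lt_trans q2).
have [Ox|xF] := thin_closed_split t0T xc.
  have := interior_max tau0 t1T taut Ox M0 rhoE rhole.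
  by move=> /le_trans /(_ (fN x t t0T Ox)); rewrite leNgt NmM.
have := lateral_max tau0 t1T taut xF M0 rhoE rhole.
move=> /le_trans /(_ (psiN x t t0T xF)).
by rewrite mulrCA ler_pM2l// leNgt NmM.
Qed.

End comparison.

(** * Initial and final times *)

Section conclusion.
Variables (R : realType) (n : nat) (T : R).
Variables (Gam : R -> set 'rV[R]_n) (nu Phi : 'rV[R]_n * R -> 'rV[R]_n).
Variables (delta : R) (proj : 'rV[R]_n * R -> 'rV[R]_n).
Variables (g0 g1 : 'rV[R]_n * R -> R) (eps0 eps kd : R).
Hypotheses (hT : 0 < T) (hGam : moving_surface T Gam nu Phi)
  (htube : tubular_neighborhood T Gam nu delta proj)
  (hwidth : thin_width T Gam delta g0 g1 eps0) (heps : 0 < eps < eps0) (hkd : 0 < kd).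
Local Notation ST := ('rV[R]_n * R)%type.
Local Notation Om := (thin_domain Gam nu g0 g1 eps).
Local Notation thin_closed := (thin_closed T Gam delta proj g0 g1 eps).
Local Notation surface := (slab `[0, T] Gam).

(** A point at time [T] is the limit of the points obtained from it by following
    the flow backwards at a constant relative height. *)
Lemma final_time (h : ST -> R) (B : R) : {within thin_closed, continuous h} ->
  (forall p, thin_closed p -> p.2 < T -> h p <= B) ->
  forall p, thin_closed p -> h p <= B.
Proof.
move=> hc hB p pc; have [pT|Tp] := ltP p.2 T; first exact: hB.
move: (pc); rewrite (thin_closed_image hGam htube hwidth heps).
move=> [[[y t] th] [/= [/= t0T Gy] th01] pE].
rewrite in_itv/= in t0T.
have tT : t = T by apply/eqP; rewrite eq_le; move: Tp; rewrite -pE /= => ->; case/andP: t0T => _ ->.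
have [z Gz yE] := surface_flow hGam t0T Gy.
pose c (s : R) : ST := fermi nu (height g0 g1 eps) ((Phi (z, s), s), th).
have fc : {within `[0, T], continuous (fun s : R => (Phi (z, s), s))}.
  have zc : {within `[0, T], continuous (fun s : R => (z, s))}.
    apply: continuous_subspaceT => s.
    exact: (@cvg_pair_nbhs _ _ _ (nbhs s) _ (cst z) id z s (cvg_cst _) cvg_id).
  exact: (within_continuous_comp zc (flow_continuous hGam)).
have fc' : {within `[0, T], continuous (fun s : R => ((Phi (z, s), s), th))}.
  move/subspace_continuousP : fc => fc; apply/subspace_continuousP => s sT.
  exact: (cvg_pair_nbhs (fc s sT) (cvg_cst _)).
have hc' : {within surface `*` `[0, 1], continuous (fermi nu (height g0 g1 eps))}.
  exact (fermi_continuous htube (@height_continuous R n T Gam delta g0 g1 eps0 eps hwidth)).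
have flowS s : [set` `[0, T]] s -> (surface `*` `[0, 1]) ((Phi (z, s), s), th).
  move=> sI; have s0T : 0 <= s <= T by move: sI; rewrite /= in_itv.
  by split=> //; split; [exact: sI|exact: (flow_surface hGam s0T Gz)].
have cc : {within `[0, T], continuous c} := within_continuous_comp fc' hc' flowS.
have cin s : [set` `[0, T]] s -> thin_closed (c s).
  move=> sT; rewrite (thin_closed_image hGam htube hwidth heps).
  by exists ((Phi (z, s), s), th); first exact: flowS.
have hcc : {within `[0, T], continuous (h \o c)} by exact: within_continuous_comp cc hc cin.
have [_ _ hT'] := (continuous_within_itvP (h \o c) hT).1 hcc.
have -> : p = c T by rewrite -pE /c -tT -yE.
rewrite leNgt; apply/negP => BT.
have H1 : \forall s \near T^'-, B < (h \o c) s by move: hT' => /cvgr_gt; exact.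
have H2 : \forall s \near T^'-, 0 < s by exact: nbhs_left_gt.
have H3 : \forall s \near T^'-, s < T by exact: nbhs_left_lt.
have H123 : \forall s \near T^'-, [/\ B < (h \o c) s, 0 < s & s < T].
  by apply: filterS3 H1 H2 H3.
have [s [s1 s2 s3]] := @filter_ex _ _ (at_left_proper_filter T) _ H123.
have : h (c s) <= B by apply: hB => //; apply: cin; rewrite /= in_itv/= !ltW.
by rewrite leNgt s1.
Qed.

(** A covering argument: near a point with [t > 0] the condition is void for small
    [tau], near an initial point it follows from continuity. *)
Lemma initial_layer (h : ST -> R) (B C : R) : {within thin_closed, continuous h} ->
  B < C -> (forall x, thin_closed (x, 0) -> h (x, 0) <= B) ->
  \forall tau \near (0 : R)^'+, forall x, thin_closed (x, tau) -> h (x, tau) <= C.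
Proof.
move=> /subspace_continuousP hc BC hB.
have /compact_near_coveringP Kc := thin_closed_compact hT hGam htube hwidth heps.
have := @Kc R (0 : R)^'+ (fun tau q => thin_closed q -> q.2 = tau -> h q <= C) _.
have H : forall q, thin_closed q -> \forall q' \near q & tau \near (0 : R)^'+,
    thin_closed q' -> q'.2 = tau -> h q' <= C.
  move=> [x t] qc; have [/= /andP[t0 tT] _ _] := qc.
  have [t00|tp] := eqVneq t 0.
    have hx : h (x, t) < C by rewrite (le_lt_trans _ BC)// t00; apply: hB; rewrite -t00.
    have hn : \forall q' \near (x, t), thin_closed q' -> h q' < C.
      by have := hc _ qc; move=> /cvgr_lt /(_ _ hx); rewrite near_withinE.
    exists ([set q' | thin_closed q' -> h q' < C], setT); first by split=> //; exact: filterT.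
    by move=> [q' tau] /= [qh _] qc' _; rewrite ltW// qh.
  have t2 : 0 < t / 2 by rewrite divr_gt0// lt_def tp.
  exists ([set q' | t / 2 < q'.2], [set tau | tau < t / 2]).
    split; last exact: nbhs_right_lt.
    have cs : q.2 @[q --> (x, t)] --> t by exact: cvg_snd.
    by move: cs => /cvgr_gt; apply; rewrite ltr_pdivrMr// ltr_pMr ?ltr1n// lt_def tp.
  move=> [q' tau] /= [q1 q2] _ E; move: q1; rewrite E => q1.
  by have := lt_trans q1 q2; rewrite ltxx.
move=> /(_ _ H); apply: filterS => tau Htau x xc.
exact: (Htau (x, tau)).
Qed.

Lemma closure_le (h : 'rV[R]_n -> R) (A : set 'rV[R]_n) (B : R) :
  {within closure A, continuous h} -> (forall x, A x -> h x <= B) ->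
  forall x, closure A x -> h x <= B.
Proof.
move=> /subspace_continuousP hc hB x xA; rewrite leNgt; apply/negP => Bx.
have : \forall z \near x, closure A z -> B < h z.
  by have := hc x xA; move=> /cvgr_gt /(_ _ Bx); rewrite near_withinE.
move=> /xA [z [Az zB]]; have := hB z Az; rewrite leNgt zB//.
exact: subset_closure.
Qed.

Variables (nue : ST -> 'rV[R]_n) (Ve : ST -> R).
Hypothesis nueP : forall x t, 0 < t < T -> frontier (Om t) x ->
  outward_unit_normal (Om t) (frontier (Om t)) x (nue (x, t)).
Hypothesis VeP : forall x t, 0 < t < T -> frontier (Om t) x ->
  normal_velocity T (fun s => frontier (Om s)) t x (nue (x, t)) (Ve (x, t)).

Lemma classical_solution_opp rho0 f psi rho gr rt :
  classical_solution_with T kd Om nue Ve rho0 f psi rho gr rt ->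
  classical_solution_with T kd Om nue Ve (fun x => - rho0 x) (fun p => - f p)
    (fun p => - psi p) (fun p => - rho p) (fun p => - gr p) (fun p => - rt p).
Proof.
move=> sol.
have Oo t : 0 <= t <= T -> open (Om t) := @thin_domain_open _ _ _ _ _ _ _ _ _ _ _ _ hGam htube hwidth heps t.
have Q_itv x t : slab `]0, T] Om (x, t) -> 0 <= t <= T /\ Om t x.
  by move=> [/=]; rewrite in_itv/= => /andP[/ltW -> ->].
have rd x t i : slab `]0, T] Om (x, t) ->
    is_derive x (delta_mx 0 i) (fun z => rho (z, t)) (gr (x, t) 0 i).
  exact: (cs_grad sol).
have DN x t i : slab `]0, T] Om (x, t) ->
    'D_(delta_mx 0 i) (fun z => - rho (z, t)) x = - 'D_(delta_mx 0 i) (fun z => rho (z, t)) x.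
  by move=> xQ; have [d _] := rd x t i xQ; have [_] := is_deriveN (derivableP d).
have On x t : slab `]0, T] Om (x, t) -> \forall z \near x, slab `]0, T] Om (z, t).
  move=> xQ; have [t0T Ox] := Q_itv x t xQ.
  apply: filterS (open_nbhs_nbhs (conj (Oo t t0T) Ox)) => z Oz.
  by case: xQ.
have HN x t i j : slab `]0, T] Om (x, t) ->
    is_derive x (delta_mx 0 i) ('D_(delta_mx 0 j) (fun z => - rho (z, t)))
      (- 'D_(delta_mx 0 i) ('D_(delta_mx 0 j) (fun z => rho (z, t))) x).
  move=> xQ.
  have dd : derivable ('D_(delta_mx 0 j) (fun z => rho (z, t))) x (delta_mx 0 i).
    exact: (cs_hess sol).
  apply: near_eq_is_derive (is_deriveN (derivableP dd)).
  by apply: filterS (On x t xQ) => z zQ; rewrite DN.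
have hessN x t : slab `]0, T] Om (x, t) ->
    hess (fun z => - rho (z, t)) x = - hess (fun z => rho (z, t)) x.
  by move=> xQ; apply/matrixP => i j; rewrite !mxE; have [_ ->] := HN x t i j xQ.
split.
- by move=> p; apply: cvgN; exact: (cs_cont sol).
- by move=> x t i xQ; rewrite mxE; exact: (is_deriveN (rd x t i xQ)).
- by move=> p; apply: cvgN; exact: (cs_grad_cont sol).
- by move=> x t i j xQ; case: (HN x t i j xQ).
- move=> i j.
  have hc : {within slab `]0, T] Om, continuous
      (fun p : ST => hess (fun z => rho (z, p.2)) p.1 i j)} by exact: (cs_hess_cont sol).
  apply: (@subspace_eq_continuous _ _ _ (fun p : ST => - (hess (fun z => rho (z, p.2)) p.1 i j))).
    move=> [x t]; rewrite inE => xQ.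
    have E : hess (fun z => - rho (z, t)) x i j = - hess (fun z => rho (z, t)) x i j.
      by rewrite hessN// mxE.
    exact/esym/E.
  by move=> p; apply: cvgN; exact: hc.
- move=> x t xQ; have H := cs_time sol xQ.
  rewrite /is_time_derivative (_ : (fun h => _) =
      (fun h => - (h^-1 * (rho (x, t + h) - rho (x, t))))); first exact: cvgN H.
  by apply/funext => h; rewrite -mulrN opprD.
- by move=> p; apply: cvgN; exact: (cs_time_cont sol).
- move=> x t xQ; rewrite hessN// raddfN/= mulrN opprK -(cs_equation sol xQ) opprB addrC//.
- move=> p pQ; rewrite -(cs_boundary sol pQ) dotpNr mulrN opprD//.
- by move=> x Ox; rewrite (cs_initial sol Ox).
Qed.

Variables (Psi : ST -> R) (m M : R).
Local Notation X := (tube_interior T Gam delta).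
Local Notation dx i := ((delta_mx 0 i, 0) : ST).
Local Notation dt := (((0 : 'rV[R]_n), (1 : R)) : ST).
Hypotheses (m_gt0 : 0 < m) (Psi_itv : forall q, X q -> m <= Psi q <= M)
  (Psi_cont : forall q, X q -> {for q, continuous Psi})
  (Psi_D : forall q, X q -> is_derive q dt Psi ('D_dt Psi q) /\
     forall v, is_derive q (v, 0) Psi (dotp v (sgrad Psi q)))
  (Psi_dxx : forall q i, X q -> derivable ('D_(dx i) Psi) q (dx i))
  (Psi_super : forall q, X q ->
    Psi q <= 'D_dt Psi q - kd * \sum_(i < n) 'D_(dx i) ('D_(dx i) Psi) q)
  (Psi_robin : forall x t v V, 0 < t < T -> frontier (Om t) x ->
     outward_unit_normal (Om t) (frontier (Om t)) x v ->
     normal_velocity T (fun s => frontier (Om s)) t x v V ->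
     eps * Psi (x, t) <= dotp v (sgrad Psi (x, t)) + kd^-1 * V * Psi (x, t)).

(** The time derivative of the signed distance, hence the barrier, is meaningful
    for [0 < t < T] only. The comparison therefore starts at a small [tau > 0], with
    the initial bound relaxed by [eta] according to [initial_layer]. *)
Lemma upper_bound rho0 f psi rho (N : R) :
  classical_solution T kd Om nue Ve rho0 f psi rho -> 0 <= N -> m <= M ->
  (forall x, Om 0 x -> rho0 x <= N * m) ->
  (forall x t, 0 < t < T -> Om t x -> f (x, t) <= N * m) ->
  (forall x t, 0 < t < T -> frontier (Om t) x -> psi (x, t) <= eps * (N * m)) ->
  forall p, thin_closed p -> rho p <= N * M.
Proof.
move=> [gr [rt sol]] N0 mM rN fN psiN.
have rc := rho_continuous hT hGam htube hwidth heps sol.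
have T0 : 0 <= (0 : R) <= T by rewrite lexx ltW.
have init x : thin_closed (x, 0) -> rho (x, 0) <= N * m.
  move=> xc; have /(closure_thinP hT hGam htube hwidth heps x T0) xO := xc.
  apply: (@closure_le (fun x => rho (x, 0)) (Om 0)) xO.
    apply: (@within_continuous_comp _ _ _ _ thin_closed (fun x => (x, 0)) rho) => //.
      apply: continuous_subspaceT => z.
      exact: (@cvg_pair_nbhs _ _ _ (nbhs z) _ id (cst 0) z 0 cvg_id (cvg_cst _)).
    by move=> z /(closure_thinP hT hGam htube hwidth heps z T0).
  by move=> z Oz; rewrite (cs_initial sol Oz); exact: rN.
apply: (final_time rc) => -[x t] pc /= tT.
have [/= /andP[t0 _] _ _] := pc.
have [t00|tp] := eqVneq t 0.
  by rewrite t00 (le_trans (init x _))// -?t00// ler_wpM2l.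
have t0T : 0 < t < T by rewrite lt_def tp t0.
have Xq : X (x, t) by exact: thin_interior pc.
have /andP[Pm PM] := Psi_itv Xq.
suff : rho (x, t) <= N * Psi (x, t) by move=> H; apply: (le_trans H); rewrite ler_wpM2l.
apply/ler_addgt0Pr => e e0.
have P0 : 0 < Psi (x, t) by apply: lt_le_trans Pm.
pose eta := e / Psi (x, t); have eta0 : 0 < eta by rewrite divr_gt0.
have Nlt : N * m < (N + eta) * m by rewrite ltr_pM2r// ltrDl.
have H1 := initial_layer rc Nlt init.
have H2 : \forall tau \near (0 : R)^'+, 0 < tau by exact: nbhs_right_gt.
have H3 : \forall tau \near (0 : R)^'+, tau < t by apply: nbhs_right_lt; case/andP: t0T.
have H123 : \forall tau \near (0 : R)^'+,
    [/\ forall z, thin_closed (z, tau) -> rho (z, tau) <= (N + eta) * m, 0 < tau & tau < t].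
  by apply: filterS3 H1 H2 H3.
have [tau [tau1 tau2 tau3]] := @filter_ex _ _ (at_right_proper_filter 0) _ H123.
have -> : N * Psi (x, t) + e = (N + eta) * Psi (x, t).
  by rewrite mulrDl /eta divfK// gt_eqF.
have NN : N * m <= (N + eta) * m by exact: ltW.
apply: (@comparison R n T Gam nu Phi delta proj g0 g1 eps0 eps kd hT hGam htube hwidth heps hkd
  nue Ve rho0 f psi rho gr rt sol nueP Psi m m_gt0 _ Psi_cont _ _ Psi_dxx Psi_super _ (N + eta) tau t) => //.
- by move=> q /Psi_itv /andP[].
- by move=> q /Psi_D [].
- by move=> q v /Psi_D [].
- by move=> z s s0T zF; apply: Psi_robin => //; [exact: nueP|exact: VeP].
- by rewrite addr_ge0// ltW.
- by move=> z s s0T Oz; rewrite (le_trans (fN z s s0T Oz)).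
- move=> z s s0T zF; rewrite (le_trans (psiN z s s0T zF))//.
  by rewrite ler_wpM2l//; case/andP: heps => /ltW.
- by rewrite /= lexx andbT ltW.
Qed.

Lemma two_sided_bound rho0 f psi rho (N : R) :
  classical_solution T kd Om nue Ve rho0 f psi rho -> 0 <= N -> m <= M ->
  (forall x, Om 0 x -> `|rho0 x| <= N * m) ->
  (forall x t, 0 < t < T -> Om t x -> `|f (x, t)| <= N * m) ->
  (forall x t, 0 < t < T -> frontier (Om t) x -> `|psi (x, t)| <= eps * (N * m)) ->
  forall p, thin_closed p -> `|rho p| <= N * M.
Proof.
move=> sol N0 mM rN fN psiN p pc; rewrite ler_norml; apply/andP; split; last first.
  apply: (upper_bound sol N0 mM) => // [x Ox|x t t0T Ox|x t t0T xF].
  - exact: le_trans (ler_norm _) (rN x Ox).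
  - exact: le_trans (ler_norm _) (fN x t t0T Ox).
  - exact: le_trans (ler_norm _) (psiN x t t0T xF).
have [gr [rt sol']] := sol.
have solN : classical_solution T kd Om nue Ve (fun x => - rho0 x) (fun p => - f p)
    (fun p => - psi p) (fun p => - rho p).
  by eexists; eexists; exact: classical_solution_opp sol'.
rewrite lerNl; apply: (upper_bound solN N0 mM) => // [x Ox|x t t0T Ox|x t t0T xF].
- by rewrite (le_trans _ (rN x Ox))// -normrN ler_norm.
- by rewrite (le_trans _ (fN x t t0T Ox))// -normrN ler_norm.
- by rewrite (le_trans _ (psiN x t t0T xF))// -normrN ler_norm.
Qed.

End conclusion.

(** * The uniform estimate *)

Section supnorm.
Variables (R : realType) (T : Type).
Implicit Types (A : set T) (f : T -> R).

Lemma supnorm_ge A f p : A p -> (`|f p|%:E <= supnorm A f)%E.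
Proof. by move=> Ap; apply: ereal_sup_ubound; exists p. Qed.

Lemma supnorm_ge0 A f : A !=set0 -> (0 <= supnorm A f)%E.
Proof. by move=> [p Ap]; apply: le_trans (supnorm_ge f Ap); rewrite lee_fin. Qed.

Lemma supnorm_le A f (B : R) : (forall p, A p -> `|f p| <= B) -> (supnorm A f <= B%:E)%E.
Proof. by move=> fB; apply: ub_ereal_sup => _ [p Ap <-]; rewrite lee_fin fB. Qed.

End supnorm.

Lemma scale_lty (R : realType) (c : R) (x : \bar R) : 0 < c -> (0 <= x)%E ->
  (c%:E * x < +oo)%E -> exists r : R, x = r%:E.
Proof.
move=> c0; case: x => [r| |] //; first by exists r.
by rewrite mulry gtr0_sg// mul1e.
Qed.

Section nonempty.
Variables (R : realType) (n : nat) (T : R).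
Variables (Gam : R -> set 'rV[R]_n) (nu Phi : 'rV[R]_n * R -> 'rV[R]_n).
Variables (delta : R) (proj : 'rV[R]_n * R -> 'rV[R]_n).
Variables (g0 g1 : 'rV[R]_n * R -> R) (eps0 eps : R).
Hypotheses (hT : 0 < T) (hGam : moving_surface T Gam nu Phi)
  (htube : tubular_neighborhood T Gam nu delta proj)
  (hwidth : thin_width T Gam delta g0 g1 eps0) (heps : 0 < eps < eps0).
Local Notation Om := (thin_domain Gam nu g0 g1 eps).

Lemma thin_domain_nonempty t : 0 <= t <= T -> Om t !=set0.
Proof.
move=> t0T; have [[y Gy] _] := ms_hypersurface hGam t0T.
have [c c0 cg] := gap_pos hwidth; have /andP[e0 _] := heps.
have gy : c <= g1 (y, t) - g0 (y, t) by apply: cg; split=> //=; rewrite in_itv.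
exists (y + (eps * ((g0 (y, t) + g1 (y, t)) / 2)) *: nu (y, t)).
exists y, (eps * ((g0 (y, t) + g1 (y, t)) / 2)); split=> //.
by rewrite !ltr_pM2l//; apply/andP; split; lra.
Qed.

Lemma frontier_thin_nonempty t : 0 < t < T -> frontier (Om t) !=set0.
Proof.
move=> t0T; have t0T' := ltW_itv t0T.
have [[y Gy] _] := ms_hypersurface hGam t0T'.
have Sy : slab `[0, T] Gam (y, t) by split=> //=; rewrite in_itv.
have h01 : 0 <= (1 : R) <= 1 by rewrite ler01 lexx.
have [_ hd] := height_bounds htube hwidth heps Sy h01.
have hE : height g0 g1 eps (y, t) 1 = eps * g1 (y, t) by rewrite /height; ring.
exists (y + height g0 g1 eps (y, t) 1 *: nu (y, t)).
apply/(thin_frontierP hT hGam htube hwidth heps _ t0T); split; last first.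
  by right; rewrite (dist_normal_line hGam htube)// (pull_normal_line hGam htube).
rewrite (thin_closed_image hGam htube hwidth heps).
by exists ((y, t), 1) => //; split=> //=; rewrite in_itv.
Qed.

End nonempty.
Theorem theorem3p4 (R : realType) (n : nat) (hn : (2 <= n)%N)
    (T : R) (hT : 0 < T)
    (Gam : R -> set 'rV[R]_n) (nu Phi : 'rV[R]_n * R -> 'rV[R]_n)
    (hGam : moving_surface T Gam nu Phi)
    (delta : R) (proj : 'rV[R]_n * R -> 'rV[R]_n)
    (htube : tubular_neighborhood T Gam nu delta proj)
    (g0 g1 : 'rV[R]_n * R -> R) (eps0 : R)
    (hwidth : thin_width T Gam delta g0 g1 eps0)
    (kd : R) (hkd : 0 < kd) :
  exists2 cT : R, 0 < cT &
  forall (eps : R), 0 < eps < eps0 ->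
  let Om := thin_domain Gam nu g0 g1 eps in
  let Q := slab `]0, T] Om in
  let dQ := slab `]0, T] (fun t => frontier (Om t)) in
  let Qbar := slab `[0, T] (fun t => closure (Om t)) in
  forall (nue : 'rV[R]_n * R -> 'rV[R]_n) (Ve : 'rV[R]_n * R -> R),
  (forall x t, dQ (x, t) ->
     outward_unit_normal (Om t) (frontier (Om t)) x (nue (x, t))) ->
  (forall x t, dQ (x, t) ->
     normal_velocity T (fun s => frontier (Om s)) t x (nue (x, t))
       (Ve (x, t))) ->
  forall (rho0 : 'rV[R]_n -> R) (f psi rho : 'rV[R]_n * R -> R),
  {within closure (Om 0), continuous rho0} ->
  {within Q, continuous f} ->
  {within dQ, continuous psi} ->
  classical_solution T kd Om nue Ve rho0 f psi rho ->
  let rhs := (cT%:E * (supnorm (closure (Om 0%R)) rho0 + supnorm Q f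
                       + eps^-1%:E * supnorm dQ psi))%E in
  (rhs < +oo)%E ->
  (supnorm Qbar rho <= rhs)%E.
Proof.
have [m [M [m0 M0 HPsi]]] := barrier_exists hT hGam htube hwidth hkd.
(* [N Psi] with [N m] equal to the sum [C] of the three norms dominates [rho], and
   [Psi <= M]. *)
exists (M / m); first by rewrite divr_gt0.
move=> eps heps Om Q dQ Qbar nue Ve nueH VeH rho0 f psi rho _ _ _ sol rhs rhs_fin.
have /andP[e0 _] := heps.
have Qin x t : 0 < t < T -> Om t x -> Q (x, t).
  by move=> /andP[t0 tT] Ox; split=> //=; rewrite in_itv/= t0 ltW.
have dQin x t : 0 < t < T -> frontier (Om t) x -> dQ (x, t).
  by move=> /andP[t0 tT] Ox; split=> //=; rewrite in_itv/= t0 ltW.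
(* The sets of the statement are not empty, otherwise a supremum would be [-oo]. *)
have half : 0 < T / 2 < T by lra.
have T0 : 0 <= (0 : R) <= T by rewrite lexx ltW.
have [x0 Ox0] := thin_domain_nonempty hGam hwidth heps T0.
have [x1 Ox1] := thin_domain_nonempty hGam hwidth heps (ltW_itv half).
have [x2 Fx2] := frontier_thin_nonempty hT hGam htube hwidth heps half.
have S0 : (0 <= supnorm (closure (Om 0%R)) rho0)%E.
  by apply: supnorm_ge0; exists x0; exact: subset_closure.
have F0 : (0 <= supnorm Q f)%E by apply: supnorm_ge0; exists (x1, T / 2); exact: Qin.
have P0 : (0 <= supnorm dQ psi)%E by apply: supnorm_ge0; exists (x2, T / 2); exact: dQin.
have P0' : (0 <= eps^-1%:E * supnorm dQ psi)%E.
  by rewrite mule_ge0// lee_fin invr_ge0 ltW.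
have [s sE] := scale_lty (divr_gt0 M0 m0) (adde_ge0 (adde_ge0 S0 F0) P0') rhs_fin.
have fin (a : \bar R) : (0 <= a)%E -> (a <= s%:E)%E -> exists r : R, a = r%:E.
  by case: a => [r| |]//; exists r.
have [S SE] : exists r : R, supnorm (closure (Om 0)) rho0 = r%:E.
  by apply: fin => //; rewrite -sE -addeA leeDl// adde_ge0.
have [F FE] : exists r : R, supnorm Q f = r%:E.
  by apply: fin => //; rewrite -sE addeAC leeDr// adde_ge0.
have [P' P'E] : exists r : R, (eps^-1%:E * supnorm dQ psi)%E = r%:E.
  by apply: fin => //; rewrite -sE leeDr// adde_ge0.
have Pfin : (eps^-1%:E * supnorm dQ psi < +oo)%E by rewrite P'E ltry.
have ei0 : 0 < eps^-1 by rewrite invr_gt0.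
have [P PE] := scale_lty ei0 P0 Pfin.
rewrite SE lee_fin in S0; rewrite FE lee_fin in F0; rewrite PE lee_fin in P0.
pose C := S + F + eps^-1 * P.
have rhsE : rhs = (C / m * M)%:E.
  transitivity ((M / m * C)%:E); first by rewrite /rhs SE FE PE.
  by congr (_%:E); rewrite mulrAC [M * C]mulrC mulrAC.
have eP0 : 0 <= eps^-1 * P by rewrite mulr_ge0// invr_ge0 ltW.
have Cm : C / m * m = C by rewrite divfK// gt_eqF.
have C0 : 0 <= C / m by rewrite divr_ge0 ?(ltW m0)// !addr_ge0.
have [Psi [Psi_itv Psi_cont Psi_D Psi_dxx [Psi_super Psi_robin]]] := HPsi eps heps.
have mM : m <= M.
  have := Psi_itv _ (frontier_in_X hT hGam htube hwidth heps half Fx2).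
  by move=> /andP[]; exact: le_trans.
rewrite rhsE; apply: supnorm_le => p.
rewrite /Qbar (Qbar_thin_closed hT hGam htube hwidth heps).
apply: (two_sided_bound hT hGam htube hwidth heps hkd _ _ m0 Psi_itv Psi_cont Psi_D Psi_dxx
  Psi_super Psi_robin sol C0 mM) => //.
- by move=> x t t0T xF; apply: nueH; exact: dQin.
- by move=> x t t0T xF; apply: VeH; exact: dQin.
- move=> x Ox; rewrite Cm; apply: (@le_trans _ _ S); last by rewrite /C -addrA lerDl addr_ge0.
  by rewrite -lee_fin -SE; apply: supnorm_ge; exact: subset_closure.
- move=> x t t0T Ox; rewrite Cm; apply: (@le_trans _ _ F); last by rewrite /C addrAC lerDr addr_ge0.
  by rewrite -lee_fin -FE; apply: supnorm_ge; exact: Qin.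
- move=> x t t0T xF; rewrite Cm; apply: (@le_trans _ _ P).
    by rewrite -lee_fin -PE; apply: supnorm_ge; exact: dQin.
  rewrite /C mulrDr mulrA divff ?gt_eqF// mul1r lerDr.
  by rewrite mulr_ge0 ?addr_ge0// ltW.
Qed.
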